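(* Let $n\geq 2$. The following groups have the $R_\infty$-property: (a) the unrestricted virtual pure braid group $UVP_n$; (b) the unrestricted virtual braid group $UVB_n$; (c) the virtual braid group $VB_n$. Further, for $n=2,3,4$ the welded braid group $WB_n$ also has the $R_\infty$-property, and for $n=2$ the virtual pure braid group $VP_2$, the welded pure braid group $WP_2$ and the unrestricted virtual pure braid group $UVP_2$ also have the $R_\infty$-property.
   Context: For an endomorphism $\alpha$ of a group $G$, elements $x,y\in G$ are twisted conjugate (via $\alpha$) if $x=zy\alpha(z)^{-1}$ for some $z\in G$; this is an equivalence relation and the number of its classes (a positive integer or $\infty$) is the Reidemeister number $R(\alpha)$. A group $G$ has the $R_\infty$-property if $R(\alpha)=\infty$ for every automorphism $\alpha$ of $G$. For $n\ge 2$, the virtual braid group $VB_n$ is the group generated by $\sigma_i,v_i$ ($1\le i\le n-1$) with relations: $\sigma_i\sigma_{i+1}\sigma_i=\sigma_{i+1}\sigma_i\sigma_{i+1}$ ($1\le i\le n-2$); $\sigma_i\sigma_j=\sigma_j\sigma_i$ ($|i-j|\ge2$); $v_iv_{i+1}v_i=v_{i+1}v_iv_{i+1}$ ($1\le i\le n-2$); $v_iv_j=v_jv_i$ ($|i-j|\ge 2$); $v_i^2=1$ ($1\le i\le n-1$); $\sigma_iv_j=v_j\sigma_i$ ($|i-j|\ge 2$); $v_iv_{i+1}\sigma_i=\sigma_{i+1}v_iv_{i+1}$ ($1\le i\le n-2$). The welded braid group $WB_n$ is the quotient of $VB_n$ obtained by adding the relations $v_i\sigma_{i+1}\sigma_i=\sigma_{i+1}\sigma_iv_{i+1}$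 ($1\le i\le n-2$). The unrestricted virtual braid group $UVB_n$ is the quotient of $VB_n$ obtained by adding both the relations $v_i\sigma_{i+1}\sigma_i=\sigma_{i+1}\sigma_iv_{i+1}$ and $v_{i+1}\sigma_i\sigma_{i+1}=\sigma_i\sigma_{i+1}v_i$ ($1\le i\le n-2$). Let $\tau_i=(i,i+1)\in S_n$. The homomorphism $\pi_P\colon VB_n\to S_n$, $\pi_P(\sigma_i)=\pi_P(v_i)=\tau_i$, induces homomorphisms $WB_n\to S_n$ and $UVB_n\to S_n$. The kernels of these three homomorphisms on $VB_n$, $WB_n$, $UVB_n$ are $VP_n$, $WP_n$, $UVP_n$ respectively. *)

(* Defs.v *)
From HB Require Import structures.
From mathcomp Require Import all_boot all_fingroup generic_quotient finmap zify.
From mathcomp Require Import boolp classical_sets cardinality.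

Set Implicit Arguments.
Unset Strict Implicit.
Unset Printing Implicit Defensive.

Local Open Scope quotient_scope.
Local Open Scope group_scope.

Section MultiplicativeGroups.
Variables (G H : groupType) (f : {multiplicative G -> H}).

Lemma group_hom1 : f 1 = 1.
Proof. by apply: (mulIg (f 1)); rewrite -gmulfM !mul1g. Qed.

Lemma group_homV x : f x^-1 = (f x)^-1.
Proof. by apply: (mulIg (f x)); rewrite -gmulfM !mulVg group_hom1. Qed.

End MultiplicativeGroups.

Section TwistedConjugacy.
Variables (G : groupType) (alpha : {multiplicative G -> G}).

Definition twisted_conj (x y : G) : Prop :=
  exists z : G, x = z * y * (alpha z)^-1.

Lemma twisted_conj_refl x : twisted_conj x x.
Proof. by exists 1; rewrite group_hom1 invg1 mul1g mulg1. Qed.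

Lemma twisted_conj_sym x y : twisted_conj x y -> twisted_conj y x.
Proof.
by case=> z ->; exists z^-1; rewrite group_homV invgK !mulgA mulVg mul1g mulgKV.
Qed.

Lemma twisted_conj_trans x y z :
  twisted_conj x y -> twisted_conj y z -> twisted_conj x z.
Proof.
by case=> a -> [b ->]; exists (a * b); rewrite gmulfM invMg !mulgA.
Qed.

Definition twisted_class (x : G) : set G := [set y | twisted_conj x y]%classic.

Definition reidemeister_classes : set (set G) := range twisted_class.

(* None stands for infinity. *)
Definition reidemeister_number : option nat :=
  if `[< finite_set reidemeister_classes >]
  then Some #|` fset_set reidemeister_classes|%fset
  else None.

Lemma reidemeister_number_infty :
  reidemeister_number = None <-> infinite_set reidemeister_classes.
Proof. by rewrite /reidemeister_number; case: asboolP. Qed.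

End TwistedConjugacy.

Definition R_infinity (G : groupType) : Prop :=
  forall alpha : {multiplicative G -> G},
    bijective alpha -> reidemeister_number alpha = None.

Section Presentation.
Variable X : choiceType.

(* The letter (x, false) is the generator x and (x, true) its inverse. *)
Definition word := seq (X * bool).

Definition winv (u : word) : word := rev [seq (a.1, ~~ a.2) | a <- u].

Variable rel : word -> word -> Prop.

(* The defining relations are l = r for all l, r such that rel l r. *)
Inductive pres_cong : word -> word -> Prop :=
| pres_refl u : pres_cong u u
| pres_sym u v : pres_cong u v -> pres_cong v u
| pres_trans u v w : pres_cong u v -> pres_cong v w -> pres_cong u w
| pres_cancel u x b w :
    pres_cong (u ++ (x, b) :: (x, ~~ b) :: w) (u ++ w)
| pres_rel u l r w : rel l r -> pres_cong (u ++ l ++ w) (u ++ r ++ w).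

Definition pres_congb (u v : word) : bool := `[< pres_cong u v >].

Lemma pres_congb_refl : reflexive pres_congb.
Proof. by move=> u; apply/asboolP; apply: pres_refl. Qed.

Lemma pres_congb_sym : symmetric pres_congb.
Proof. by move=> u v; apply/asboolP/asboolP; apply: pres_sym. Qed.

Lemma pres_congb_trans : transitive pres_congb.
Proof.
by move=> v u w /asboolP uv /asboolP vw; apply/asboolP; apply: pres_trans vw.
Qed.

Canonical pres_equiv :=
  EquivRel pres_congb pres_congb_refl pres_congb_sym pres_congb_trans.

Definition presented : Type := {eq_quot pres_equiv}.

HB.instance Definition _ := Choice.on presented.
HB.instance Definition _ := EqQuotient.on presented.

Definition class_of_word (u : word) : presented := (\pi_presented u)%qT.
Definition word_of_class (p : presented) : word := repr p.

Lemma class_of_wordK p : class_of_word (word_of_class p) = p.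
Proof. exact: reprK. Qed.

Lemma class_of_wordP u v : class_of_word u = class_of_word v <-> pres_cong u v.
Proof.
split=> [uv|uv]; first by move/eqquotP: uv => /asboolP.
by apply/eqquotP/asboolP.
Qed.

Lemma word_of_classK u : pres_cong (word_of_class (class_of_word u)) u.
Proof. by apply/class_of_wordP; rewrite class_of_wordK. Qed.

Lemma pres_cong_ctx a b u v : pres_cong u v -> pres_cong (a ++ u ++ b) (a ++ v ++ b).
Proof.
elim=> {u v} [u|u v _ /pres_sym //|u v w _ uv _|u x c w|u l r w lr].
- exact: pres_refl.
- exact: pres_trans uv.
- by have := pres_cancel (a ++ u) x c (w ++ b); rewrite -!catA.
- by have := pres_rel (a ++ u) (w ++ b) lr; rewrite -!catA.
Qed.

Lemma pres_cong_cat u u' v v' :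
  pres_cong u u' -> pres_cong v v' -> pres_cong (u ++ v) (u' ++ v').
Proof.
move=> uu' vv'; apply: (@pres_trans _ (u' ++ v)).
  exact: (pres_cong_ctx [::] v uu').
by have := pres_cong_ctx u' [::] vv'; rewrite !cats0.
Qed.

Lemma winvK : involutive winv.
Proof.
move=> u; rewrite /winv map_rev revK -map_comp -[RHS]map_id.
by apply: eq_map => -[x b] /=; rewrite negbK.
Qed.

Lemma winvL u : pres_cong (winv u ++ u) [::].
Proof.
elim: u => [|[x b] u IHu]; first exact: pres_refl.
rewrite /winv /= rev_cons -/(winv u) cat_rcons.
have := pres_cancel (winv u) x (~~ b) u; rewrite negbK => /pres_trans; exact.
Qed.

Lemma winvR u : pres_cong (u ++ winv u) [::].
Proof. by rewrite -{1}[u]winvK; apply: winvL. Qed.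

Lemma pres_cong_winv u v : pres_cong u v -> pres_cong (winv u) (winv v).
Proof.
move=> uv; apply: (@pres_trans _ (winv u ++ v ++ winv v)).
  apply: pres_sym; rewrite -[X in pres_cong _ X]cats0.
  by apply: pres_cong_cat (pres_refl _) (winvR _).
rewrite catA -[X in pres_cong _ X]cat0s.
apply: pres_cong_cat (pres_refl _).
apply: pres_trans (winvL u).
by apply: pres_cong_cat (pres_refl _) (pres_sym uv).
Qed.

Definition pres_one := class_of_word [::].
Definition pres_mul p q := class_of_word (word_of_class p ++ word_of_class q).
Definition pres_inv p := class_of_word (winv (word_of_class p)).

Lemma class_of_word_cat u v :
  pres_mul (class_of_word u) (class_of_word v) = class_of_word (u ++ v).
Proof.
by apply/class_of_wordP; apply: pres_cong_cat; apply: word_of_classK.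
Qed.

Lemma class_of_word_inv u : pres_inv (class_of_word u) = class_of_word (winv u).
Proof. by apply/class_of_wordP/pres_cong_winv/word_of_classK. Qed.

Lemma pres_mulA : associative pres_mul.
Proof.
move=> p q r; rewrite -[p]class_of_wordK -[q]class_of_wordK -[r]class_of_wordK.
by rewrite !class_of_word_cat catA.
Qed.

Lemma pres_mul1g : left_id pres_one pres_mul.
Proof. by move=> p; rewrite -[p]class_of_wordK class_of_word_cat. Qed.

Lemma pres_mulg1 : right_id pres_one pres_mul.
Proof. by move=> p; rewrite -[p]class_of_wordK class_of_word_cat cats0. Qed.

Lemma pres_mulVg : left_inverse pres_one pres_inv pres_mul.
Proof.
move=> p; rewrite -[p]class_of_wordK class_of_word_inv class_of_word_cat.
exact/class_of_wordP/winvL.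
Qed.

Lemma pres_mulgV : right_inverse pres_one pres_inv pres_mul.
Proof.
move=> p; rewrite -[p]class_of_wordK class_of_word_inv class_of_word_cat.
exact/class_of_wordP/winvR.
Qed.

HB.instance Definition _ := isGroup.Build presented
  pres_mulA pres_mul1g pres_mulg1 pres_mulVg pres_mulgV.

Definition pres_gen (x : X) : presented := class_of_word [:: (x, false)].

Section Lift.
Variables (H : groupType) (f : X -> H).

Definition word_eval (u : word) : H :=
  \prod_(a <- u) (if a.2 then (f a.1)^-1 else f a.1).

Definition respects_rel : Prop :=
  forall l r, rel l r -> word_eval l = word_eval r.

Definition pres_lift of respects_rel :=
  fun p : presented => word_eval (word_of_class p).

Variable f_rel : respects_rel.

Lemma word_eval_cat u v : word_eval (u ++ v) = word_eval u * word_eval v.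
Proof. by rewrite /word_eval big_cat. Qed.

Lemma word_eval_cong u v : pres_cong u v -> word_eval u = word_eval v.
Proof.
elim=> {u v} // [u v w _ -> _ -> //|u x b w|u l r w lr].
  rewrite !word_eval_cat; congr (_ * _); rewrite /word_eval !big_cons mulgA /=.
  by case: b; rewrite /= (mulVg, mulgV) mul1g.
by rewrite !word_eval_cat (f_rel lr).
Qed.

Lemma pres_lift_word u : pres_lift f_rel (class_of_word u) = word_eval u.
Proof. exact/word_eval_cong/word_of_classK. Qed.

Lemma pres_lift_gen x : pres_lift f_rel (pres_gen x) = f x.
Proof. by rewrite pres_lift_word /word_eval big_seq1. Qed.

Lemma pres_lift_morph : monoid_morphism (pres_lift f_rel).
Proof.
split; first by rewrite pres_lift_word /word_eval big_nil.
move=> p q; rewrite -[p]class_of_wordK -[q]class_of_wordK.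
by rewrite [class_of_word _ * _]class_of_word_cat !pres_lift_word word_eval_cat.
Qed.

HB.instance Definition _ := isUMagmaMorphism.Build presented H
  (pres_lift f_rel) pres_lift_morph.

End Lift.

End Presentation.

Section Kernel.
Variables (G H : groupType) (f : {multiplicative G -> H}).

Definition ker_pred : pred G := fun x => f x == 1.

Record kernel := Kernel { kernel_val :> G; _ : ker_pred kernel_val }.

HB.instance Definition _ := [isSub for kernel_val].
HB.instance Definition _ := [Choice of kernel by <:].

Lemma ker_group_closed : group_closed ker_pred.
Proof.
split=> [|x y]; rewrite !unfold_in /ker_pred ?group_hom1 // => /eqP fx /eqP fy.
by rewrite gmulfM group_homV fx fy invg1 mulg1.
Qed.

HB.instance Definition _ :=
  SubChoice_isSubGroup.Build G ker_pred kernel ker_group_closed.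

End Kernel.

Section VirtualBraidGroups.
Variable n : nat.

(* Indices are shifted by one: i : 'I_n.-1 stands for the index i + 1. *)
Notation idx := 'I_n.-1.
Notation vgen := (idx + idx)%type.
Notation vword := (word vgen).

Definition sg (i : idx) : vgen * bool := (inl i, false).
Definition vg (i : idx) : vgen * bool := (inr i, false).

Definition far (i j : idx) : bool := (i + 2 <= j)%N || (j + 2 <= i)%N.

Inductive VB_rel : vword -> vword -> Prop :=
| VB_sss (i j : idx) of j = i.+1 :> nat :
    VB_rel [:: sg i; sg j; sg i] [:: sg j; sg i; sg j]
| VB_ss i j of far i j : VB_rel [:: sg i; sg j] [:: sg j; sg i]
| VB_vvv (i j : idx) of j = i.+1 :> nat :
    VB_rel [:: vg i; vg j; vg i] [:: vg j; vg i; vg j]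
| VB_vv i j of far i j : VB_rel [:: vg i; vg j] [:: vg j; vg i]
| VB_v2 i : VB_rel [:: vg i; vg i] [::]
| VB_sv i j of far i j : VB_rel [:: sg i; vg j] [:: vg j; sg i]
| VB_vvs (i j : idx) of j = i.+1 :> nat :
    VB_rel [:: vg i; vg j; sg i] [:: sg j; vg i; vg j].

Inductive WB_rel : vword -> vword -> Prop :=
| WB_VB u v of VB_rel u v : WB_rel u v
| WB_vss (i j : idx) of j = i.+1 :> nat :
    WB_rel [:: vg i; sg j; sg i] [:: sg j; sg i; vg j].

Inductive UVB_rel : vword -> vword -> Prop :=
| UVB_WB u v of WB_rel u v : UVB_rel u v
| UVB_vss (i j : idx) of j = i.+1 :> nat :
    UVB_rel [:: vg j; sg i; sg j] [:: sg i; sg j; vg i].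

Definition VB : groupType := presented VB_rel.
Definition WB : groupType := presented WB_rel.
Definition UVB : groupType := presented UVB_rel.

Lemma idx_succ_proof (i : idx) : (i.+1 < n)%N.
Proof. by rewrite -ltn_predRL. Qed.

(* Permutations compose left to right in MathComp; each transposition and the
   kernels below do not depend on this convention. *)
Definition tau (i : idx) : 'S_n :=
  tperm (widen_ord (leq_pred n) i) (Ordinal (idx_succ_proof i)).

Definition tau_gen (x : vgen) : 'S_n :=
  match x with inl i => tau i | inr i => tau i end.

Lemma tau_braid (i j : idx) : j = i.+1 :> nat ->
  tau i * (tau j * tau i) = tau j * (tau i * tau j).
Proof.
move=> ji; rewrite /tau.
have -> : widen_ord (leq_pred n) j = Ordinal (idx_succ_proof i) by apply/val_inj.
set a := widen_ord _ _; set b := Ordinal _; set c := Ordinal (idx_succ_proof j).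
have ab : a != b by rewrite -val_eqE /= neq_ltn ltnSn.
have bc : b != c by rewrite -val_eqE /= ji neq_ltn ltnSn.
have ac : a != c by rewrite -val_eqE /= ji neq_ltn leqnSn.
have E1 : tperm a b * (tperm b c * tperm a b) = tperm a c.
  by rewrite -{1}(tpermV a b) -/(conjg _ _) tpermJ tpermR tpermD.
have E2 : tperm b c * (tperm a b * tperm b c) = tperm a c.
  by rewrite -{1}(tpermV b c) -/(conjg _ _) tpermJ tpermL tpermD // eq_sym.
by rewrite E1 E2.
Qed.

Lemma tau_far i j : far i j -> tau i * tau j = tau j * tau i.
Proof.
rewrite /far => ij; rewrite conjgC; congr (_ * _).
by rewrite tpermJ !tpermD // -val_eqE /=; lia.
Qed.

Lemma tau_UVB : respects_rel UVB_rel tau_gen.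
Proof.
have E x : word_eval tau_gen x = \prod_(a <- x) tau_gen a.1.
  rewrite /word_eval; apply: eq_bigr => -[x' [|]] //= _.
  by case: x' => i; rewrite tpermV.
move=> _ _ [u v [_ _ [i j ij|i j ij|i j ij|i j ij|i|i j ij|i j ij]|i j ij]|i j ij];
  rewrite !E ?big_cons ?big_nil !mulg1 /=; by [exact: tau_far | exact: tau_braid | exact/esym/tau_braid | exact: tperm2].
Qed.

Lemma tau_WB : respects_rel WB_rel tau_gen.
Proof. by move=> u v uv; apply: tau_UVB; apply: UVB_WB. Qed.

Lemma tau_VB : respects_rel VB_rel tau_gen.
Proof. by move=> u v uv; apply: tau_WB; apply: WB_VB. Qed.

Definition piP_VB : {multiplicative VB -> 'S_n} := pres_lift tau_VB.
Definition piP_WB : {multiplicative WB -> 'S_n} := pres_lift tau_WB.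
Definition piP_UVB : {multiplicative UVB -> 'S_n} := pres_lift tau_UVB.

Lemma piP_VB_gen x : piP_VB (pres_gen VB_rel x) = tau_gen x.
Proof. exact: pres_lift_gen. Qed.

Lemma piP_WB_gen x : piP_WB (pres_gen WB_rel x) = tau_gen x.
Proof. exact: pres_lift_gen. Qed.

Lemma piP_UVB_gen x : piP_UVB (pres_gen UVB_rel x) = tau_gen x.
Proof. exact: pres_lift_gen. Qed.

Definition VP : groupType := kernel piP_VB.
Definition WP : groupType := kernel piP_WB.
Definition UVP : groupType := kernel piP_UVB.

End VirtualBraidGroups.

(* Main.v *)
Require Import Defs.
From HB Require Import structures.
From mathcomp Require Import all_boot all_order all_algebra all_fingroup.
From mathcomp Require Import generic_quotient zify ring gseries alt.
From mathcomp Require Import boolp classical_sets cardinality.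

(**
   An automorphism [alpha] has infinitely many twisted classes as soon as it fixes, up to
   an inner automorphism, a nonzero additive functional [l] on an invariant subgroup of
   finite index: the values of [l] separate the classes up to finite ambiguity.  So in each
   case one looks for an invariant functional.

   The group [UVP_n] is a direct product of free groups of rank two, one for each pair of
   strands.  On the abelianization [alpha] permutes the factors; let [B] be its return map
   on one plane.  If [B] fixes a direction, that gives the functional.  Otherwise twisted
   conjugate elements of the commutator subgroup are already conjugate by the commutator
   subgroup, whose elements are lattice loops, seen through the moments of their winding
   numbers.  If [det B = 1] the signed area is fixed; if [det B = -1] the second moment of
   the quadratic form [v |-> det (v, B v)], corrected by moments of lower order, is fixed.

   The groups [VB_n], [WB_n] and [UVB_n] map onto [Z^(n(n-1)) ><| S_n], by which one counts
   the crossings of each ordered pair of strands.  For [n >= 5] the homomorphism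
   [pi_P o alpha] to [S_n] kills the kernel of [pi_P]: since the image of [sigma_1] commutes
   with those of [v_3], ..., [v_(n-1)], it is trivial or equal to that of [v_1], and in the
   trivial case functionals on the kernel would be invariant under conjugation.  So [alpha]
   acts on the lattice compatibly with an automorphism of [S_n], which maps transpositions
   to transpositions because it preserves the trace of the permutation representation on
   ordered pairs.  The functionals that [v_1] and [v_2] both negate form a line, on which
   [alpha] acts by a sign that [v_1] can absorb.  For [n = 4] the same argument works over
   [S_3], and for [n <= 3] with characters of order two.
*)

Set Implicit Arguments.
Unset Strict Implicit.
Unset Printing Implicit Defensive.

Import GRing.Theory Num.Theory.
Local Open Scope group_scope.

(** * Reidemeister numbers and invariant functionals *)

(** When [1 - B] is invertible on every plane, the abelianization of [UVP_n] has only finitely many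
    twisted classes and detects nothing; this forces the descent to lattice loops. If [det B = -1],
    signed area is reversed, but so is the form [q v = det (v, B v)], since [q (B v) = det B * q v];
    weighting area by [q] makes the signs cancel. The corrections are due to the image of a unit
    square being a loop whose first and second moments are arbitrary.

    For n >= 5 the trace is what rules out the outer automorphisms of [S_6]. For n = 4 the
    alternating group is not simple, which blocks the injectivity argument; in [S_3], however, the
    centralizer of an involution has order two, and this pins the image of [sigma_1]. For n <= 3
    there is no [v_3] to commute with [sigma_1], and a case survives in which [alpha] sends
    [sigma_1] to an even and [v_1] to an odd element. There [alpha^2] preserves the sign and scales
    the functional [l0] by some [c = 1] or [c = -1], and the functional used for [alpha] is
    [l0 + c * (l0 \o alpha)]. *)

Lemma infinite_range_nat (T : eqType) (f : nat -> T) :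
  injective f -> infinite_set (range f).
Proof.
move=> f_inj /finite_seqP [s fs].
have sub : {subset [seq f i | i <- iota 0 (size s).+1] <= s}.
  move=> _ /mapP [i _ ->]; have : range f (f i) by exists i.
  by rewrite fs.
have := uniq_leq_size _ sub; rewrite map_inj_uniq // iota_uniq size_map size_iota.
by rewrite ltnn => /(_ isT).
Qed.

Lemma reidemeister_number_inftyP (G : groupType) (alpha : {multiplicative G -> G})
    (y : nat -> G) :
  (forall m m', twisted_conj alpha (y m) (y m') -> m = m') ->
  reidemeister_number alpha = None.
Proof.
move=> y_inj; apply/reidemeister_number_infty => fin.
have inj : injective (fun m => twisted_class alpha (y m)).
  move=> m m' E; apply: y_inj.
  have : twisted_class alpha (y m') (y m') by exact: twisted_conj_refl.
  by rewrite -E.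
apply: (infinite_range_nat inj); apply: sub_finite_set fin.
by move=> _ [m _ <-]; exists (y m).
Qed.

Section AdditiveOn.
Variables (G : groupType) (K : G -> Prop).

Definition subgroup_pred : Prop :=
  [/\ K 1, forall x y, K x -> K y -> K (x * y) & forall x, K x -> K x^-1].

Definition finite_index : Prop :=
  exists (F : finType) (c : G -> F), forall x y, c x = c y -> K (x * y^-1).

Definition additive_on (l : G -> int) : Prop :=
  forall x y, K x -> K y -> l (x * y) = (l x + l y)%R.

Hypothesis Kg : subgroup_pred.
Variables (l : G -> int) (la : additive_on l).

Lemma additive_on1 : l 1 = 0%R.
Proof. by have [K1 _ _] := Kg; have := la K1 K1; rewrite mulg1; lia. Qed.

Lemma additive_onV x : K x -> l x^-1 = (- l x)%R.
Proof.
have [K1 KM KV] := Kg; move=> Kx; have := la Kx (KV _ Kx).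
by rewrite mulgV additive_on1; lia.
Qed.

Lemma additive_onJ x y : K x -> K y -> l (x * y * x^-1) = l y.
Proof.
have [K1 KM KV] := Kg; move=> Kx Ky.
by rewrite la ?la ?additive_onV //; [lia | exact: KM | exact: KV].
Qed.

Lemma subgroup_predX x m : K x -> K (x ^+ m).
Proof.
have [K1 KM KV] := Kg; move=> Kx.
by elim: m => [|m IHm]; rewrite ?expg0 // expgS; apply: KM.
Qed.

Lemma additive_onX x m : K x -> l (x ^+ m) = (l x *+ m)%R.
Proof.
move=> Kx; elim: m => [|m IHm]; first by rewrite expg0 additive_on1 mulr0n.
by rewrite expgS mulrS la ?IHm //; apply: subgroup_predX.
Qed.

Lemma additive_on_torsion x m : K x -> x ^+ m.+1 = 1 -> l x = 0%R.
Proof.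
move=> Kx xm; have := additive_onX m.+1 Kx; rewrite xm additive_on1.
by move/esym/eqP; rewrite mulrn_eq0 /= => /eqP.
Qed.

End AdditiveOn.

Section Reidemeister.
Variables (G : groupType) (alpha : {multiplicative G -> G}).

(* On each coset [K g] the functional descends to the twisted classes under [K], and
   only finitely many of these merge under [G]. *)
Lemma reidemeister_functional (K : G -> Prop) (l : G -> int) (g u : G) :
  subgroup_pred K -> finite_index K -> additive_on K l ->
  (forall x, K x -> K (g * alpha x * g^-1)) ->
  (forall x, K x -> l (g * alpha x * g^-1) = l x) ->
  K u -> l u != 0%R -> reidemeister_number alpha = None.
Proof.
move=> Kg [F [c Kc]] la Ka lE Ku lu.
have [K1 KM KV] := Kg.
apply/reidemeister_number_infty => fin.
pose y m := u ^+ m * g.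
pose rep (S : set G) := xget 1 S.
have repP m : exists z, rep (twisted_class alpha (y m)) = z * y m * (alpha z)^-1.
  have : twisted_class alpha (y m) (rep (twisted_class alpha (y m))).
    by apply: xgetPex; exists (y m); exact: twisted_conj_refl.
  by move/twisted_conj_sym.
have [z zP] := choice repP.
pose h m := (twisted_class alpha (y m), c (z m)^-1).
have h_inj : injective h.
  move=> m m' [E cz]; pose k := (z m)^-1 * z m'.
  have Kk : K k by have := Kc _ _ cz; rewrite invgK.
  have yE : u ^+ m = k * u ^+ m' * (g * alpha k * g^-1)^-1.
    apply: (mulIg g); rewrite -/(y m) !invMg invgK !mulgA mulgKV -[_ * g]mulgA -/(y m').
    have := zP m; rewrite E zP => /(congr1 (fun x => (z m)^-1 * x * alpha (z m))).
    by rewrite !mulgA mulgKV mulVg mul1g /k gmulfM group_homV invMg invgK !mulgA.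
  move: yE (Ka _ Kk) (lE _ Kk); move: (g * alpha k * g^-1) => j yE Kj lj.
  clearbody k; have := congr1 l yE.
  rewrite la ?la ?(additive_onV Kg la) ?lj //;
    do ?[exact: subgroup_predX | apply: KV | apply: KM | by []].
  rewrite !(additive_onX Kg la) // => E1.
  have : (l u *+ m = l u *+ m')%R by rewrite E1 addrAC subrr add0r.
  exact: (mulrIn lu).
apply: (infinite_range_nat h_inj).
apply: (@sub_finite_set _ _ (reidemeister_classes alpha `*` [set: F])%classic).
  by move=> _ [m _ <-]; split=> //; exists (y m).
by apply: finite_setX.
Qed.

End Reidemeister.

(* If the functional is only preserved up to a scalar, invertibility makes the scalar a
   sign, which [t] can absorb. *)
Lemma reidemeister_signed (G : groupType) (alpha beta : {multiplicative G -> G})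
    (K : G -> Prop) (l : G -> int) (g t u : G) (c c' : int) :
  cancel beta alpha -> cancel alpha beta ->
  subgroup_pred K -> finite_index K -> additive_on K l ->
  (forall x, K x <-> K (g * alpha x * g^-1)) ->
  (forall x, K x -> K (t * x * t^-1)) ->
  (forall x, K x -> l (t * x * t^-1) = (- l x)%R) ->
  (forall x, K x -> l (g * alpha x * g^-1) = (c * l x)%R) ->
  (forall x, K x -> l (beta (g^-1 * x * g)) = (c' * l x)%R) ->
  K u -> l u = 1%R -> reidemeister_number alpha = None.
Proof.
move=> bK aK Kg Kf la Ka Kt lt lc lc' Ku lu.
have Ku' : K (beta (g^-1 * u * g)).
  by apply/Ka; rewrite bK !mulgA mulgV mul1g mulgK.
have cc' : (c * c' = 1)%R.
  have := lc _ Ku'; rewrite lc' // lu mulr1 bK !mulgA mulgV mul1g mulgK lu.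
  by move->.
have [c1|c1] : (c = 1 \/ c = -1)%R.
  have := congr1 absz cc'; rewrite abszM => /eqP.
  by rewrite muln_eq1 => /andP [/eqP c1 _]; lia.
- apply: (reidemeister_functional (g := g) (u := u) Kg Kf la) => // [x|x Kx|].
  + by move/Ka.
  + by rewrite lc // c1 mul1r.
  + by rewrite lu.
- apply: (reidemeister_functional (g := t * g) (u := u) Kg Kf la) => // [x|x Kx|].
  + by move/Ka/Kt; rewrite invMg !mulgA.
  + have -> : t * g * alpha x * (t * g)^-1 = t * (g * alpha x * g^-1) * t^-1.
      by rewrite invMg !mulgA.
    by rewrite lt; [rewrite lc // c1 mulN1r opprK | exact: (proj1 (Ka x) Kx)].
  + by rewrite lu.
Qed.

Lemma multiplicative_inverse (G : groupType) (alpha : {multiplicative G -> G}) :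
  bijective alpha ->
  exists beta : {multiplicative G -> G}, cancel alpha beta /\ cancel beta alpha.
Proof.
move=> [b aK bK]; have bM : monoid.monoid_morphism b.
  split=> [|g h]; first by rewrite -{1}(group_hom1 alpha) aK.
  by rewrite -{1}[g]bK -{1}[h]bK -gmulfM aK.
pose bm := isUMagmaMorphism.Build G G b bM.
by exists (HB.pack_for (UMagmaMorphism.type G G) b bm).
Qed.

(** * Products of free groups of rank two *)

Definition normal_pred (G : groupType) (N : G -> Prop) : Prop :=
  subgroup_pred N /\ forall g x, N x -> N (g * x * g^-1).

(** * Abelian quotients, written additively *)

Section AbelianQuotient.
Local Open Scope quotient_scope.
Variables (G : groupType) (N : G -> Prop).
Hypothesis Nn : normal_pred N.
Hypothesis Nab : forall g h : G, N (g * h * g^-1 * h^-1).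

Definition coset_eqb (g h : G) : bool := `[< N (g * h^-1) >].

Lemma coset_eqb_refl : reflexive coset_eqb.
Proof. by move=> g; apply/asboolP; rewrite mulgV; case: Nn => [] []. Qed.

Lemma coset_eqb_sym : symmetric coset_eqb.
Proof.
have [[_ _ NV] _] := Nn.
by move=> g h; apply/asboolP/asboolP => /NV; rewrite invMg invgK.
Qed.

Lemma coset_eqb_trans : transitive coset_eqb.
Proof.
have [[_ NM _] _] := Nn.
move=> h g k /asboolP gh /asboolP hk; apply/asboolP.
by have := NM _ _ gh hk; rewrite !mulgA mulgKV.
Qed.

Canonical coset_equiv :=
  EquivRel coset_eqb coset_eqb_refl coset_eqb_sym coset_eqb_trans.

Definition abelian_quotient : Type := {eq_quot coset_equiv}.
HB.instance Definition _ := Choice.on abelian_quotient.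
HB.instance Definition _ := EqQuotient.on abelian_quotient.

Definition coset_class (g : G) : abelian_quotient := (\pi_abelian_quotient g)%qT.

Lemma coset_classK (q : abelian_quotient) : coset_class (repr q) = q.
Proof. exact: reprK. Qed.

Lemma coset_classP g h : coset_class g = coset_class h <-> N (g * h^-1).
Proof.
split=> [gh|gh]; first by move/eqquotP: gh => /asboolP.
by apply/eqquotP/asboolP.
Qed.

Lemma repr_coset_class g : N (repr (coset_class g) * g^-1).
Proof. by apply/coset_classP; rewrite coset_classK. Qed.

Definition coset_add (p q : abelian_quotient) := coset_class (repr p * repr q).
Definition coset_opp (p : abelian_quotient) := coset_class (repr p)^-1.

Lemma coset_class_add g h : coset_add (coset_class g) (coset_class h) = coset_class (g * h).
Proof.
have [[_ NM NV] NJ] := Nn; apply/coset_classP.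
have := NM _ _ (NJ (repr (coset_class g)) _ (repr_coset_class h)) (repr_coset_class g).
by rewrite invMg !mulgA mulgKV.
Qed.

Lemma coset_class_opp g : coset_opp (coset_class g) = coset_class g^-1.
Proof.
have [[_ NM NV] NJ] := Nn; apply/coset_classP.
have := NJ (repr (coset_class g))^-1 _ (NV _ (repr_coset_class g)).
by rewrite !invMg !invgK mulgA mulgKV.
Qed.

Lemma coset_addA : associative coset_add.
Proof.
move=> p q r; rewrite -[p]coset_classK -[q]coset_classK -[r]coset_classK.
by rewrite !coset_class_add mulgA.
Qed.

Lemma coset_addC : commutative coset_add.
Proof.
move=> p q; rewrite -[p]coset_classK -[q]coset_classK !coset_class_add.
by apply/coset_classP; rewrite invMg mulgA.
Qed.

Lemma coset_add0 : left_id (coset_class 1) coset_add.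
Proof. by move=> p; rewrite -[p]coset_classK coset_class_add mul1g. Qed.

Lemma coset_addN : left_inverse (coset_class 1) coset_opp coset_add.
Proof.
by move=> p; rewrite -[p]coset_classK coset_class_opp coset_class_add mulVg.
Qed.

HB.instance Definition _ := GRing.isZmodule.Build abelian_quotient
  coset_addA coset_addC coset_add0 coset_addN.

Lemma coset_classM g h : coset_class (g * h) = (coset_class g + coset_class h)%R.
Proof. by rewrite -coset_class_add. Qed.

Lemma coset_classV g : coset_class g^-1 = (- coset_class g)%R.
Proof. by rewrite -coset_class_opp. Qed.

Lemma coset_class_eq0 g : coset_class g = 0%R <-> N g.
Proof. by rewrite [0%R]/(coset_class 1) coset_classP invg1 mulg1. Qed.

End AbelianQuotient.

(** * Lattice paths: displacement and weighted area *)

Notation plane := (int * int)%type.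

(* The semidirect product of the lattice with its module of integer functions. *)
Definition area_group : Type := (plane * (plane -> int))%type.
HB.instance Definition _ := Choice.on area_group.

Definition area_mul (p q : area_group) : area_group :=
  (p.1 + q.1, fun w => p.2 w + q.2 (w + p.1))%R.
Definition area_one : area_group := (0, fun=> 0)%R.
Definition area_inv (p : area_group) : area_group := (- p.1, fun w => - p.2 (w - p.1))%R.

Lemma area_mulA : associative area_mul.
Proof.
move=> p q r; congr pair; first by rewrite /= addrA.
by apply/funext => w; rewrite /= !addrA.
Qed.

Lemma area_mul1g : left_id area_one area_mul.
Proof.
move=> [u f]; congr pair; first by rewrite /= add0r.
by apply/funext => w; rewrite /= addr0 add0r.
Qed.

Lemma area_mulg1 : right_id area_one area_mul.
Proof.
move=> [u f]; congr pair; first by rewrite /= addr0.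
by apply/funext => w; rewrite /= addr0.
Qed.

Lemma area_mulVg : left_inverse area_one area_inv area_mul.
Proof.
move=> [u f]; congr pair; first by rewrite /= addNr.
by apply/funext => w; rewrite /= addNr.
Qed.

Lemma area_mulgV : right_inverse area_one area_inv area_mul.
Proof.
move=> [u f]; congr pair; first by rewrite /= addrN.
by apply/funext => w; rewrite /= addrK addrN.
Qed.

HB.instance Definition _ := isGroup.Build area_group
  area_mulA area_mul1g area_mulg1 area_mulVg area_mulgV.

(** A direct product of free groups of rank two, described by generation, commutation of different
    factors, and the universal property of each single factor with the others sent to 1. *)
Record product_of_free_pairs (K : groupType) (I : finType) (x y : I -> K) : Prop := {
  pfp_gen : forall A : K -> Prop, subgroup_pred A ->
    (forall i, A (x i)) -> (forall i, A (y i)) -> forall g, A g;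
  pfp_comm : forall i j, i != j ->
    [/\ commute (x i) (x j), commute (x i) (y j) & commute (y i) (y j)];
  pfp_hom : forall (H : groupType) (a b : H) i, exists f : {multiplicative K -> H},
    [/\ f (x i) = a, f (y i) = b & forall j, j != i -> f (x j) = 1 /\ f (y j) = 1] }.

Section ProductOfFreePairs.
Variables (K : groupType) (I : finType) (x y : I -> K).
Hypothesis Kxy : product_of_free_pairs x y.

(** An element becomes a path in the lattice of the factor [i], where [P w] is the weight of the
    horizontal edge from [w] to [w + (1, 0)] and vertical edges weigh nothing. Thus [area] is a
    discrete line integral; by Green's formula the unit square at [w] weighs
    [P w - P (w + (0, 1))]. *)
Definition area_hom (i : I) (P : plane -> int) : {multiplicative K -> area_group} :=
  sval (cid (pfp_hom Kxy (((1, 0), P) : area_group)%R (((0, 1), fun=> 0) : area_group)%R i)).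

Definition disp i g : plane := (area_hom i (fun=> 0%R) g).1.
Definition area i P g : plane -> int := (area_hom i P g).2.

Lemma area_homP i P :
  [/\ area_hom i P (x i) = ((1, 0), P)%R,
      area_hom i P (y i) = ((0, 1), fun=> 0)%R &
      forall j, j != i -> area_hom i P (x j) = 1 /\ area_hom i P (y j) = 1].
Proof. by rewrite /area_hom; case: cid. Qed.

Lemma dispE i P g : (area_hom i P g).1 = disp i g.
Proof.
have [ax ay aj] := area_homP i P.
have [bx b_y bj] := area_homP i (fun=> 0%R).
apply: (pfp_gen Kxy (A := fun g => (area_hom i P g).1 = disp i g)) => [|j|j].
- split=> [|h k Eh Ek|h Eh]; first by rewrite /disp !group_hom1.
  + by rewrite /disp !gmulfM /= Eh Ek.
  + by rewrite /disp !group_homV /= Eh.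
- rewrite /disp; have [->|ji] := eqVneq j i; first by rewrite ax bx.
  by have [-> _] := aj _ ji; have [-> _] := bj _ ji.
- rewrite /disp; have [->|ji] := eqVneq j i; first by rewrite ay b_y.
  by have [_ ->] := aj _ ji; have [_ ->] := bj _ ji.
Qed.

Lemma disp1 i : disp i 1 = 0%R. Proof. by rewrite /disp group_hom1. Qed.

Lemma dispM i g h : disp i (g * h) = (disp i g + disp i h)%R.
Proof. by rewrite /disp gmulfM. Qed.

Lemma dispV i g : disp i g^-1 = (- disp i g)%R.
Proof. by rewrite /disp group_homV. Qed.

Lemma areaM i P g h w :
  area i P (g * h) w = (area i P g w + area i P h (w + disp i g))%R.
Proof. by rewrite /area gmulfM /= dispE. Qed.

Lemma area1 i P w : area i P 1 w = 0%R. Proof. by rewrite /area group_hom1. Qed.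

Lemma areaV i P g w : area i P g^-1 w = (- area i P g (w - disp i g))%R.
Proof. by rewrite /area group_homV /= dispE. Qed.

Lemma disp_x i j : disp i (x j) = if j == i then (1, 0)%R else 0%R.
Proof.
have [ax ay aj] := area_homP i (fun=> 0%R); rewrite /disp.
by case: eqVneq => [->|/aj [-> _]]; rewrite ?ax.
Qed.

Lemma disp_y i j : disp i (y j) = if j == i then (0, 1)%R else 0%R.
Proof.
have [ax ay aj] := area_homP i (fun=> 0%R); rewrite /disp.
by case: eqVneq => [->|/aj [_ ->]]; rewrite ?ay.
Qed.

Lemma area_x i j P w : area i P (x j) w = if j == i then P w else 0%R.
Proof.
have [ax ay aj] := area_homP i P; rewrite /area.
by case: eqVneq => [->|/aj [-> _]]; rewrite ?ax.
Qed.

Lemma area_y i j P w : area i P (y j) w = 0%R.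
Proof.
have [ax ay aj] := area_homP i P; rewrite /area.
by have [->|/aj [_ ->]] := eqVneq j i; rewrite ?ay.
Qed.

Definition comm (g h : K) := g * h * g^-1 * h^-1.

Lemma disp_comm i g h : disp i (comm g h) = 0%R.
Proof. by rewrite /comm !dispM !dispV addrAC addrK addrN. Qed.

Lemma area_comm i P g h w : area i P (comm g h) w =
  (area i P g w + area i P h (w + disp i g) - area i P g (w + disp i h)
   - area i P h w)%R.
Proof.
rewrite /comm !areaM !areaV !dispM !dispV.
by congr (_ + _ - area _ _ _ _ - area _ _ _ _)%R; ring.
Qed.

Lemma area_commxy i P w : area i P (comm (x i) (y i)) w = (P w - P (w + (0, 1)))%R.
Proof. by rewrite area_comm !area_x !area_y disp_y !eqxx; ring. Qed.

(** Conjugation moves the base point of a loop: the passages along [g] and back cancel. *)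
Lemma area_conj i P g h w : disp i h = 0%R ->
  area i P (g * h * g^-1) w = area i P h (w + disp i g)%R.
Proof.
move=> h0; rewrite !areaM areaV !dispM h0 addr0 addrK.
by rewrite addrAC addrN add0r.
Qed.

Definition disp0 (g : K) : Prop := forall i, disp i g = 0%R.

Lemma disp0_normal : normal_pred disp0.
Proof.
split; first split=> [i|g h g0 h0 i|g g0 i].
- exact: disp1.
- by rewrite dispM g0 h0 addr0.
- by rewrite dispV g0 oppr0.
- by move=> g h h0 i; rewrite !dispM dispV h0 addr0 addrN.
Qed.

(* Modulo [N] the group becomes abelian, so there every element is the sum of its
   displacements. *)
Lemma disp0_ind (N : K -> Prop) : normal_pred N ->
  (forall i, N (comm (x i) (y i))) -> forall g, disp0 g -> N g.
Proof.
move=> Nn Nxy.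
have [[N1 NM NV] NJ] := Nn.
have Ncomm g h : commute g h -> N (comm g h).
  by rewrite /comm => ->; rewrite mulgK mulgV.
have Nsym g h : N (comm g h) -> N (comm h g).
  by move/NV; rewrite /comm !invMg !invgK !mulgA.
(* Modulo the normal subgroup [N], the elements commuting with [g] form a subgroup, so it is enough
   to test generators. *)
have Ngen (g : K) : (forall i, N (comm g (x i))) -> (forall i, N (comm g (y i))) ->
    forall h, N (comm g h).
  move=> gx gy; apply: (pfp_gen Kxy) => //; split=> [|h k gh gk|h gh].
  - by rewrite /comm mulg1 invg1 mulg1 mulgV.
  - have := NM _ _ gh (NJ h _ gk); rewrite /comm !invMg !mulgA.
    by rewrite !mulgKV.
  - have := NJ h^-1 _ (NV _ gh); rewrite /comm !invMg !invgK !mulgA.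
    by rewrite mulVg mul1g.
have Nxx i j : N (comm (x i) (x j)).
  have [->|/(pfp_comm Kxy) [ij _ _]] := eqVneq i j; exact: Ncomm.
have Nyy i j : N (comm (y i) (y j)).
  have [->|/(pfp_comm Kxy) [_ _ ij]] := eqVneq i j; exact: Ncomm.
have Nxy' i j : N (comm (x i) (y j)).
  by have [->|/(pfp_comm Kxy) [_ ij _]] := eqVneq i j => //; exact: Ncomm.
have Nab g h : N (comm g h).
  by apply: (Ngen g) => i; apply: (Nsym _ _); apply: (Ngen _) => j //; apply: (Nsym _ _).
pose c := coset_class Nn.
have cE g : c g = (\sum_i (c (x i) *~ (disp i g).1 + c (y i) *~ (disp i g).2))%R.
  apply: (pfp_gen Kxy (A := fun g => c g = \sum_i (c (x i) *~ (disp i g).1 +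
    c (y i) *~ (disp i g).2))%R) => [|j|j].
  - split=> [|h k Eh Ek|h Eh].
    + rewrite big1 => [|i _]; last by rewrite disp1 !mulr0z addr0.
      exact/(coset_class_eq0 Nn Nab).
    + rewrite /c coset_classM -/c Eh Ek -big_split; apply: eq_bigr => i _ /=.
      by rewrite dispM /= !mulrzDr addrACA.
    + rewrite /c coset_classV -/c Eh -sumrN; apply: eq_bigr => i _ /=.
      by rewrite dispV /= !mulrNz opprD.
  - rewrite (bigD1 j) //= disp_x eqxx /= mulr1z mulr0z addr0 big1 ?addr0 // => i ij.
    by rewrite disp_x eq_sym (negPf ij) !mulr0z addr0.
  - rewrite (bigD1 j) //= disp_y eqxx /= mulr1z mulr0z add0r big1 ?addr0 // => i ij.
    by rewrite disp_y eq_sym (negPf ij) !mulr0z addr0.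
move=> g g0; apply/(coset_class_eq0 Nn Nab); rewrite -/(c g) cE.
by rewrite big1 // => i _; rewrite g0 !mulr0z addr0.
Qed.

Lemma plane_opp (p : plane) : (- p)%R = (- p.1, - p.2)%R. Proof. by []. Qed.

Lemma plane_add (p q : plane) : (p + q)%R = (p.1 + q.1, p.2 + q.2)%R. Proof. by []. Qed.

Lemma plane0 : (0 : plane)%R = (0, 0)%R. Proof. by []. Qed.

Definition det2 (p q : plane) : int := (p.1 * q.2 - p.2 * q.1)%R.

Definition span2 (a b v : plane) : plane :=
  (v.1 * a.1 + v.2 * b.1, v.1 * a.2 + v.2 * b.2)%R.

(* Chosen so that [cubic k w - cubic k (w + (0, 1))] is [6] times the quadratic
   polynomial with coefficients [k]. *)
Definition cubic (k : int * int * int * int * int * int) (w : plane) : int :=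
  let: (k1, k2, k3, k4, k5, k6) := k in let: (s, t) := w in
  (- (6 * k1 * s * s * t + 3 * k2 * s * t * (t - 1)
      + k3 * t * (t - 1) * (2 * t - 1)
      + 6 * k4 * s * t + 3 * k5 * t * (t - 1) + 6 * k6 * t))%R.

Lemma cubicD k w : (cubic k w - cubic k (w + (0, 1)) =
  let: (k1, k2, k3, k4, k5, k6) := k in let: (s, t) := w in
  6 * (k1 * s * s + k2 * s * t + k3 * t * t + k4 * s + k5 * t + k6))%R.
Proof.
case: k => [[[[[k1 k2] k3] k4] k5] k6]; case: w => s t.
by rewrite plane_add /cubic /= addr0; ring.
Qed.

Definition cubic0 := cubic (0, 0, 0, 0, 0, 1)%R.

(** The weight is [cubic0 (s, t) = -6 t]; being linear, it changes by a constant under a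
    translation, and this constant is collected once per unit of horizontal displacement. *)
Lemma area_cubic0D i g w z :
  area i cubic0 g (w + z)%R = (area i cubic0 g w - 6 * (disp i g).1 * z.2)%R.
Proof.
move: w z; apply: (pfp_gen Kxy (A := fun g => forall w z : plane,
  area i cubic0 g (w + z) = area i cubic0 g w - 6 * (disp i g).1 * z.2)%R) => [|j|j].
- split=> [|h k Eh Ek|h Eh] w z; first by rewrite !area1 disp1 plane0 /=; ring.
  + by rewrite !areaM (Eh w z) (addrAC w) (Ek (w + _)%R z) dispM plane_add /=; ring.
  + by rewrite !areaV (addrAC w) (Eh (w - _)%R z) dispV plane_opp /=; ring.
- move=> w z; rewrite !area_x disp_x; case: eqP => _; last by rewrite plane0 /=; ring.
  by case: w z => [s t] [s' t']; rewrite plane_add /cubic0 /=; ring.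
- by move=> w z; rewrite !area_y disp_y; case: eqP => _; rewrite ?plane0 /=; ring.
Qed.

(** Whatever the shapes of the two paths, their areas cancel against those of the inverse paths up
    to the translation terms, which leave the parallelogram spanned by the displacements. *)
Lemma area_cubic0_comm i g h w :
  area i cubic0 (comm g h) w = (6 * det2 (disp i g) (disp i h))%R.
Proof. by rewrite area_comm 2!area_cubic0D /det2; ring. Qed.

Lemma det2_commute i g h : commute g h -> det2 (disp i g) (disp i h) = 0%R.
Proof.
move=> gh; have := area_cubic0_comm i g h 0%R.
have -> : comm g h = 1 by rewrite /comm gh mulgK mulgV.
by rewrite area1 => /esym/eqP; rewrite mulf_eq0 /= => /eqP.
Qed.

(* The displacement-free elements see the cubics only through the moments up to order
   two of the winding number of the corresponding lattice loop. *)
Lemma area_moments i g : disp0 g -> exists m mx my mxx mxy myy : int,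
  forall k1 k2 k3 k4 k5 k6 s t, area i (cubic (k1, k2, k3, k4, k5, k6)) g (s, t) =
  (6 * (k1 * (s * s * m + 2 * s * mx + mxx) + k2 * (s * t * m + s * my + t * mx + mxy)
      + k3 * (t * t * m + 2 * t * my + myy)
      + k4 * (s * m + mx) + k5 * (t * m + my) + k6 * m))%R.
Proof.
move=> g0; pose M (g : K) := exists m mx my mxx mxy myy : int,
  forall k1 k2 k3 k4 k5 k6 s t, area i (cubic (k1, k2, k3, k4, k5, k6)) g (s, t) =
  (6 * (k1 * (s * s * m + 2 * s * mx + mxx) + k2 * (s * t * m + s * my + t * mx + mxy)
      + k3 * (t * t * m + 2 * t * my + myy)
      + k4 * (s * m + mx) + k5 * (t * m + my) + k6 * m))%R.
suff [] : disp0 g /\ M g by [].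
have [[K1 KM KV] KJ] := disp0_normal.
apply: (disp0_ind (N := fun g => disp0 g /\ M g)) g0 => [|j].
- split; first split.
  + split=> //; exists 0%R, 0%R, 0%R, 0%R, 0%R, 0%R => k1 k2 k3 k4 k5 k6 s t.
    by rewrite area1; ring.
  + move=> h k [h0 [m [mx [my [mxx [mxy [myy Eh]]]]]]].
    move=> [k0 [n [nx [ny [nxx [nxy [nyy Ek]]]]]]]; split; first exact: KM.
    exists (m + n)%R, (mx + nx)%R, (my + ny)%R, (mxx + nxx)%R, (mxy + nxy)%R, (myy + nyy)%R.
    by move=> k1 k2 k3 k4 k5 k6 s t; rewrite areaM h0 addr0 Eh Ek; ring.
  + move=> h [h0 [m [mx [my [mxx [mxy [myy Eh]]]]]]]; split; first exact: KV.
    exists (- m)%R, (- mx)%R, (- my)%R, (- mxx)%R, (- mxy)%R, (- myy)%R.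
    by move=> k1 k2 k3 k4 k5 k6 s t; rewrite areaV h0 subr0 Eh; ring.
  + move=> h k [k0 [m [mx [my [mxx [mxy [myy Ek]]]]]]]; split; first exact: KJ.
    have [a [b hab]] : exists a b, disp i h = (a, b) by case: (disp i h) => a b; exists a, b.
    exists m, (mx + a * m)%R, (my + b * m)%R, (mxx + 2 * a * mx + a * a * m)%R,
      (mxy + a * my + b * mx + a * b * m)%R, (myy + 2 * b * my + b * b * m)%R.
    move=> k1 k2 k3 k4 k5 k6 s t; rewrite area_conj // hab.
    by rewrite -[((s, t) + (a, b))%R]/(s + a, t + b)%R Ek; ring.
- split=> [r|]; first exact: disp_comm.
  have [ji|ji] := eqVneq j i.
  + exists 1%R, 0%R, 0%R, 0%R, 0%R, 0%R => k1 k2 k3 k4 k5 k6 s t.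
    by rewrite ji area_commxy cubicD; ring.
  + exists 0%R, 0%R, 0%R, 0%R, 0%R, 0%R => k1 k2 k3 k4 k5 k6 s t.
    by rewrite area_comm !area_x !area_y (negPf ji); ring.
Qed.

(** * Return maps of an automorphism on the planes of the factors *)

Section Automorphism.
Variables alpha beta : {multiplicative K -> K}.
Hypotheses (aK : cancel alpha beta) (bK : cancel beta alpha).

Lemma disp0_morph (f : {multiplicative K -> K}) g : disp0 g -> disp0 (f g).
Proof.
have [[K1 KM KV] KJ] := disp0_normal.
apply: (disp0_ind (N := fun g => disp0 (f g))) => [|i].
- split; first split=> [|h k h0 k0|h h0]; rewrite ?group_hom1 //.
  + by rewrite gmulfM; apply: KM.
  + by rewrite group_homV; apply: KV.
  + by move=> h k k0; rewrite !gmulfM group_homV; apply: KJ.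
- by move=> r; rewrite /comm !gmulfM !group_homV; apply: disp_comm.
Qed.

Lemma det2_parallel v w z : w != 0%R -> det2 v w = 0%R -> det2 w z = 0%R -> det2 v z = 0%R.
Proof.
case: v w z => [v1 v2] [w1 w2] [z1 z2]; rewrite /det2 /= => w0 vw wz.
have E1 : (w1 * (v1 * z2 - v2 * z1) = v1 * (w1 * z2 - w2 * z1) + z1 * (v1 * w2 - v2 * w1))%R
  by ring.
have E2 : (w2 * (v1 * z2 - v2 * z1) = v2 * (w1 * z2 - w2 * z1) + z2 * (v1 * w2 - v2 * w1))%R
  by ring.
move: E1 E2; rewrite vw wz !mulr0 addr0 => /eqP; rewrite mulf_eq0 => /orP [/eqP w10|/eqP //].
move/eqP; rewrite mulf_eq0 => /orP [/eqP w20|/eqP //].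
by rewrite w10 w20 eqxx in w0.
Qed.

(** As [alpha] is surjective, both unit vectors occur as displacements of its values, and only 0 is
    parallel to both. *)
Lemma det2_gen r (v : plane) :
  (forall t, det2 v (disp r (alpha (x t))) = 0)%R ->
  (forall t, det2 v (disp r (alpha (y t))) = 0)%R -> v = 0%R.
Proof.
move=> vx vy; have vg g : det2 v (disp r (alpha g)) = 0%R.
  apply: (pfp_gen Kxy (A := fun g => det2 v (disp r (alpha g)) = 0%R)) => //.
  split=> [|h k|h]; rewrite ?group_hom1 ?disp1 ?gmulfM ?dispM ?group_homV ?dispV.
  + by rewrite /det2 !mulr0 subrr.
  + rewrite /det2 /= => h0 k0; rewrite -[RHS](addr0 0)%R -{1}h0 -k0; ring.
  + by rewrite /det2 plane_opp /= => h0; rewrite -[RHS]oppr0 -h0; ring.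
have := vg (beta (x r)); have := vg (beta (y r)); rewrite !bK disp_x disp_y eqxx.
by case: v {vx vy vg} => v1 v2; rewrite /det2 /= => H1 H2; congr pair; lia.
Qed.

(* Images of different factors commute, hence have parallel displacements; since the
   image of [alpha] spans the plane, only one factor can contribute. *)
Lemma factor_source r : exists q, forall t, t != q ->
  disp r (alpha (x t)) = 0%R /\ disp r (alpha (y t)) = 0%R.
Proof.
have comm_alpha g h : commute g h -> commute (alpha g) (alpha h).
  by rewrite /commute -!gmulfM => ->.
have [[q [c [cq c0]]]|none] := pselect (exists q c, (c = x q \/ c = y q) /\
  disp r (alpha c) != 0%R); last first.
  by exists r => t _; split; apply/eqP/negPn/negP => H; apply: none; exists t;
    [exists (x t)|exists (y t)]; split; auto.
have comm_cd q' t c' d : t != q' -> (c' = x q' \/ c' = y q') -> (d = x t \/ d = y t) ->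
    det2 (disp r (alpha c')) (disp r (alpha d)) = 0%R.
  move=> tq cq' dt; apply/det2_commute/comm_alpha.
  have [xx xy yy] := pfp_comm Kxy tq.
  have [xx' xy' yy'] : [/\ commute (x q') (x t), commute (x q') (y t) & commute (y q') (y t)].
    by apply: (pfp_comm Kxy); rewrite eq_sym.
  by case: cq' dt => -> [->|->].
exists q => t tq.
suff H d : (d = x t \/ d = y t) -> disp r (alpha d) = 0%R by split; apply: H; auto.
move=> dt; apply/eqP/negPn/negP => d0.
(* Images from the factor [q] are compared with [c] through [d], which comes from another factor and
   is parallel to both. *)
have all s e : (e = x s \/ e = y s) ->
    det2 (disp r (alpha c)) (disp r (alpha e)) = 0%R.
  move=> es; have [sq|sq] := eqVneq s q; last exact: (comm_cd q s c e sq cq es).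
  apply: (det2_parallel d0); first exact: (comm_cd q t c d tq cq dt).
  by apply: (comm_cd t s d e _ dt es); rewrite sq eq_sym.
have /eqP := c0; apply; apply: (@det2_gen r) => s; apply: (all s); auto.
Qed.

Definition source r : I := sval (cid (factor_source r)).

Lemma sourceP r t : t != source r ->
  disp r (alpha (x t)) = 0%R /\ disp r (alpha (y t)) = 0%R.
Proof. by rewrite /source; case: cid => q /= Hq; apply: Hq. Qed.

Lemma disp_span (f : K -> K) r q : (forall g h, f (g * h) = f g * f h) ->
  (forall t, t != q -> disp r (f (x t)) = 0%R /\ disp r (f (y t)) = 0%R) ->
  forall g, disp r (f g) = span2 (disp r (f (x q))) (disp r (f (y q))) (disp q g).
Proof.
move=> fM fq; have f1 : f 1 = 1 by apply: (mulIg (f 1)); rewrite -fM !mul1g.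
have fV g : f g^-1 = (f g)^-1 by apply: (mulIg (f g)); rewrite -fM !mulVg f1.
apply: (pfp_gen Kxy) => [|t|t].
- split=> [|h k Eh Ek|h Eh].
  + by rewrite f1 !disp1 /span2 !plane0 /= !mul0r addr0.
  + by rewrite fM !dispM Eh Ek /span2 !plane_add /=; congr pair; ring.
  + by rewrite fV !dispV Eh /span2 !plane_opp /=; congr pair; ring.
- rewrite disp_x; case: eqVneq => [->|/fq [-> _]]; last by rewrite /span2 !plane0 /= !mul0r addr0.
  by rewrite /span2 /= !mul1r !mul0r !addr0; case: (disp _ _).
- rewrite disp_y; case: eqVneq => [->|/fq [_ ->]]; last by rewrite /span2 !plane0 /= !mul0r addr0.
  by rewrite /span2 /= !mul1r !mul0r !add0r; case: (disp _ _).
Qed.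

Lemma span20 a b : span2 a b 0%R = 0%R.
Proof. by rewrite /span2 plane0 /= !mul0r addr0. Qed.

Lemma disp_alpha r g : disp (source r) g = 0%R -> disp r (alpha g) = 0%R.
Proof.
move=> g0; rewrite (@disp_span alpha r (source r)) ?g0 ?span20 //; first exact: gmulfM.
by move=> t; apply: sourceP.
Qed.

(** If a factor were the source of none, [alpha] would send its generator into [disp0], and [beta]
    would bring the generator itself into [disp0]. *)
Lemma source_inj : injective source.
Proof.
have surj q : q \in codom source.
  apply/negPn/negP => qS; have : disp0 (alpha (x q)).
    move=> r; have [] := @sourceP r q => //.
    by apply: contraNneq qS => ->; apply: codom_f.
  by move/(disp0_morph beta) => /(_ q); rewrite aK disp_x eqxx.
have E : #|codom source| = #|I| by apply: eq_card => q; rewrite surj.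
by apply/injectiveP/card_uniqP; rewrite size_map -cardE.
Qed.

Lemma iterM k g h : iter k alpha (g * h) = iter k alpha g * iter k alpha h.
Proof. by elim: k => //= k ->; rewrite gmulfM. Qed.

Lemma iterV k g : iter k alpha g^-1 = (iter k alpha g)^-1.
Proof. by elim: k => //= k ->; rewrite group_homV. Qed.

Lemma iter_comm k g h : iter k alpha (comm g h) = comm (iter k alpha g) (iter k alpha h).
Proof. by rewrite /comm !iterM !iterV. Qed.

Lemma iterJ k g h :
  iter k alpha (g * h * g^-1) = iter k alpha g * iter k alpha h * (iter k alpha g)^-1.
Proof. by rewrite !iterM iterV. Qed.

Lemma disp0_iter k g : disp0 g -> disp0 (iter k alpha g).
Proof. by move=> g0; elim: k => //= k; apply: disp0_morph. Qed.

Lemma disp_iter k r g : disp (iter k source r) g = 0%R -> disp r (iter k alpha g) = 0%R.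
Proof.
elim: k r => //= k IHk r g0; apply: disp_alpha; apply: IHk.
by rewrite -iterSr.
Qed.

Lemma disp_iter_xy k r t : t != iter k source r ->
  disp r (iter k alpha (x t)) = 0%R /\ disp r (iter k alpha (y t)) = 0%R.
Proof. by move=> tr; split; apply: disp_iter; rewrite ?disp_x ?disp_y (negPf tr). Qed.

Section Cycle.
Variable r : I.
Let o := fingraph.order source r.

Definition ret_x : plane := disp r (iter o alpha (x r)).
Definition ret_y : plane := disp r (iter o alpha (y r)).

Lemma iter_source_order : iter o source r = r.
Proof. exact: (iter_order source_inj r). Qed.

Lemma iter_source_neq k : (0 < k < o)%N -> r != iter k source r.
Proof.
move=> /andP [k0 ko]; apply: contraTneq k0 => E.
by have := findex_iter ko; rewrite -E findex0 => <-.
Qed.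

Lemma disp_return g : disp r (iter o alpha g) = span2 ret_x ret_y (disp r g).
Proof.
apply: disp_span; first exact: iterM.
by move=> t tr; apply: disp_iter_xy; rewrite iter_source_order.
Qed.

Lemma iter_alphaK k : cancel (iter k beta) (iter k alpha).
Proof. by elim: k => [//|k IHk] g; rewrite iterSr [iter _ beta _]iterS bK IHk. Qed.

Lemma det2_return : (det2 ret_x ret_y = 1 \/ det2 ret_x ret_y = -1)%R.
Proof.
have Ex := disp_return (iter o beta (x r)); have Ey := disp_return (iter o beta (y r)).
move: Ex Ey; rewrite !iter_alphaK disp_x disp_y eqxx.
case: ret_x ret_y (disp r _) (disp r _) => [a1 a2] [b1 b2] [v1 v2] [u1 u2].
rewrite /span2 /det2 /= => -[E1 E2] [E3 E4].
have : ((a1 * b2 - a2 * b1) * (u1 * v2 - u2 * v1) = 1)%R.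
  transitivity ((u1 * a1 + u2 * b1) * (v1 * a2 + v2 * b2)
    - (u1 * a2 + u2 * b2) * (v1 * a1 + v2 * b1))%R; first by ring.
  by rewrite -E1 -E2 -E3 -E4.
move/(congr1 absz); rewrite abszM => /eqP; rewrite muln_eq1 => /andP [/eqP H _].
move: H; move: (a1 * b2 - a2 * b1)%R => d; lia.
Qed.

Definition cycle_sum (h : K -> int) (g : K) : int := (\sum_(k < o) h (iter k alpha g))%R.

(** Applying [alpha] shifts the sum along the cycle by one step, and the new last term equals the
    old first one. *)
Lemma cycle_sum_alpha h g : h (iter o alpha g) = h g ->
  cycle_sum h (alpha g) = cycle_sum h g.
Proof.
have o0 : (0 < o)%N by exact: fingraph.order_gt0.
rewrite /cycle_sum -(prednK o0) => hg.
rewrite big_ord_recr [RHS]big_ord_recl /= addrC -iterSr /= hg; congr (_ + _)%R.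
by apply: eq_bigr => k _; rewrite -iterSr.
Qed.

Lemma cycle_sum_additive (A : K -> Prop) h : (forall g, A g -> A (alpha g)) ->
  additive_on A h -> additive_on A (cycle_sum h).
Proof.
move=> Aa hA g g' Ag Ag'; rewrite /cycle_sum -big_split; apply: eq_bigr => k _ /=.
have Ai e : A e -> A (iter k alpha e) by move=> Ae; elim: (nat_of_ord k) => //= i; apply: Aa.
by rewrite iterM hA //; apply: Ai.
Qed.

Lemma cycle_sum_first h g : (forall k, (0 < k < o)%N -> h (iter k alpha g) = 0%R) ->
  cycle_sum h g = h g.
Proof.
have o0 : (0 < o)%N by exact: fingraph.order_gt0.
rewrite /cycle_sum -(prednK o0) => hg; rewrite big_ord_recl big1 ?addr0 // => k _.
by apply: hg; rewrite lift0 /= ltnS.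
Qed.

End Cycle.

(** After [k] steps both entries of the commutator have no displacement in the plane of [r], so the
    terms of [area_comm] cancel in pairs. *)
Lemma area_iter_conj r k P w g i : (forall j, j = r -> i != iter k source j) ->
  area r P (iter k alpha (g * comm (x i) (y i) * g^-1)) w = 0%R.
Proof.
move=> /(_ r erefl) /disp_iter_xy [X0 Y0].
rewrite iterJ area_conj ?disp_comm // iter_comm ?disp_comm // area_comm X0 Y0 !addr0.
by rewrite addrAC addrK subrr.
Qed.

(* The determinant of [1 - B], where [B] is the return map on the plane of [r]. *)
Definition fix_det r : int :=
  ((1 - (ret_x r).1) * (1 - (ret_y r).2) - (ret_x r).2 * (ret_y r).1)%R.

Lemma reidemeister_fixed_direction r : fix_det r = 0%R -> reidemeister_number alpha = None.
Proof.
move=> det0; set B1 := ret_x r in det0; set B2 := ret_y r in det0.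
(* A row vector fixed by the return map [B]: a nonzero row of the adjugate of [1 - B], or [(1, 0)]
   if both rows vanish, which means [B = 1]. *)
have [l1 [l2 [l0 E1 E2]]] : exists l1 l2 : int, [/\ (l1, l2) <> (0, 0)%R,
    (l1 * B1.1 + l2 * B1.2 = l1)%R & (l1 * B2.1 + l2 * B2.2 = l2)%R].
  move: det0; rewrite /fix_det -/B1 -/B2; case: B1 B2 => [a1 a2] [b1 b2] /= det0.
  have [a0|a0] := eqVneq (a2, 1 - a1)%R (0, 0)%R.
    have [b0|b0] := eqVneq (1 - b2, b1)%R (0, 0)%R.
      exists 1%R, 0%R; move: a0 b0 => [-> a10] [b20 ->]; split=> //.
        by have -> : a1 = 1%R by lia.
      by rewrite mulr0 mul0r.
    exists (1 - b2)%R, b1; split; first exact/eqP.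
      by apply/eqP; rewrite -subr_eq0; apply/eqP; rewrite -[RHS]oppr0 -det0; ring.
    by ring.
  exists a2, (1 - a1)%R; split; first exact/eqP.
    by ring.
  by apply/eqP; rewrite -subr_eq0; apply/eqP; rewrite -[RHS]oppr0 -det0; ring.
pose h g : int := (l1 * (disp r g).1 + l2 * (disp r g).2)%R.
have hM g g' : h (g * g') = (h g + h g')%R by rewrite /h dispM plane_add /=; ring.
have ho g : h (iter (fingraph.order source r) alpha g) = h g.
  rewrite /h disp_return /span2 /= -/B1 -/B2; move: (disp r g) => d.
  transitivity ((l1 * B1.1 + l2 * B1.2) * d.1 + (l1 * B2.1 + l2 * B2.2) * d.2)%R.
    by ring.
  by rewrite E1 E2.
have first g : (forall k, (0 < k < fingraph.order source r)%N ->
    disp r (iter k alpha g) = 0%R) -> cycle_sum r h g = h g.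
  move=> H; apply: cycle_sum_first => k /H; rewrite /h => ->.
  by rewrite plane0 /= !mulr0 addr0.
have [hx hy] : cycle_sum r h (x r) = l1 /\ cycle_sum r h (y r) = l2.
  split; rewrite first; rewrite /h ?disp_x ?disp_y ?eqxx /=; try ring;
    by move=> k /iter_source_neq /disp_iter_xy [].
have [u hu] : exists u, cycle_sum r h u != 0%R.
  have [l10|l10] := eqVneq l1 0%R; last by exists (x r); rewrite hx.
  by exists (y r); rewrite hy; apply: contra_not_neq l0 => ->; rewrite l10.
apply: (reidemeister_functional (K := fun _ => True) (l := cycle_sum r h) (g := 1) (u := u)) => //.
- by exists (ordinal 1), (fun _ => ord0).
- by apply: cycle_sum_additive => // g g' _ _; apply: hM.
- by move=> g _; rewrite mul1g invg1 mulg1 cycle_sum_alpha.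
Qed.

(** The return map fixes [disp r z], and multiplying by the adjugate of [1 - B] gives [fix_det r]
    times this displacement. This forces an element that twists one member of [disp0] into another
    to lie in [disp0]. *)
Lemma disp0_fixed z : (forall r, fix_det r != 0%R) ->
  (forall r, disp r (alpha z) = disp r z) -> disp0 z.
Proof.
move=> det0 za r.
have zk k : forall q, disp q (iter k alpha z) = disp q z.
  elim: k => //= k IHk q; rewrite -[RHS]za.
  have E := @disp_span alpha q (source q) (fun g h => gmulfM g h) (@sourceP q).
  by rewrite [LHS]E [RHS]E IHk.
have := disp_return r z; rewrite zk; move: (det0 r); rewrite /fix_det /span2.
case: (ret_x r) (ret_y r) (disp r z) => [a1 a2] [b1 b2] [u1 u2] /= d0 [E1 E2].
have F1 : (((1 - a1) * (1 - b2) - a2 * b1) * u1 = 0)%R.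
  transitivity ((1 - b2) * (u1 - (u1 * a1 + u2 * b1)) + b1 * (u2 - (u1 * a2 + u2 * b2)))%R;
    first by ring.
  by rewrite -E1 -E2 !subrr !mulr0 addr0.
have F2 : (((1 - a1) * (1 - b2) - a2 * b1) * u2 = 0)%R.
  transitivity ((1 - a1) * (u2 - (u1 * a2 + u2 * b2)) + a2 * (u1 - (u1 * a1 + u2 * b1)))%R;
    first by ring.
  by rewrite -E1 -E2 !subrr !mulr0 addr0.
by move/eqP: F1; move/eqP: F2; rewrite !mulf_eq0 (negPf d0) /= => /eqP -> /eqP ->.
Qed.

(** The subgroup [disp0] has infinite index, so [reidemeister_functional] does not apply;
    [disp0_fixed] takes its place. Invariance needs testing only on the conjugates of the commutator
    of the factor [r]: on those of the other factors both sides vanish, and together they generate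
    [disp0]. *)
Lemma reidemeister_area r P : (forall r, fix_det r != 0%R) ->
  (forall g, area r P (iter (fingraph.order source r) alpha (g * comm (x r) (y r) * g^-1)) 0%R
    = area r P (g * comm (x r) (y r) * g^-1) 0%R) ->
  (exists g, area r P (g * comm (x r) (y r) * g^-1) 0%R != 0%R) ->
  reidemeister_number alpha = None.
Proof.
move=> det0 hcomm [g0 hg0]; pose h g := area r P g 0%R; pose o := fingraph.order source r.
have [[K1 KM KV] KJ] := disp0_normal.
have ha : additive_on disp0 h by move=> g g' G0 _; rewrite /h areaM G0 addr0.
have ho g : disp0 g -> h (iter o alpha g) = h g.
  suff H : disp0 g -> disp0 g /\ forall e, h (iter o alpha (e * g * e^-1)) = h (e * g * e^-1).
    by move/H => [_ /(_ 1)]; rewrite mul1g invg1 mulg1.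
  apply: (disp0_ind (N := fun g => disp0 g /\ forall e,
    h (iter o alpha (e * g * e^-1)) = h (e * g * e^-1))) => [|i].
  - split; first split=> [|a b [A0 Ha] [B0 Hb]|a [A0 Ha]].
    + split=> // e; rewrite mulg1 mulgV; congr h.
      by elim: (o) => //= k ->; rewrite group_hom1.
    + split=> [|e]; first exact: KM.
      have -> : e * (a * b) * e^-1 = (e * a * e^-1) * (e * b * e^-1).
        by rewrite !mulgA mulgKV.
      move: (Ha e) (Hb e) (KJ e a A0) (KJ e b B0).
      move: (e * a * e^-1) (e * b * e^-1) => a' b' Ea Eb A' B'.
      by rewrite iterM !ha ?Ea ?Eb //; exact: disp0_iter.
    + split=> [|e]; first exact: KV.
      have -> : e * a^-1 * e^-1 = (e * a * e^-1)^-1 by rewrite !invMg invgK mulgA.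
      move: (Ha e) (KJ e a A0); move: (e * a * e^-1) => a' Ea A'.
      by rewrite iterV !(additive_onV (And3 K1 KM KV) ha) ?Ea //; exact: disp0_iter.
    + move=> a b [B0 Hb]; split=> [|e]; first exact: KJ.
      by have := Hb (e * a); rewrite invMg !mulgA.
  - split=> [q|e]; first exact: disp_comm.
    have [->|ir] := eqVneq i r; first exact: hcomm.
    rewrite /h area_iter_conj => [|j ->]; last by rewrite iter_source_order.
    by rewrite (@area_iter_conj r 0) => // j ->.
pose w := g0 * comm (x r) (y r) * g0^-1; pose psi := cycle_sum r h.
have w0 : disp0 w by apply: KJ => q; apply: disp_comm.
have psi_a : additive_on disp0 psi.
  by apply: cycle_sum_additive ha => g; apply: disp0_morph.
have psi_w : psi w != 0%R.
  rewrite /psi cycle_sum_first // => k kr; apply: area_iter_conj => j ->.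
  exact: iter_source_neq.
apply: (@reidemeister_number_inftyP _ _ (fun m => w ^+ m)) => m m' [z zE].
have Kg : subgroup_pred disp0 by split.
have wX k : disp0 (w ^+ k) by apply: (subgroup_predX Kg k w0).
have z0 : disp0 z.
  apply: disp0_fixed => // q; have := congr1 (disp q) zE.
  rewrite !dispM dispV !wX addr0 => /esym/eqP.
  by rewrite subr_eq0 => /eqP.
have := congr1 psi zE; rewrite psi_a ?psi_a ?(additive_onV Kg psi_a) //;
  do ?[exact: disp0_morph | exact: KM | apply: KV].
rewrite /psi cycle_sum_alpha ?ho // addrAC subrr add0r -/psi !(additive_onX Kg psi_a) //.
exact: mulrIn.
Qed.

Lemma reidemeister_free_pairs (i0 : I) : reidemeister_number alpha = None.
Proof.
have [[r /eqP r0]|none] := pselect (exists r, fix_det r == 0%R).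
  exact: reidemeister_fixed_direction r0.
have det0 r : fix_det r != 0%R by apply/negP => H; apply: none; exists r.
have [D1|D1] := det2_return i0.
  (* With [det B = 1] the image of the unit square again has area 6 in the normalization of
     [cubic0], wherever it is based. *)
  apply: (@reidemeister_area i0 cubic0) => // [g|].
    rewrite iterJ iter_comm !area_conj; do ?[exact: disp_comm].
    rewrite area_cubic0_comm -/(ret_x i0) -/(ret_y i0) D1.
    by rewrite area_cubic0_comm disp_x disp_y eqxx.
  by exists 1; rewrite mul1g invg1 mulg1 area_cubic0_comm disp_x disp_y eqxx.
have := det0 i0; move: D1; rewrite /fix_det.
pose X := iter (fingraph.order source i0) alpha (x i0).
pose Y := iter (fingraph.order source i0) alpha (y i0).
(* The moments of the image of the unit square under the return map; the total winding [m] is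
   [det B]. *)
have [m [mx [my [mxx [mxy [myy mE]]]]]] :=
  area_moments i0 (fun i => disp_comm i X Y).
have m1 : (det2 (ret_x i0) (ret_y i0) = m)%R.
  have := mE 0%R 0%R 0%R 0%R 0%R 1%R 0%R 0%R.
  rewrite -/cubic0 area_cubic0_comm -/(ret_x i0) -/(ret_y i0) => E.
  by apply: (mulfI (_ : 6 != 0 :> int)%R) => //; rewrite E; ring.
have ret g := disp_return i0 g.
move: m1; rewrite /det2; case: (ret_x i0) (ret_y i0) ret => [a1 a2] [b1 b2] ret /= m1 D1 det0'.
have {}m1 : m = (-1)%R by rewrite -m1.
have {}D1 : (a1 * b2 = a2 * b1 - 1)%R by lia.
(* Here [t] is the trace of [B]; since [det B = -1], the determinants of [1 - B] and [1 + B] are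
   [- t] and [t]. The form [q (u, v) = a2 u^2 + p u v - b1 v^2] is the determinant of [(u, v)] and
   its image under [B]. *)
pose t := (a1 + b2)%R; pose p : int := (b2 - a1)%R.
have t0 : t != 0%R by apply: contra_neq det0' => t0; rewrite /t in t0; lia.
(* [S] is the polar form of [q] paired with the first moments [mx, my]. For the quadratic part
   [2 t q], invariance asks for a linear part [L] with [L w + L (B w) = 2 t S (B w)]. By
   Cayley-Hamilton [t B (1 + B)^-1 = B - 1], so [L w = 2 S (B w - w)], with coefficients
   [2 l1, 2 l2]. The constant terms then give [2 k6]; the factor [2 t] is what keeps all
   coefficients integral. *)
pose S (u v : int) : int := (2 * a2 * u * mx + p * (u * my + v * mx) - 2 * b1 * v * my)%R.
pose l1 := S (a1 - 1)%R a2; pose l2 := S b1 (b2 - 1)%R.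
pose k6 : int := (l1 * mx + l2 * my + t * (a2 * mxx + p * mxy - b1 * myy))%R.
pose P := cubic (2 * t * a2, 2 * t * p, - 2 * t * b1, 2 * l1, 2 * l2, k6)%R.
have PE g : area i0 P (g * comm (x i0) (y i0) * g^-1) 0%R =
    (P (disp i0 g) - P (disp i0 g + (0, 1)))%R.
  by rewrite area_conj ?add0r ?area_commxy //; apply: disp_comm.
apply: (@reidemeister_area i0 P) => // [g|].
  rewrite PE iterJ iter_comm area_conj ?add0r; last exact: disp_comm.
  rewrite ret cubicD; case: (disp i0 g) => u v; rewrite /span2 /= mE m1.
  congr (6 * _)%R; apply/eqP; rewrite -subr_eq0; apply/eqP.
  transitivity ((a1 * b2 - (a2 * b1 - 1)) *
      (2 * S u v - 2 * t * (a2 * u * u + p * u * v - b1 * v * v)))%R.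
    by rewrite /k6 /l1 /l2 /S /p /t; ring.
  by rewrite D1 subrr mul0r.
have [//|none'] := pselect (exists g, area i0 P (g * comm (x i0) (y i0) * g^-1) 0%R != 0%R).
have val g : (P (disp i0 g) - P (disp i0 g + (0, 1)) = 0)%R.
  by rewrite -PE; apply/eqP/negPn/negP => H; apply: none'; exists g.
(* Vanishing at the six points 0, the four unit vectors and [(1, 1)] kills all coefficients of a
   quadratic polynomial in two variables. Then [q = 0], so [B] is a scalar whose square is
   [det B = -1]. *)
have := (val 1, (val (x i0), val (x i0)^-1), (val (y i0), val (y i0)^-1), val (x i0 * y i0)).
rewrite dispM !dispV disp1 disp_x disp_y eqxx !plane_opp plane0 plane_add /= !cubicD.
move=> [[[V0 [V1 V2]] [V3 V4]] V5]; rewrite plane_add /= in V5.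
have A2 : (t * a2 = 0)%R by lia.
have B1 : (t * b1 = 0)%R by lia.

have TP : (t * p = 0)%R by lia.
move/eqP: A2; move/eqP: B1; move/eqP: TP; rewrite !mulf_eq0 (negPf t0) /= => /eqP p0.
move=> /eqP b0 /eqP a0; rewrite /p in p0.
have : (a1 * a1 = -1)%R by have -> : (a1 * a1 = a1 * b2)%R; [congr (_ * _)%R;
  lia | rewrite D1 a0; lia].
by have := sqr_ge0 a1; rewrite expr2 => + E; rewrite E.
Qed.

End Automorphism.
End ProductOfFreePairs.

Theorem product_of_free_pairs_R_infinity (K : groupType) (I : finType) (x y : I -> K) (i : I) :
  product_of_free_pairs x y -> R_infinity K.
Proof.
move=> Kxy alpha /multiplicative_inverse [beta [aK bK]].
exact: (reidemeister_free_pairs Kxy aK bK i).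
Qed.

(** * Groups of virtual braid type *)

Definition move_pair (n : nat) (s : 'S_n) (q : 'I_n * 'I_n) : 'I_n * 'I_n := (s q.1, s q.2).

Lemma move_pairM n (s t : 'S_n) q : move_pair (s * t) q = move_pair t (move_pair s q).
Proof. by rewrite /move_pair !permM. Qed.

Lemma move_pair1 n (q : 'I_n * 'I_n) : move_pair 1 q = q.
Proof. by case: q => a b; rewrite /move_pair !perm1. Qed.

Lemma move_pair_inj n (s : 'S_n) : injective (move_pair s).
Proof. by move=> [a b] [c d] [/perm_inj -> /perm_inj ->]. Qed.

Definition swap_pair (n : nat) (q : 'I_n * 'I_n) : 'I_n * 'I_n := (q.2, q.1).

Lemma perm_to_first (n : nat) (l : seq 'I_n.+1) : uniq l ->
  exists s : 'S_n.+1, forall i, (i < size l)%N -> s (nth ord0 l i) = inord i.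
Proof.
elim/last_ind: l => [_|l a IHl]; first by exists 1.
rewrite rcons_uniq => /andP [al ul]; have [s sP] := IHl ul.
have szl : (size l <= n)%N.
  have : uniq (rcons l a) by rewrite rcons_uniq al.
  by move/card_uniqP => E; have := max_card (mem (rcons l a)); rewrite E size_rcons card_ord.
exists (s * tperm (s a) (inord (size l))) => i; rewrite size_rcons ltnS leq_eqVlt.
case/orP => [/eqP ->|il]; first by rewrite nth_rcons ltnn eqxx permM tpermL.
rewrite nth_rcons il permM sP // tpermD //.
  by apply: contra al => /eqP; rewrite -(sP i il) => /perm_inj ->; apply: mem_nth.
by apply/negP => /eqP /(congr1 val); rewrite /= !inordK; lia.
Qed.

(** What the groups [VB_n], [WB_n], [UVB_n] have in common for [n = m + 2], with indices counted
    from 0. The field [vb_hom] is a crossed homomorphism to the [H]-valued functions on ordered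
    pairs of points; the two orders of a crossing receive independent values [a] and [b]. *)
Record virtual_braid (m : nat) (G : groupType) (s v : nat -> G)
    (p : {multiplicative G -> 'S_m.+2}) : Prop := {
  vb_gen : forall A : G -> Prop, subgroup_pred A ->
    (forall i, (i <= m)%N -> A (s i)) -> (forall i, (i <= m)%N -> A (v i)) -> forall g, A g;
  vb_sss : forall i, (i < m)%N -> s i * (s i.+1 * s i) = s i.+1 * (s i * s i.+1);
  vb_vvv : forall i, (i < m)%N -> v i * (v i.+1 * v i) = v i.+1 * (v i * v i.+1);
  vb_vvs : forall i, (i < m)%N -> v i * (v i.+1 * s i) = s i.+1 * (v i * v i.+1);
  vb_v2 : forall i, (i <= m)%N -> v i * v i = 1;
  vb_ss : forall i j, (i.+1 < j <= m)%N -> commute (s i) (s j);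
  vb_vv : forall i j, (i.+1 < j <= m)%N -> commute (v i) (v j);
  vb_sv : forall i j, (i.+1 < j <= m)%N -> commute (s i) (v j);
  vb_vs : forall i j, (i.+1 < j <= m)%N -> commute (v i) (s j);
  vb_ps : forall i, (i <= m)%N -> p (s i) = tperm (inord i) (inord i.+1);
  vb_pv : forall i, (i <= m)%N -> p (v i) = tperm (inord i) (inord i.+1);
  vb_hom : forall (H : groupType) (a b : H), exists D : G -> 'I_m.+2 * 'I_m.+2 -> H,
    [/\ forall g h q, D (g * h) q = D g q * D h (move_pair (p g) q),
        forall i q, (i <= m)%N -> D (v i) q = 1 &
        forall i q, (i <= m)%N -> D (s i) q =
          if q == (inord i, inord i.+1) then a
          else if q == (inord i.+1, inord i) then b else 1] }.

Section VirtualBraid.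
Variables (m : nat) (G : groupType) (s v : nat -> G) (p : {multiplicative G -> 'S_m.+2}).
Hypothesis Gvb : virtual_braid s v p.

Definition vsub (j : nat) (g : G) : Prop := forall A : G -> Prop, subgroup_pred A ->
  (forall i, (j <= i <= m)%N -> A (v i)) -> A g.

Lemma vsub_subgroup j : subgroup_pred (vsub j).
Proof.
split=> [A [] //|g h Hg Hh A AG Av|g Hg A AG Av].
- by case: (AG) => _ AM _; apply: AM; [apply: Hg|apply: Hh].
- by case: (AG) => _ _ AV; apply: AV; apply: Hg.
Qed.

Lemma vsub_v j i : (j <= i <= m)%N -> vsub j (v i).
Proof. by move=> ji A _; apply. Qed.

Lemma vsub_leq j k g : (k <= j)%N -> vsub j g -> vsub k g.
Proof.
move=> kj Hg A AG Av; apply: Hg => // i /andP [ji im]; apply: Av.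
by rewrite (leq_trans kj ji).
Qed.

Lemma v_inv i : (i <= m)%N -> (v i)^-1 = v i.
Proof. by move=> im; apply: (mulIg (v i)); rewrite mulVg (vb_v2 Gvb). Qed.

Lemma vsub_ind_r j (A : G -> Prop) : A 1 ->
  (forall g i, (j <= i <= m)%N -> A g -> A (g * v i)) -> forall g, vsub j g -> A g.
Proof.
move=> A1 Av g Hg.
suff [] : (forall x, A x -> A (x * g)) /\ (forall x, A x -> A (x * g^-1)).
  by move/(_ 1 A1); rewrite mul1g.
apply: (Hg (fun g => (forall x, A x -> A (x * g)) /\ (forall x, A x -> A (x * g^-1)))) => [|i ji];
  last first.
  by rewrite v_inv; [split=> x; apply: Av | case/andP: ji].
split=> [|e h [G1 G2] [H1 H2]|e [G1 G2]].
- by split=> x; rewrite ?invg1 mulg1.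
- by split=> x Ax; rewrite ?invMg !mulgA; [apply/H1/G1|apply/G2/H2].
- by split=> x Ax; rewrite ?invgK; [apply: G2|apply: G1].
Qed.

(** The product of the [d] consecutive generators from [v j] on: a representative of a coset of
    [vsub j.+1] in [vsub j], recognized by where it sends the point [j]. *)
Fixpoint run (j d : nat) : G := if d is d'.+1 then run j d' * v (j + d') else 1.

Lemma run_vsub j d : (j + d <= m.+1)%N -> vsub j (run j d).
Proof.
have [V1 VM _] := vsub_subgroup j.
elim: d => //= d IHd jd; apply: VM; first by apply: IHd; lia.
by apply: vsub_v; lia.
Qed.

Lemma run_commute j d t : (j + d < t <= m)%N -> commute (run j d) (v t).
Proof.
elim: d => [|d IHd] jt /=; first by rewrite /commute mul1g mulg1.
have c1 : commute (run j d) (v t) by apply: IHd; lia.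
have c2 : commute (v (j + d)) (v t) by apply: (vb_vv Gvb); lia.
by rewrite /commute -mulgA c2 mulgA c1 mulgA.
Qed.

Lemma run_shift j d t : (j <= t)%N -> (t.+1 < j + d <= m.+1)%N ->
  run j d * v t = v t.+1 * run j d.
Proof.
elim: d => [|d IHd] jt td; first lia.
have [tE|tN] := eqVneq t.+1 (j + d)%N; last first.
  have c : commute (v (j + d)) (v t) by apply/commute_sym/(vb_vv Gvb); lia.
  by rewrite /= -mulgA c mulgA IHd ?mulgA //; lia.
case: d tE td {IHd} => [|d] tE td; first lia.
have {}tE : t = (j + d)%N by lia.
have c : commute (run j d) (v t.+1) by apply: run_commute; lia.
rewrite /= addnS -tE -!mulgA (vb_vvv Gvb); last lia.
by rewrite !mulgA c.
Qed.

(** Coset enumeration for the Coxeter presentation of the symmetric group. A further [v t] lengthens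
    the run if [t = j + d], shortens it if [t.+1 = j + d], and otherwise slides through to the left
    factor, becoming [v t.+1] inside the run. Injectivity of [p] on [vsub 0] rests on this. *)
Lemma vsub_run j g : vsub j g ->
  exists h d, [/\ vsub j.+1 h, (j + d <= maxn j m.+1)%N & g = h * run j d].
Proof.
have [V1 VM _] := vsub_subgroup j.+1.
move: g; apply: vsub_ind_r => [|g t jt [h [d [Hh jd ->]]]].
  by exists 1, 0%N; rewrite mulg1; split=> //; lia.
case: (ltngtP t (j + d)%N) => [tjd|tjd|tE].
- have [tE|tN] := eqVneq t.+1 (j + d)%N.
    case: d jd tjd tE => [|d] jd tjd tE; first lia.
    have {}tE : t = (j + d)%N by lia.
    exists h, d; split=> //; first lia.
    by rewrite /= -tE -!mulgA (vb_v2 Gvb) ?mulg1 //; lia.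
  exists (h * v t.+1), d; split=> //; first by apply: VM => //; apply: vsub_v; lia.
  by rewrite -!mulgA run_shift //; lia.
- exists (h * v t), d; split=> //; first by apply: VM => //; apply: vsub_v; lia.
  by rewrite -!mulgA run_commute //; lia.
- by exists h, d.+1; split=> //; [lia | rewrite tE mulgA].
Qed.

Lemma inord_eq i j : (i <= m.+1)%N -> (j <= m.+1)%N ->
  ((inord i : 'I_m.+2) == inord j) = (i == j).
Proof. by move=> im jm; rewrite -val_eqE /= !inordK. Qed.

Lemma run_move j d : (j + d <= m.+1)%N -> p (run j d) (inord j) = inord (j + d).
Proof.
elim: d => [|d IHd] jd /=; first by rewrite group_hom1 perm1 addn0.
by rewrite gmulfM permM IHd ?(vb_pv Gvb) ?tpermL ?addnS //; lia.
Qed.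

Lemma vsub_fix j i g : (i < j)%N -> vsub j g -> p g (inord i) = inord i.
Proof.
move=> ij Hg; apply: (Hg (fun g => p g (inord i) = inord i)) => [|k /andP [jk km]].
- split=> [|h k Hh Hk|h Hh]; first by rewrite group_hom1 perm1.
  + by rewrite gmulfM permM Hh.
  + by rewrite group_homV -{1}Hh permK.
- by rewrite (vb_pv Gvb) // tpermD // inord_eq; lia.
Qed.

Lemma vsub_fix_next j g : (j <= m.+1)%N -> vsub j g -> p g (inord j) = inord j -> vsub j.+1 g.
Proof.
move=> jm /vsub_run [h [d [Hh jd ->]]]; rewrite gmulfM permM (vsub_fix _ Hh) //.
rewrite run_move; last lia.
move/eqP; rewrite inord_eq; [move=> dE|lia|lia].
have -> : d = 0%N by lia.
by rewrite mulg1.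
Qed.

Lemma vsub_p1 g : vsub 0 g -> p g = 1 -> g = 1.
Proof.
move=> g0 pg; have : vsub m.+1 g.
  suff H j : (j <= m.+1)%N -> vsub j g by apply: H.
  elim: j => // j IHj jm; apply: vsub_fix_next; [lia| apply: IHj; lia |].
  by rewrite pg perm1.
move/(_ (fun h => h = 1)); apply=> [|i]; last lia.
by split=> [|x y -> ->|x ->]; rewrite ?mulg1 ?invg1.
Qed.

Lemma vsub_p_inj g h : vsub 0 g -> vsub 0 h -> p g = p h -> g = h.
Proof.
have [V1 VM VV] := vsub_subgroup 0.
move=> g0 h0 gh; apply: (mulIg h^-1); rewrite mulgV; apply: vsub_p1.
  by apply: VM => //; apply: VV.
by rewrite gmulfM group_homV gh mulgV.
Qed.

Lemma vsub_lift (t : 'S_m.+2) : exists2 w, vsub 0 w & p w = t.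
Proof.
suff H k : forall j, (j + k = m.+1)%N -> forall t : 'S_m.+2,
    (forall i, (i < j)%N -> t (inord i) = inord i) -> exists2 w, vsub j w & p w = t.
  by apply: (H m.+1 0%N).
elim: k => [|k IHk] j jk u uP.
  exists 1; first by case: (vsub_subgroup j).
  rewrite group_hom1; apply/permP => a; rewrite perm1.
  have [am|am] := ltnP a j; first by rewrite -[a]inord_val uP.
  have [um|um] := ltnP (u a) j; last by apply: val_inj; have := ltn_ord a; have := ltn_ord (u a);
    rewrite /=; lia.
  by have := uP _ um; rewrite inord_val => /perm_inj /(congr1 val) /=; lia.
have [d ud] : exists d, (u (inord j) = j + d :> nat)%N.
  exists (u (inord j) - j)%N; rewrite subnKC // leqNgt; apply/negP => H.
  have := uP _ H; rewrite inord_val => /perm_inj /(congr1 val).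
  by rewrite /= inordK; lia.
have jd : (j + d <= m.+1)%N by rewrite -ud -ltnS.
have jk' : (j.+1 + k = m.+1)%N by lia.
have [] := IHk j.+1 jk' (u * (p (run j d))^-1).
  move=> i ij; rewrite permM; have [->|ne] := eqVneq i j.
    have -> : u (inord j) = inord (j + d) by apply: val_inj; rewrite /= inordK.
    by rewrite -(run_move jd) permK.
  rewrite uP; last lia.
  have E : p (run j d) (inord i) = inord i by apply: (@vsub_fix j); [lia|apply: run_vsub].
  by rewrite -{1}E permK.
move=> w Hw pw; have [_ VM _] := vsub_subgroup j.
exists (w * run j d); last by rewrite gmulfM pw mulgKV.
by apply: VM; [apply: vsub_leq Hw | apply: run_vsub].
Qed.

Lemma vsub_torsion w : vsub 0 w -> exists k, w ^+ k.+1 = 1.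
Proof.
move=> Hw; exists (#[p w].-1); rewrite prednK ?order_gt0 //; apply: vsub_p1.
  by apply: (subgroup_predX (K := vsub 0) (vsub_subgroup 0) _ Hw).
by rewrite -[RHS](expg_order (p w)); elim: (#[p w]) => [|k IHk];
  rewrite ?expg0 ?group_hom1 // !expgS gmulfM IHk.
Qed.

Notation base := ((inord 0, inord 1) : 'I_m.+2 * 'I_m.+2).

Definition lam := s 0 * v 0.

(* The conjugate of [lam] attached to the ordered pair [q]; junk if its points coincide. *)
Definition lamp (q : 'I_m.+2 * 'I_m.+2) : G :=
  xget 1 [set g | exists w, [/\ vsub 0 w, move_pair (p w) q = base & g = w * lam * w^-1]]%classic.

Lemma p_lam : p lam = 1.
Proof. by rewrite /lam gmulfM (vb_ps Gvb) // (vb_pv Gvb) // tperm2. Qed.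

Lemma lam_commute w : vsub 2 w -> commute w lam.
Proof.
move=> Hw; apply: (Hw (fun w => commute w lam)) => [|i /andP [i2 im]].
- split=> [|g h Hg Hh|g Hg]; first by rewrite /commute mul1g mulg1.
  + by rewrite /commute -mulgA Hh mulgA Hg mulgA.
  + exact/commute_sym/commuteV/commute_sym.
- have c1 : commute (s 0) (v i) by apply: (vb_sv Gvb); lia.
  have c2 : commute (v 0) (v i) by apply: (vb_vv Gvb); lia.
  by rewrite /commute /lam mulgA -c1 -!mulgA c2.
Qed.

(** Two choices of [w] differ by an element fixing both points of [base]; it lies in [vsub 2], hence
    commutes with [lam]. *)
Lemma lampE w q : vsub 0 w -> move_pair (p w) q = base -> w * lam * w^-1 = lamp q.
Proof.
move=> Hw wq; rewrite /lamp.
set S := [set g | _]%classic.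
have [w' [Hw' wq' ->]] : S (xget 1 S) by apply: xgetPex; exists (w * lam * w^-1), w.
have [_ VM VV] := vsub_subgroup 0.
pose u := w^-1 * w'.
have pu : move_pair (p u) base = base.
  rewrite /u gmulfM group_homV move_pairM -[X in move_pair _ (move_pair _ X)]wq.
  by rewrite -[move_pair _ (move_pair _ q)]move_pairM mulgV move_pair1.
have Hu : vsub 2 u.
  have u0 : vsub 0 u by apply: VM => //; apply: VV.
  by case: pu => u1 u2; apply: vsub_fix_next => //; apply: vsub_fix_next.
have E : w' = w * u by rewrite /u mulgA mulgV mul1g.
move: (lam_commute Hu); clearbody u; rewrite E; move: lam => l ul.
by rewrite invMg !mulgA -(mulgA w u) ul mulgA mulgK.
Qed.

Lemma lamp_witness q : q.1 != q.2 -> exists2 w, vsub 0 w & move_pair (p w) q = base.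
Proof.
move=> q12; have [|t tP] := @perm_to_first m.+1 [:: q.1; q.2]; first by rewrite /= inE q12.
have [w Hw pw] := vsub_lift t; exists w => //.
by rewrite /move_pair pw; have /= := tP 0%N isT; have /= := tP 1%N isT => -> ->.
Qed.

Lemma lampJ w q : q.1 != q.2 -> vsub 0 w -> w * lamp q * w^-1 = lamp (move_pair (p w)^-1 q).
Proof.
move=> q12 Hw; have [w' Hw' wq'] := lamp_witness q12.
have [_ VM VV] := vsub_subgroup 0.
rewrite -(lampE Hw' wq') -(lampE (w := w * w')) ?invMg ?mulgA //; first exact: VM.
by rewrite gmulfM -wq' -move_pairM mulgA mulVg mul1g.
Qed.

Lemma p_lamp q : q.1 != q.2 -> p (lamp q) = 1.
Proof.
case/lamp_witness => w Hw wq; rewrite -(lampE Hw wq).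
by rewrite 2!gmulfM p_lam mulg1 group_homV mulgV.
Qed.

Lemma base_neq : base.1 != base.2.
Proof. by rewrite inord_eq. Qed.

(** Conjugation by [v i * v i.+1] carries both [s i] and [v i] to their successors. *)
Lemma sv_lamp i : (i <= m)%N -> s i * v i = lamp (inord i, inord i.+1).
Proof.
have [V1 VM VV] := vsub_subgroup 0.
elim: i => [_|i IHi im].
  by rewrite -(lampE V1) ?mul1g ?invg1 ?mulg1 //= group_hom1 move_pair1.
have Hw : vsub 0 (v i * v i.+1) by apply: VM; apply: vsub_v; lia.
have E1 : s i.+1 = v i * v i.+1 * s i * (v i * v i.+1)^-1.
  by rewrite -[_ * _ * s i]mulgA (vb_vvs Gvb im) mulgK.
have E2 : v i.+1 = v i * v i.+1 * v i * (v i * v i.+1)^-1.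
  by rewrite -[_ * _ * v i]mulgA (vb_vvv Gvb im) mulgK.
have -> : s i.+1 * v i.+1 = v i * v i.+1 * (s i * v i) * (v i * v i.+1)^-1.
  have key (w a b x y : G) : x = w * a * w^-1 -> y = w * b * w^-1 -> x * y = w * (a * b) * w^-1.
    by move=> -> ->; rewrite !mulgA mulgKV.
  exact: key E1 E2.
rewrite IHi ?lampJ //=; [|by rewrite inord_eq; lia|lia].
rewrite gmulfM !(vb_pv Gvb); try lia.
rewrite invMg !tpermV /move_pair /= !permM.
have i1 : (i <= m.+1)%N by lia. have i2 : (i.+1 <= m.+1)%N by lia.
have i3 : (i.+2 <= m.+1)%N by lia.
by rewrite [tperm (inord i.+1) _ (inord i)]tpermD ?inord_eq ?tpermL ?tpermD ?inord_eq //; lia.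
Qed.

(** The products [k * w], with [k] generated by the [lamp q] and [w] in [vsub 0], are stable under
    left multiplication by the generators, because [vsub 0] permutes the [lamp q]. So they exhaust
    [G], and [p (k * w) = p w] is trivial only for [w = 1]. *)
Lemma pure_ind (A : G -> Prop) : subgroup_pred A ->
  (forall q, q.1 != q.2 -> A (lamp q)) -> forall g, p g = 1 -> A g.
Proof.
move=> AG Al.
pose L g := forall B : G -> Prop, subgroup_pred B -> (forall q, q.1 != q.2 -> B (lamp q)) -> B g.
have [LG LM LV] : subgroup_pred L.
  split=> [B [] //|g h Hg Hh B BG Bl|g Hg B BG Bl]; have [_ BM BV] := BG.
    by apply: BM; [apply: Hg|apply: Hh].
  by apply: BV; apply: Hg.
have [V1 VM VV] := vsub_subgroup 0.
have LJ w g : vsub 0 w -> L g -> L (w * g * w^-1).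
  move=> Hw Hg; apply: (Hg (fun g => L (w * g * w^-1))) => [|q q12].
  - split=> [|h k Hh Hk|h Hh]; first by rewrite mulg1 mulgV.
    + by have := LM _ _ Hh Hk; rewrite !mulgA mulgKV.
    + by have := LV _ Hh; rewrite !invMg invgK !mulgA.
  - rewrite lampJ // => B BG Bl; apply: Bl.
    by rewrite /move_pair /=; apply: contra q12 => /eqP /perm_inj ->.
pose F g := exists k w, [/\ L k, vsub 0 w & g = k * w].
have Fv w g : vsub 0 w -> F g -> F (w * g).
  move=> Hw [k [w' [Lk Hw' ->]]]; exists (w * k * w^-1), (w * w'); split; [exact: LJ|exact: VM|].
  by rewrite !mulgA mulgKV.
have Fl k g : L k -> F g -> F (k * g).
  by move=> Lk [k' [w' [Lk' Hw' ->]]]; exists (k * k'), w'; split; rewrite ?mulgA //; apply: LM.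
have FG g : (forall x, F x -> F (g * x)) /\ (forall x, F x -> F (g^-1 * x)).
  apply: (vb_gen Gvb (A := fun g => (forall x, F x -> F (g * x)) /\
    (forall x, F x -> F (g^-1 * x)))) => [|i im|i im].
  - split=> [|h k [H1 H2] [K1 K2]|h [H1 H2]].
    + by split=> x; rewrite ?invg1 mul1g.
    + by split=> x Fx; rewrite ?invMg -mulgA; [apply/H1/K1|apply/K2/H2].
    + by split=> x Fx; rewrite ?invgK; [apply: H2|apply: H1].
  - have -> : s i = lamp (inord i, inord i.+1) * v i.
      by rewrite -sv_lamp // -mulgA (vb_v2 Gvb) // mulg1.
    have Li : L (lamp (inord i, inord i.+1)).
      by move=> B BG Bl; apply: Bl; rewrite inord_eq /=; lia.
    have Vi : vsub 0 (v i) by apply: vsub_v.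
    split=> x Fx; first by rewrite -mulgA; apply: Fl => //; apply: Fv.
    by rewrite invMg -mulgA; apply: Fv; [exact: VV|apply: Fl => //; exact: LV].
  - by split=> x; apply: Fv; [|apply: VV]; apply: vsub_v.
move=> g pg; have [|k [w [Lk Hw gE]]] := (FG g).1 1; first by exists 1, 1; split; rewrite ?mulg1.
have pk : p k = 1.
  apply: (Lk (fun k => p k = 1)) => [|q q12]; last exact: p_lamp.
  split=> [|x y px py|x px]; first exact: group_hom1.
    by rewrite gmulfM px py mulg1.
  by rewrite group_homV px invg1.
have w1 : w = 1.
  by apply: vsub_p1 => //; move: pg; rewrite -[g]mulg1 gE gmulfM pk mul1g.
by rewrite -[g]mulg1 gE w1 mulg1; apply: Lk.
Qed.

Section Cocycle.
Variables (H : groupType) (a b : H).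

Definition cocycle : G -> 'I_m.+2 * 'I_m.+2 -> H := sval (cid (vb_hom Gvb a b)).

Lemma cocycleM g h q : cocycle (g * h) q = cocycle g q * cocycle h (move_pair (p g) q).
Proof. by rewrite /cocycle; case: cid => D /= []. Qed.

Lemma cocycle1 q : cocycle 1 q = 1.
Proof.
have := cocycleM 1 1 q; rewrite mulg1 group_hom1 move_pair1 => E.
by apply: (mulgI (cocycle 1 q)); rewrite -E mulg1.
Qed.

Lemma cocycleV g q : cocycle g^-1 q = (cocycle g (move_pair (p g)^-1 q))^-1.
Proof.
apply: (mulIg (cocycle g (move_pair (p g)^-1 q))); rewrite mulVg.
by have := cocycleM g^-1 g q; rewrite mulVg cocycle1 group_homV.
Qed.

Lemma cocycle_vsub w q : vsub 0 w -> cocycle w q = 1.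
Proof.
move=> Hw; move: q; apply: (Hw (fun w => forall q, cocycle w q = 1)) => [|i im].
- split=> [q|x y Hx Hy q|x Hx q]; first exact: cocycle1.
    by rewrite cocycleM Hx Hy mulg1.
  by rewrite cocycleV Hx invg1.
- by move=> q; rewrite /cocycle; case: cid => D /= [_ Dv _]; apply: Dv.
Qed.

Lemma cocycle_s i q : (i <= m)%N -> cocycle (s i) q =
  if q == (inord i, inord i.+1) then a else if q == (inord i.+1, inord i) then b else 1.
Proof. by move=> im; rewrite /cocycle; case: cid => D /= [_ _ Ds]; apply: Ds. Qed.

Lemma cocycle_lamp q r : q.1 != q.2 ->
  cocycle (lamp q) r = if r == q then a else if r == swap_pair q then b else 1.
Proof.
case/lamp_witness => w Hw wq; rewrite -(lampE Hw wq).
have [_ _ VV] := vsub_subgroup 0.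
rewrite !cocycleM !(@cocycle_vsub (v 0)) ?(@cocycle_vsub w) ?(@cocycle_vsub w^-1) //;
  do ?[exact: vsub_v | exact: VV].
rewrite mul1g !mulg1 cocycle_s // -wq (inj_eq (@move_pair_inj _ _)).
suff -> : (move_pair (p w) r == (inord 1, inord 0)) = (r == swap_pair q) by [].
rewrite -[RHS](inj_eq (@move_pair_inj _ (p w))); congr (_ == _).
by move: wq; rewrite /swap_pair /move_pair /= => -[-> ->].
Qed.

End Cocycle.

End VirtualBraid.

(** * Pure groups *)

Section PureFreePairs.
Variables (m : nat) (G : groupType) (s v : nat -> G) (p : {multiplicative G -> 'S_m.+2}).
Hypothesis Gvb : virtual_braid s v p.
Let lamp := lamp s v p.

Definition upper_pair := {q : 'I_m.+2 * 'I_m.+2 | (q.1 < q.2)%N}.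

Lemma upper_pair_neq (q : upper_pair) : (val q).1 != (val q).2.
Proof. by have := valP q; rewrite -val_eqE neq_ltn => ->. Qed.

Lemma swap_upper_pair_neq (q : upper_pair) : (swap_pair (val q)).1 != (swap_pair (val q)).2.
Proof. by rewrite eq_sym; apply: upper_pair_neq. Qed.

Lemma ker_lamp q : q.1 != q.2 -> ker_pred p (lamp q).
Proof. by move=> q12; apply/eqP; apply: p_lamp. Qed.

Definition pure_x (q : upper_pair) : kernel p := Kernel (ker_lamp (upper_pair_neq q)).
Definition pure_y (q : upper_pair) : kernel p := Kernel (ker_lamp (swap_upper_pair_neq q)).

Lemma kernel_valM (k k' : kernel p) : val (k * k') = val k * val k'.
Proof. by []. Qed.

Lemma kernel_valP (k : kernel p) : p (val k) = 1.
Proof. by apply/eqP; apply: valP k. Qed.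

Hypothesis lamp_comm : forall q r, q.1 != q.2 -> r.1 != r.2 -> r != q -> r != swap_pair q ->
  commute (lamp q) (lamp r).

(** On the kernel of [p] the cocycle at a fixed pair is a homomorphism. At [r] it takes the values
    [a] and [b] on the two generators of the factor [r] and 1 on all others, which is the universal
    property of that factor. *)
Lemma pure_free_pairs : product_of_free_pairs pure_x pure_y.
Proof.
split=> [A AG Ax Ay k|q r qr|H a b r].
- pose B g := forall k : kernel p, val k = g -> A k.
  suff [_ Bk] : p (val k) = 1 /\ B (val k) by apply: Bk.
  have [A1 AM AV] := AG.
  apply: (pure_ind Gvb (A := fun g => p g = 1 /\ B g)) (kernel_valP k).
  + split=> [|x y [px Bx] [py By]|x [px Bx]]; split.
    * exact: group_hom1.
    * by move=> k' E; have -> : k' = 1 by apply: val_inj.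
    * by rewrite gmulfM px py mulg1.
    * move=> k' E.
      have kx : ker_pred p x by apply/eqP.
      have ky : ker_pred p y by apply/eqP.
      have -> : k' = Kernel kx * Kernel ky by apply: val_inj.
      by apply: AM; [apply: Bx|apply: By].
    * by rewrite group_homV px invg1.
    * move=> k' E; have kx : ker_pred p x by apply/eqP.
      have -> : k' = (Kernel kx)^-1 by apply: val_inj.
      by apply: AV; apply: Bx.
  + move=> q q12; split; first exact: p_lamp.
    move=> k' E; move: (q12); rewrite neq_ltn => /orP [lt|lt].
      have -> : k' = pure_x (exist _ q lt) by apply: val_inj.
      exact: Ax.
    have -> : k' = pure_y (exist (fun q : 'I_m.+2 * 'I_m.+2 => (q.1 < q.2)%N) (swap_pair q) lt).
      by apply: val_inj; rewrite E /=; case: (q).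
    exact: Ay.
- have vqr : val q != val r by [].
  have sqr : val q != swap_pair (val r).
    apply/negP => /eqP E; have := valP q; have := valP r; rewrite /= E /=; lia.
  have com (k k' : kernel p) : commute (val k) (val k') -> commute k k'.
    by move=> c; apply: val_inj.
  have swapE (a b : 'I_m.+2 * 'I_m.+2) : (swap_pair a == swap_pair b) = (a == b).
    by apply/eqP/eqP => [|-> //]; case: a b => a1 a2 [b1 b2] [-> ->].
  have swapK (a : 'I_m.+2 * 'I_m.+2) : swap_pair (swap_pair a) = a by case: a.
  have := (upper_pair_neq q, upper_pair_neq r).
  have := (swap_upper_pair_neq q, swap_upper_pair_neq r) => -[sq sr] [uq ur].
  split; apply: com; apply: lamp_comm => //.
  + by rewrite eq_sym.
  + by rewrite -swapE swapK eq_sym.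
  + by rewrite eq_sym.
  + by rewrite swapE eq_sym.
  + by rewrite swapE eq_sym.
  + by rewrite swapK eq_sym.
- pose f (k : kernel p) : H := cocycle Gvb a b (val k) (val r).
  have fM : monoid.monoid_morphism f.
    split=> [|k k']; first exact: cocycle1.
    by rewrite /f kernel_valM cocycleM kernel_valP move_pair1.
  pose fm := isUMagmaMorphism.Build _ _ f fM.
  exists (HB.pack_for (UMagmaMorphism.type (kernel p) H) f fm); rewrite /= /f.
  have rs : (val r == swap_pair (val r)) = false.
    by apply/negP => /eqP /(congr1 fst) /= /eqP; rewrite (negPf (upper_pair_neq r)).
  split=> [||q qr].
  + by rewrite cocycle_lamp ?eqxx // upper_pair_neq.
  + rewrite cocycle_lamp ?rs //; last exact: swap_upper_pair_neq.
    by case: (val r) => r1 r2 /=; rewrite eqxx.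
  + have vrq : (val r == val q) = false by apply/negP => /eqP /val_inj E; rewrite E eqxx in qr.
    have srq : (val r == swap_pair (val q)) = false.
      by apply/negP => /eqP E; have := valP q; have := valP r; rewrite /= E /=; lia.
    have u := upper_pair_neq q; have u' := swap_upper_pair_neq q.
    split; rewrite cocycle_lamp // ?vrq ?srq //.
    by case: (val q) vrq => q1 q2 /= ->.
Qed.

Lemma pure_R_infinity : R_infinity (kernel p).
Proof.
have lt : (((inord 0, inord 1) : 'I_m.+2 * 'I_m.+2).1 < (inord 1 : 'I_m.+2))%N.
  by rewrite !inordK.
exact: (product_of_free_pairs_R_infinity (exist _ (inord 0, inord 1) lt) pure_free_pairs).
Qed.

End PureFreePairs.

Section UnrestrictedCommutation.
Variables (m : nat) (G : groupType) (s v : nat -> G) (p : {multiplicative G -> 'S_m.+2}).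
Hypothesis Gvb : virtual_braid s v p.
Hypothesis Gwb : (0 < m)%N -> v 0 * (s 1%N * s 0) = s 1%N * (s 0 * v 1%N).
Hypothesis Guvb : (0 < m)%N -> v 1%N * (s 0 * s 1%N) = s 0 * (s 1%N * v 0).
Let lamp := lamp s v p.

Lemma lamp_conj_commute w q r : q.1 != q.2 -> r.1 != r.2 -> vsub m v 0 w ->
  commute (lamp (move_pair (p w) q)) (lamp (move_pair (p w) r)) -> commute (lamp q) (lamp r).
Proof.
move=> q12 r12 Hw; have [_ _ VV] := vsub_subgroup m v 0.
have E t : t.1 != t.2 -> lamp (move_pair (p w) t) = w^-1 * lamp t * w.
  move=> t12; have := lampJ Gvb t12 (VV _ Hw).
  by rewrite invgK group_homV invgK => ->.
rewrite !E // /commute !mulgA !(mulgK w) => /(congr1 (fun x => w * x * w^-1)).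
by rewrite !mulgA !mulgK !mulgV !mul1g.
Qed.

Let i0 : 'I_m.+2 := inord 0.
Let i1 : 'I_m.+2 := inord 1.
Let i2 : 'I_m.+2 := inord 2.
Let i3 : 'I_m.+2 := inord 3.

(** The first commutation is [Guvb] and the second is [Gwb], rewritten. The braid relation becomes
    the Yang-Baxter equation [YB], from which the first two extract the third. *)
Lemma lamp_base_commute : (0 < m)%N ->
  [/\ commute (lamp (i0, i1)) (lamp (i0, i2)), commute (lamp (i0, i2)) (lamp (i1, i2))
    & commute (lamp (i0, i1)) (lamp (i1, i2))].
Proof.
move=> m0; pose a := s 0; pose b := s 1%N; pose x := v 0; pose y := v 1%N.
have xx : x * x = 1 by exact: (vb_v2 Gvb).
have yy : y * y = 1 by exact: (vb_v2 Gvb).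
have E01 : lamp (i0, i1) = a * x by rewrite (sv_lamp Gvb).
have E12 : lamp (i1, i2) = b * y by rewrite (sv_lamp Gvb).
have V1 : vsub m v 0 y by apply: vsub_v.
have V0 : vsub m v 0 x by apply: vsub_v.
have m2 : (2 <= m.+1)%N by lia.
have n01 : i0 != i1 by rewrite inord_eq.
have n02 : i0 != i2 by rewrite inord_eq.
have n12 : i1 != i2 by rewrite inord_eq.
have E02 : lamp (i0, i2) = y * (a * x) * y.
  have yV : y^-1 = y by apply: (v_inv Gvb).
  rewrite -E01 -[X in _ * X]yV lampJ //; congr lamp.
  rewrite (vb_pv Gvb) // tpermV /move_pair /= tpermL tpermD //; by rewrite eq_sym.
have E02' : lamp (i0, i2) = x * (b * y) * x.
  have xV : x^-1 = x by apply: (v_inv Gvb).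
  rewrite -E12 -[X in _ * X]xV lampJ //; congr lamp.
  by rewrite (vb_pv Gvb) // tpermV /move_pair /= tpermR tpermD.
have tail (u u' t : G) : u = u' -> u * t = u' * t by move->.
have xx' t : x * (x * t) = t by rewrite mulgA xx mul1g.
have yy' t : y * (y * t) = t by rewrite mulgA yy mul1g.
have braid t : x * (y * (x * t)) = y * (x * (y * t)).
  by have := tail _ _ t (vb_vvv Gvb m0); rewrite -!mulgA.
have mixed t : x * (y * (a * t)) = b * (x * (y * t)).
  by have := tail _ _ t (vb_vvs Gvb m0); rewrite -!mulgA.
have mixed' t : y * (x * (b * t)) = a * (y * (x * t)).
  by rewrite -[t in LHS]xx' -[x * t in LHS]yy' -mixed xx' yy'.
have aba t : a * (b * (a * t)) = b * (a * (b * t)).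
  by have := tail _ _ t (vb_sss Gvb m0); rewrite -!mulgA.
have wb t : x * (b * (a * t)) = b * (a * (y * t)).
  by have := tail _ _ t (Gwb m0); rewrite -!mulgA.
have uvb t : y * (a * (b * t)) = a * (b * (x * t)).
  by have := tail _ _ t (Guvb m0); rewrite -!mulgA.
have C1 : commute (lamp (i0, i1)) (lamp (i0, i2)).
  rewrite /commute E01 {1}E02' E02 -!mulgA xx' mixed uvb xx'.
  by rewrite -[y * x]mulg1 -!mulgA.
have C2 : commute (lamp (i0, i2)) (lamp (i1, i2)).
  by rewrite /commute E12 {1}E02' E02 -!mulgA yy' mixed' wb yy'.
split=> //.
have YB : lamp (i0, i1) * lamp (i0, i2) * lamp (i1, i2) =
    lamp (i1, i2) * lamp (i0, i2) * lamp (i0, i1).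
  rewrite E01 E12 {1}E02' E02 -!mulgA xx' yy' mixed mixed' aba.
  by rewrite [x * (y * x)](vb_vvv Gvb m0).
have : lamp (i0, i1) * lamp (i1, i2) * lamp (i0, i2) =
    lamp (i1, i2) * lamp (i0, i1) * lamp (i0, i2).
  by rewrite -!mulgA -C2 C1 !mulgA YB.
exact: mulIg.
Qed.

(** Conjugation by [vsub 0] moves the pairs to the first points: three points if the pairs share
    one, four if they are disjoint, where distant generators commute. *)
Lemma lamp_commute q r : q.1 != q.2 -> r.1 != r.2 -> r != q -> r != swap_pair q ->
  commute (lamp q) (lamp r).
Proof.
case: q r => [i j] [k l] /= ij kl rq rs.
have use (w : seq 'I_m.+2) : uniq w -> exists2 g, vsub m v 0 g &
    forall i, (i < size w)%N -> p g (nth ord0 w i) = inord i.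
  move=> /perm_to_first [t tP]; have [g Hg pg] := vsub_lift Gvb t.
  by exists g; rewrite ?pg.
have m_pos (a b c : 'I_m.+2) : uniq [:: a; b; c] -> (0 < m)%N.
  move=> /card_uniqP E; have := max_card (mem [:: a; b; c]).
  by rewrite E /= card_ord ltnS.
have tri (a b c : 'I_m.+2) : a != b -> b != c -> a != c ->
    [/\ commute (lamp (a, b)) (lamp (a, c)), commute (lamp (a, c)) (lamp (b, c))
     & commute (lamp (a, b)) (lamp (b, c))].
  move=> ab bc ac; have u : uniq [:: a; b; c] by rewrite /= !inE negb_or ab ac bc.
  have [C1 C2 C3] := lamp_base_commute (m_pos _ _ _ u).
  have [g Hg pg] := use _ u.
  have := (pg 0%N isT, pg 1%N isT, pg 2 isT) => /= -[[p0 p1] p2].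
  by split; apply: (lamp_conj_commute (w := g)) => //; rewrite /move_pair /= ?p0 ?p1 ?p2.
have [ki|ki] := eqVneq k i.
  rewrite ki in kl rq *; have jl : j != l by apply: contra rq => /eqP ->.
  by have [] := tri i j l ij jl kl.
have [lj|lj] := eqVneq l j.
  rewrite lj in kl *.
  by have [] := tri i k j; rewrite // eq_sym.
have [kj|kj] := eqVneq k j.
  rewrite kj in rs kl *; have li : i != l by apply: contra rs => /eqP ->; rewrite /swap_pair.
  by have [] := tri i j l.
have [li|li] := eqVneq l i.
  rewrite li; apply: commute_sym.
  by have [] := tri k i j.
have u : uniq [:: i; j; k; l].
  by rewrite /= !inE !negb_or ij kl -!(eq_sym k) -!(eq_sym l) ki li kj lj.
have m1 : (1 < m)%N.
  by have := max_card (mem [:: i; j; k; l]); rewrite (card_uniqP u) /= card_ord !ltnS.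
have [g Hg pg] := use _ u.
have := (pg 0%N isT, pg 1%N isT, pg 2 isT, pg 3 isT) => /= -[[[p0 p1] p2] p3].
apply: (lamp_conj_commute (w := g)) => //; rewrite /move_pair /= p0 p1 p2 p3.
have -> : lamp (inord 0, inord 1) = s 0 * v 0 by rewrite (sv_lamp Gvb).
have -> : lamp (inord 2, inord 3) = s 2 * v 2 by rewrite (sv_lamp Gvb).
have ss : commute (s 0) (s 2) by apply: (vb_ss Gvb).
have sv : commute (s 0) (v 2) by apply: (vb_sv Gvb).
have vs : commute (v 0) (s 2) by apply: (vb_vs Gvb).
have vv : commute (v 0) (v 2) by apply: (vb_vv Gvb).
by apply: commuteM; apply/commute_sym; apply: commuteM; apply/commute_sym.
Qed.

End UnrestrictedCommutation.

(** * Crossing functionals; two and three strands *)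

Lemma val_tperm_inord (m i : nat) (a : 'I_m.+2) : (i <= m)%N ->
  tperm (inord i) (inord i.+1) a = (if a == i :> nat then i.+1 else if a == i.+1 :> nat then i
    else a) :> nat.
Proof.
move=> im; case: tpermP => [->|->|/eqP a1 /eqP a2].
- by rewrite !inordK ?eqxx //; lia.
- rewrite !inordK ?eqxx; try lia.
  by case: eqP => //; lia.
- by move: a1 a2; rewrite -!val_eqE /= !inordK; try lia; move=> /negPf -> /negPf ->.
Qed.

Section Functionals.
Variables (m : nat) (G : groupType) (s v : nat -> G) (p : {multiplicative G -> 'S_m.+2}).
Hypothesis Gvb : virtual_braid s v p.
Notation pair := ('I_m.+2 * 'I_m.+2)%type.
Let lamp := lamp s v p.
Let vsub := vsub m v.

(** The first lattice coordinate of [area_group] serves as the infinite cyclic target; with [b = 1],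
    [lamp q] counts at [q] and not at the swapped pair. *)
Definition cnt (g : G) (q : pair) : int :=
  (cocycle Gvb (((1, 0), fun=> 0) : area_group)%R (1 : area_group) g q).1.1.

Lemma cntM g h q : cnt (g * h) q = (cnt g q + cnt h (move_pair (p g) q))%R.
Proof. by rewrite /cnt cocycleM. Qed.

Lemma cnt_vsub w q : vsub 0 w -> cnt w q = 0%R.
Proof. by move=> Hw; rewrite /cnt cocycle_vsub. Qed.

Lemma cnt_lamp q r : q.1 != q.2 -> cnt (lamp q) r = ((r == q)%:R)%R.
Proof. by move=> q12; rewrite /cnt cocycle_lamp //; case: (r == q) => //; case: (r == _). Qed.

Lemma cnt_J g y q : p y = 1 -> cnt (g * y * g^-1) q = cnt y (move_pair (p g) q).
Proof.
move=> py; have := cntM (g * y * g^-1) g q.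
rewrite mulgKV !cntM !gmulfM py mulg1 group_homV mulgV move_pair1; lia.
Qed.

Definition ell (k : pair -> int) (g : G) : int := (\sum_q k q * cnt g q)%R.

Lemma ellM k g h : ell k (g * h) = (ell k g + ell (k \o move_pair (p g)^-1) h)%R.
Proof.
rewrite /ell; under eq_bigr => q _ do rewrite cntM mulrDr.
rewrite big_split; congr (_ + _)%R.
rewrite (reindex_inj (@move_pair_inj _ (p g)^-1)); apply: eq_bigr => q _ /=.
by rewrite -move_pairM mulVg move_pair1.
Qed.

Lemma ell_vsub k w : vsub 0 w -> ell k w = 0%R.
Proof. by move=> Hw; rewrite /ell big1 // => q _; rewrite cnt_vsub ?mulr0. Qed.

Lemma ell_lamp k q : q.1 != q.2 -> ell k (lamp q) = k q.
Proof.
move=> q12; rewrite /ell (bigD1 q) //= cnt_lamp // eqxx mulr1 big1 ?addr0 // => r rq.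
by rewrite cnt_lamp // (negPf rq) mulr0.
Qed.

Lemma ell_vJ k w g : vsub 0 w -> ell k (w * g * w^-1) = ell (k \o move_pair (p w)^-1) g.
Proof.
move=> Hw; have [_ _ VV] := vsub_subgroup m v 0.
rewrite ellM (ell_vsub _ (VV _ Hw)) addr0 ellM ell_vsub // add0r; congr ell.
Qed.

(* Invariant, up to the sign character, under the permutations of the first three points. *)
Definition kap (q : pair) : int :=
  match nat_of_ord q.1, nat_of_ord q.2 with
  | 0%N, 1%N | 1%N, 2%N | 2%N, 0%N => 1%R
  | 1%N, 0%N | 2%N, 1%N | 0%N, 2%N => (-1)%R
  | _, _ => 0%R
  end.

Lemma kap_v0 q : kap (move_pair (p (v 0)) q) = (- kap q)%R.
Proof.
case: q => a b; rewrite /kap /move_pair /= (vb_pv Gvb) // !val_tperm_inord //.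
by move: (a : nat) (b : nat) => [|[|[|a']]] [|[|[|b']]].
Qed.

Lemma kap_v1 q : (0 < m)%N -> kap (move_pair (p (v 1%N)) q) = (- kap q)%R.
Proof.
move=> m0; case: q => a b; rewrite /kap /move_pair /= (vb_pv Gvb) // !val_tperm_inord //.
by move: (a : nat) (b : nat) => [|[|[|a']]] [|[|[|b']]].
Qed.

Lemma p_v2 i : (i <= m)%N -> (p (v i))^-1 = p (v i).
Proof. by move=> im; rewrite -group_homV (v_inv Gvb). Qed.

Lemma kap_base : kap (inord 0, inord 1) = 1%R.
Proof. by rewrite /kap /= !inordK. Qed.

Lemma ell_lam k : ell k (lam s v) = k (inord 0, inord 1).
Proof. by rewrite /lam (sv_lamp Gvb) // ell_lamp ?base_neq. Qed.

End Functionals.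

(** Serves to show that [N] has index at most two by locating only the generators of the group in
    [N] or [N t]. *)
Lemma two_cosets (G : groupType) (N : G -> Prop) (t : G) : subgroup_pred N ->
  (forall x, N x -> N (t * x * t^-1)) -> (forall x, N x -> N (t^-1 * x * t)) -> N (t * t) ->
  subgroup_pred (fun g => N g \/ N (g * t^-1)).
Proof.
move=> [N1 NM NV] Nt Nt' Ntt; split=> [|g h Hg Hh|g Hg]; first by left.
- have Hh' : N h -> N (t * h * t^-1) by exact: Nt.
  case: Hg Hh => Hg [] Hh.
  + by left; apply: NM.
  + by right; rewrite -mulgA; apply: NM.
  + by right; have := NM _ _ Hg (Nt _ Hh); rewrite !mulgA mulgKV.
  + left; have := NM _ _ (NM _ _ Hg (Nt _ Hh)) Ntt.
    by rewrite !mulgA !mulgKV.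
- case: Hg => Hg; first by left; apply: NV.
  right; have := NM _ _ (Nt' _ (NV _ Hg)) (NV _ Ntt).
  by rewrite !invMg invgK !mulgA mulVg mul1g mulgK.
Qed.

(** * Two and three strands *)

Section FewStrands.
Variables (m : nat) (G : groupType) (s v : nat -> G) (p : {multiplicative G -> 'S_m.+2}).
Hypothesis Gvb : virtual_braid s v p.
Hypothesis m1 : (m <= 1)%N.
Let l0 := ell Gvb (@kap m).
Let sgn (g : G) : bool := odd_perm (p g).
Let even (g : G) : Prop := sgn g = false.

Lemma sgnM g h : sgn (g * h) = sgn g (+) sgn h.
Proof. by rewrite /sgn gmulfM odd_permM. Qed.

Lemma sgnV g : sgn g^-1 = sgn g.
Proof. by rewrite /sgn group_homV odd_permV. Qed.

Lemma sgn_v i : (i <= m)%N -> sgn (v i).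
Proof. by move=> im; rewrite /sgn (vb_pv Gvb) // odd_tperm inord_eq; lia. Qed.

Lemma sgn_s i : (i <= m)%N -> sgn (s i).
Proof. by move=> im; rewrite /sgn (vb_ps Gvb) // odd_tperm inord_eq; lia. Qed.

Lemma even_subgroup : subgroup_pred even.
Proof.
split=> [|x y|x]; rewrite /even ?sgnM ?sgnV.
- by rewrite /sgn group_hom1 odd_perm1.
- by move=> -> ->.
- by [].
Qed.

Lemma kap_sgn g q : kap (move_pair (p g) q) = ((-1) ^+ sgn g * kap q)%R.
Proof.
move: q; apply: (vb_gen Gvb (A := fun g => forall q,
  kap (move_pair (p g) q) = ((-1) ^+ sgn g * kap q)%R)) => [|i im q|i im q].
- split=> [q|g' h Hg Hh q|g' Hg q].
  + by rewrite /sgn group_hom1 odd_perm1 move_pair1 mul1r.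
  + by rewrite gmulfM move_pairM Hh Hg sgnM mulrA -signr_addb addbC.
  + have := Hg (move_pair (p g'^-1) q).
    rewrite -move_pairM group_homV mulVg move_pair1 sgnV => ->.
    by rewrite mulrA -signr_addb addbb mul1r.
- rewrite (vb_ps Gvb) // -(vb_pv Gvb) // sgn_s // expr1 mulN1r.
  by case: i im => [|[|i]] im; [exact: (kap_v0 Gvb)|exact: (kap_v1 Gvb)|lia].
- rewrite sgn_v // expr1 mulN1r.
  by case: i im => [|[|i]] im; [exact: (kap_v0 Gvb)|exact: (kap_v1 Gvb)|lia].
Qed.

Lemma l0_M g h : l0 (g * h) = (l0 g + (-1) ^+ sgn g * l0 h)%R.
Proof.
rewrite /l0 ellM; congr (_ + _)%R; rewrite /ell big_distrr; apply: eq_bigr => q _ /=.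
by rewrite -group_homV kap_sgn sgnV mulrA.
Qed.

Lemma l0_additive : additive_on even l0.
Proof. by move=> x y; rewrite /even l0_M => -> _; rewrite mul1r. Qed.

Lemma l0_J g x : even x -> l0 (g * x * g^-1) = ((-1) ^+ sgn g * l0 x)%R.
Proof.
rewrite /even => ex; have := l0_M (g * x * g^-1) g.
rewrite mulgKV l0_M !sgnM ex addbF sgnV addbb mul1r; lia.
Qed.

Lemma even_lam : even (lam s v).
Proof. by rewrite /even sgnM sgn_s ?sgn_v. Qed.

Lemma l0_lam : l0 (lam s v) = 1%R.
Proof. by rewrite /l0 ell_lam kap_base. Qed.

(** The difference [d] of the two sides is again negated by [v 0], and it vanishes on [lam], on its
    conjugate [s 1 * v 1] and on [v 1 * v 0], which has order three. So its kernel and the coset of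
    [v 0] contain all generators. *)
Lemma l0_unique (l : G -> int) : additive_on even l ->
  (forall x, even x -> l (v 0 * x * (v 0)^-1) = (- l x)%R) ->
  forall x, even x -> l x = (l (lam s v) * l0 x)%R.
Proof.
move=> la lv; pose d x : int := (l x - l (lam s v) * l0 x)%R.
have [E1 EM EV] := even_subgroup.
have da : additive_on even d.
  by move=> x y ex ey; rewrite /d la // l0_additive //; lia.
have dv x : even x -> d (v 0 * x * (v 0)^-1) = (- d x)%R.
  by move=> ex; rewrite /d lv // l0_J // sgn_v // expr1; lia.
have eJ g x : even x -> even (g * x * g^-1).
  by rewrite /even !sgnM sgnV => ->; rewrite addbF addbb.
pose N x := even x /\ d x = 0%R.
have NG : subgroup_pred N.
  split=> [|x y [ex dx] [ey dy]|x [ex dx]]; split=> //.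
  - exact: (additive_on1 even_subgroup da).
  - exact: EM.
  - by rewrite da // dx dy.
  - exact: EV.
  - by rewrite (additive_onV even_subgroup da) // dx.
have Nv x : N x -> N (v 0 * x * (v 0)^-1).
  by case=> ex dx; split; [exact: eJ | rewrite dv // dx].
have [N1 NM NV] := NG.
have vV : (v 0)^-1 = v 0 by apply: (v_inv Gvb).
have Nlam : N (lam s v) by split; [exact: even_lam | rewrite /d l0_lam mulr1 subrr].
have Nvv : (0 < m)%N -> N (v 1%N * v 0).
  move=> m0; have e : even (v 1%N * v 0) by rewrite /even sgnM !sgn_v.
  split=> //; apply: (additive_on_torsion (m := 2) even_subgroup da e).
  have vK i t : (i <= m)%N -> v i * (v i * t) = t.
    by move=> im; rewrite mulgA (vb_v2 Gvb) // mul1g.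
  by rewrite !expgS expg0 mulg1 -!mulgA (vb_vvv Gvb m0) !vK // (vb_v2 Gvb).
have Nsv : (0 < m)%N -> N (s 1%N * v 1%N).
  move=> m0; set w := v 0 * v 1%N.
  have -> : s 1%N * v 1%N = w * lam s v * w^-1.
    have mixed t : v 0 * (v 1%N * (s 0 * t)) = s 1%N * (v 0 * (v 1%N * t)).
      by have := congr1 (fun x => x * t) (vb_vvs Gvb m0); rewrite -!mulgA.
    by apply: (mulIg w); rewrite mulgKV /w /lam -!mulgA -(vb_vvv Gvb m0) mixed.
  have ew : even w by rewrite /even sgnM !sgn_v.
  split; first exact: eJ even_lam.
  by rewrite (additive_onJ even_subgroup da) //; [case: Nlam | exact: even_lam].
have all g : N g \/ N (g * (v 0)^-1).
  apply: (vb_gen Gvb (A := fun g => N g \/ N (g * (v 0)^-1))) => [|i im|i im].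
  - apply: two_cosets => //; first by move=> x /Nv; rewrite vV.
    by rewrite (vb_v2 Gvb).
  - right; rewrite vV; case: i im => [//|[|i]] im; last lia.
    have -> : s 1%N * v 0 = s 1%N * v 1%N * (v 1%N * v 0).
      by rewrite -mulgA [v 1%N * (v 1%N * _)]mulgA (vb_v2 Gvb) // mul1g.
    by apply: NM; [exact: Nsv | exact: Nvv].
  - by right; rewrite vV; case: i im => [|[|i]] im; [rewrite (vb_v2 Gvb)|exact: Nvv|lia].
move=> x ex; have [[_ dx]|[ex' _]] := all x; first by move: dx; rewrite /d; lia.
by move: ex'; rewrite /even sgnM sgnV ex sgn_v.
Qed.

Lemma l0_scalar (alpha beta : {multiplicative G -> G}) :
  cancel alpha beta -> cancel beta alpha -> (forall g, sgn (alpha g) = sgn g) ->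
  exists c : int, (c = 1 \/ c = -1)%R /\ forall x, even x -> l0 (alpha x) = (c * l0 x)%R.
Proof.
move=> aK bK sa; have sb g : sgn (beta g) = sgn g by rewrite -sa bK.
have scal (f : {multiplicative G -> G}) : (forall g, sgn (f g) = sgn g) ->
    forall x, even x -> l0 (f x) = (l0 (f (lam s v)) * l0 x)%R.
  move=> sf; apply: (l0_unique (l := fun x => l0 (f x))) => [x y ex ey|x ex].
    by rewrite gmulfM l0_additive // /even sf.
  by rewrite !gmulfM group_homV l0_J /even ?sf ?sgn_v // expr1 mulN1r.
exists (l0 (alpha (lam s v))); split; last exact: scal.
have ebl : even (beta (lam s v)) by rewrite /even sb even_lam.
have := scal alpha sa _ ebl; rewrite bK l0_lam => /esym /(congr1 absz).
rewrite abszM => /eqP; rewrite muln_eq1 => /andP [/eqP H _].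
by move: H; move: (l0 _) => d; lia.
Qed.

Definition character2 (f : G -> bool) : Prop := forall g h, f (g * h) = f g (+) f h.

Lemma character2_v1 f : character2 f -> (0 < m)%N -> f (v 1%N) = f (v 0).
Proof.
move=> fM m0; have := congr1 f (vb_vvv Gvb m0).
by rewrite !fM; do 2 case: (f _).
Qed.

Lemma character2_s1 f : character2 f -> (0 < m)%N -> f (s 1%N) = f (s 0).
Proof.
move=> fM m0; have := congr1 f (vb_sss Gvb m0).
by rewrite !fM; do 2 case: (f _).
Qed.

Lemma character2_1 f : character2 f -> f 1 = false.
Proof. by move=> fM; have := fM 1 1; rewrite mulg1; case: (f 1). Qed.

Lemma character2_V f g : character2 f -> f g^-1 = f g.
Proof.
move=> fM; have := fM g g^-1; rewrite mulgV character2_1 //.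
by case: (f g); case: (f _).
Qed.

Lemma character2_ext f f' : character2 f -> character2 f' ->
  f (s 0) = f' (s 0) -> f (v 0) = f' (v 0) -> forall g, f g = f' g.
Proof.
move=> fM fM' fs fv; apply: (vb_gen Gvb (A := fun g => f g = f' g)) => [|i im|i im].
- split=> [|x y ex ey|x ex]; first by rewrite !character2_1.
    by rewrite fM fM' ex ey.
  by rewrite !character2_V.
- by case: i im => [//|[|i]] im; [rewrite !character2_s1|lia].
- by case: i im => [//|[|i]] im; [rewrite !character2_v1|lia].
Qed.

Lemma character2_sgn_hom (f : {multiplicative G -> G}) : character2 (fun g => sgn (f g)).
Proof. by move=> g h; rewrite gmulfM sgnM. Qed.

(* Such a character carries no equivariant functional on its kernel. *)
Lemma sgn_hom_not_s_only (alpha beta : {multiplicative G -> G}) :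
  cancel alpha beta -> cancel beta alpha ->
  sgn (alpha (s 0)) -> sgn (alpha (v 0)) = false -> False.
Proof.
move=> aK bK as0 av0; pose f g := sgn (alpha g); pose l g := l0 (alpha g).
have fM : character2 f by exact: character2_sgn_hom.
pose K g := f g = false.
have KG : subgroup_pred K.
  split=> [|x y|x]; rewrite /K ?fM ?character2_1 ?character2_V //.
  by move=> -> ->.
have [K1 KM KV] := KG.
have la : additive_on K l by move=> x y ex ey; rewrite /l gmulfM l0_additive.
have lJ g x : K x -> l (g * x * g^-1) = ((-1) ^+ f g * l x)%R.
  by move=> kx; rewrite /l !gmulfM group_homV l0_J.
have KJ g x : K x -> K (g * x * g^-1).
  by rewrite /K !fM character2_V // => ->; rewrite addbF addbb.
pose N x := K x /\ l x = 0%R.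
have NG : subgroup_pred N.
  split=> [|x y [ex dx] [ey dy]|x [ex dx]]; split=> //.
  - exact: (additive_on1 KG la).
  - exact: KM.
  - by rewrite la // dx dy.
  - exact: KV.
  - by rewrite (additive_onV KG la) // dx.
have NJ g x : N x -> N (g * x * g^-1).
  by case=> kx lx; split; [exact: KJ | rewrite lJ // lx mulr0].
have [N1 NM NV] := NG.
have Nv i : (i <= m)%N -> N (v i).
  move=> im; have kv : K (v i).
    by case: i im => [//|[|i]] im; [rewrite /K character2_v1|lia].
  split=> //; apply: (additive_on_torsion (m := 1) KG la kv).
  by rewrite expgS expg1 (vb_v2 Gvb).
(* Conjugation by [s 0] fixes this square but negates [l]. *)
have Nss : N (s 0 * s 0).
  have kss : K (s 0 * s 0) by rewrite /K fM addbb.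
  split=> //; have := lJ (s 0) _ kss; rewrite /f as0 expr1 mulgA mulgK. by move: (l _) => d; lia.
have all g : N g \/ N (g * (s 0)^-1).
  apply: (vb_gen Gvb (A := fun g => N g \/ N (g * (s 0)^-1))) => [|i im|i im].
  - apply: two_cosets => // x Nx; first exact: NJ.
    by have := NJ (s 0)^-1 _ Nx; rewrite invgK.
  - right; case: i im => [|[|i]] im; [by rewrite mulgV| |lia].
    have Nw : N (v 0 * v 1%N) by apply: NM; apply: Nv.
    have E : s 1%N = v 0 * v 1%N * s 0 * (v 0 * v 1%N)^-1.
      by rewrite -[_ * _ * s 0]mulgA (vb_vvs Gvb im) mulgK.
    rewrite E -2!mulgA [s 0 * _]mulgA.
    by apply: NM => //; apply/NJ/NV.
  - by left; apply: Nv.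
have lz x : K x -> l x = 0%R.
  move=> kx; have [[_ lx] //|[kx' _]] := all x.
  by move: kx'; rewrite /K fM character2_V // kx /f as0.
have := lz (beta (lam s v)); rewrite /K /f /l bK l0_lam => H.
by have := H even_lam.
Qed.

Lemma sgn_hom_cases (alpha beta : {multiplicative G -> G}) :
  cancel alpha beta -> cancel beta alpha ->
  (forall g, sgn (alpha g) = sgn g) \/
  (sgn (alpha (s 0)) = false /\ sgn (alpha (v 0)) = true).
Proof.
move=> aK bK; pose f g := sgn (alpha g).
have fM : character2 f by exact: character2_sgn_hom.
have sM : character2 sgn by exact: sgnM.
have ss := sgn_s (leq0n m); have sv := sgn_v (leq0n m).
case fs : (sgn (alpha (s 0))); case fv : (sgn (alpha (v 0))).
- by left; apply: (character2_ext fM sM); rewrite /f ?fs ?fv.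
- by case: (sgn_hom_not_s_only aK bK fs fv).
- by right.
- have f0 g : f g = false by apply: (character2_ext fM (f' := fun _ => false)).
  by have := f0 (beta (v 0)); rewrite /f bK sv.
Qed.

Lemma reidemeister_few_strands (alpha : {multiplicative G -> G}) :
  bijective alpha -> reidemeister_number alpha = None.
Proof.
move=> /multiplicative_inverse [beta [aK bK]].
pose f g := sgn (alpha g).
have fM : character2 f by exact: character2_sgn_hom.
have EG := even_subgroup.
have fin : finite_index even.
  exists bool, sgn => x y E; by rewrite /even sgnM sgnV E addbb.
have [sa|sa] := pselect (forall g, f g = sgn g).
  have [c [c1 cE]] := l0_scalar aK bK sa.
  have ea g x : even x -> even (g * alpha x * g^-1).
    by rewrite /even !sgnM sgnV -/(f x) sa => ->; rewrite addbF addbb.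
  case: c1 => c1.
  - apply: (reidemeister_functional (g := 1) (u := lam s v) EG fin l0_additive) => //.
    + exact: ea.
    + by move=> x ex; rewrite mul1g invg1 mulg1 cE // c1 mul1r.
    + exact: even_lam.
    + by rewrite l0_lam.
  - apply: (reidemeister_functional (g := v 0) (u := lam s v) EG fin l0_additive) => //.
    + exact: ea.
    + move=> x ex; rewrite l0_J ?sgn_v // ?cE // ?c1 ?expr1; first lia.
      by rewrite /even -/(f x) sa.
    + exact: even_lam.
    + by rewrite l0_lam.
have [//|[fs fv]] := sgn_hom_cases aK bK.
pose alpha2 : {multiplicative G -> G} := alpha \o alpha.
pose beta2 : {multiplicative G -> G} := beta \o beta.
have aK2 : cancel alpha2 beta2 by move=> x; rewrite /= aK aK.
have bK2 : cancel beta2 alpha2 by move=> x; rewrite /= bK bK.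
(* If [alpha2] were in the exceptional case too, [f \o alpha] and [f] would agree on [s 0] and
   [v 0], hence everywhere; as [alpha] is surjective, [f] would be [sgn]. *)
have faa g : sgn (alpha (alpha g)) = sgn g.
  have [/(_ g) //|[f2s f2v]] := sgn_hom_cases aK2 bK2; case: sa => h.
  have f2M : character2 (fun g => f (alpha g)) by move=> x y; rewrite gmulfM fM.
  rewrite -[h in RHS]bK -/(f (beta h)) -[h in LHS]bK.
  by apply: (character2_ext f2M fM); rewrite /f ?f2s ?f2v ?fs ?fv.
have [c [c1 cE]] := l0_scalar aK2 bK2 faa.
pose K g := even g /\ f g = false.
have [E1 EM EV] := EG.
have KG : subgroup_pred K.
  split=> [|x y [ex fx] [ey fy]|x [ex fx]]; split; do ?[exact: EM | exact: EV | exact: E1].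
  - exact: character2_1.
  - by rewrite fM fx fy.
  - by rewrite character2_V.
have Kfin : finite_index K.
  exists (bool * bool)%type, (fun g => (sgn g, f g)) => x y [e1 e2].
  by split; rewrite /even ?sgnM ?sgnV ?e1 ?addbb // fM character2_V // e2 addbb.
have lfM g x : even (alpha x) -> l0 (alpha (g * x * g^-1)) = ((-1) ^+ f g * l0 (alpha x))%R.
  by move=> ex; rewrite !gmulfM group_homV l0_J.
have Ka g x : K x -> K (g * alpha x * g^-1).
  move=> [ex fx]; split; first by rewrite /even !sgnM sgnV -/(f x) fx addbF addbb.
  by rewrite !fM character2_V // /f faa ex addbF addbb.
(* The element [s 0] is odd for [sgn] and even for [f]: conjugation by it negates [l0] and preserves
   [l0 \o alpha], which matches the sign [c] of [alpha2]. *)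
pose g : G := if c == 1%R then 1 else s 0.
pose l x : int := (l0 x + c * l0 (alpha x))%R.
have la : additive_on K l.
  move=> x y [ex fx] [ey fy]; rewrite /l gmulfM !l0_additive //; lia.
have sgs : sgn (s 0) = true by apply: sgn_s.
have lE x : K x -> l (g * alpha x * g^-1) = l x.
  move=> [ex fx]; rewrite /l lfM ?l0_J //; last by rewrite /even faa.
  have := cE x ex; rewrite /= => ->; rewrite /g.
  have -> : sgn g = (c != 1%R).
    by rewrite /g; case: eqP => _; rewrite ?sgs // /sgn group_hom1 odd_perm1.
  have -> : f g = false by rewrite /g; case: eqP => _; rewrite ?character2_1 // /f fs.
  move: (l0 x) (l0 (alpha x)) => a b.
  by case: c1 => ->; rewrite ?eqxx /= ?expr0 ?expr1; lia.
(* Squaring puts [lam] into the kernel of [f]. The values of [l] at [lam2] and at its conjugate by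
   [s 0] differ by 4, so one of them is nonzero. *)
pose lam2 := lam s v * lam s v.
have K2 : K lam2.
  by split; [apply: EM; exact: even_lam | rewrite fM addbb].
have l2 : l0 lam2 = 2%R by rewrite l0_additive ?l0_lam //; exact: even_lam.
have K2' : K (s 0 * lam2 * (s 0)^-1).
  clearbody lam2; case: K2 => ex fx; split; first by rewrite /even !sgnM sgnV ex addbF addbb.
  by rewrite !fM character2_V // fx addbF addbb.
have V1 : l lam2 = (2 + c * l0 (alpha lam2))%R by rewrite /l l2.
have V2 : l (s 0 * lam2 * (s 0)^-1) = (- 2 + c * l0 (alpha lam2))%R.
  by case: K2 => ex fx; rewrite /l lfM // l0_J // sgs /f fs expr0 expr1 l2; lia.
have [V0|V0] := eqVneq (l lam2) 0%R; last first.
  exact: (reidemeister_functional (g := g) (u := lam2) KG Kfin la (Ka g) lE).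
apply: (reidemeister_functional (g := g) (u := s 0 * lam2 * (s 0)^-1) KG Kfin la (Ka g) lE) => //.
by rewrite V2; apply/eqP; move: V0; rewrite V1; lia.
Qed.

End FewStrands.

(** * Homomorphisms from groups on at least four strands *)

Lemma commute_braid (Q : groupType) (a b : Q) :
  commute a b -> a * (b * a) = b * (a * b) -> a = b.
Proof. by move=> ab; rewrite -ab => /mulIg. Qed.

Lemma commute_tperm (T : finType) (t : {perm T}) (a b : T) : a != b ->
  commute t (tperm a b) -> t a = a \/ t a = b.
Proof.
move=> ab c; have := congr1 (fun u : {perm T} => u a) c.
rewrite !permM tpermL; case: tpermP => [->|->|_ _ /perm_inj E]; [by left|by right|].
by rewrite E eqxx in ab.
Qed.

(** Disjoint transpositions commute, and commuting elements related by the braid relation are equal;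
    so the two transpositions share exactly one point. *)
Lemma transposition_pair (n : nat) (t1 t2 : 'S_n.+2) (a b c d : 'I_n.+2) :
  t1 = tperm a b -> t2 = tperm c d -> t1 != t2 -> a != b -> c != d ->
  t1 * (t2 * t1) = t2 * (t1 * t2) ->
  exists x, t1 ^ x = tperm (inord 0) (inord 1) /\ t2 ^ x = tperm (inord 1) (inord 2).
Proof.
move=> E1 E2 t12 ab cd braid.
have [i [j [k [T1 T2 ij [jk ik]]]]] : exists i j k : 'I_n.+2,
    [/\ t1 = tperm i j, t2 = tperm j k, i != j & j != k /\ i != k].
  have aux (x y z : 'I_n.+2) : tperm x y = t1 -> tperm y z = t2 -> x != y -> y != z ->
      exists i j k : 'I_n.+2, [/\ t1 = tperm i j, t2 = tperm j k, i != j & j != k /\ i != k].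
    move=> X Y xy yz; exists x, y, z; split=> //; split=> //.
    by apply: contra t12 => /eqP xz; rewrite -X -Y xz tpermC.
  have [ca|ca] := eqVneq c a.
    by rewrite ca in E2 cd; apply: (aux b a d); rewrite // 1?tpermC // eq_sym.
  have [cb|cb] := eqVneq c b; first by rewrite cb in E2 cd; apply: (aux a b d).
  have [da|da] := eqVneq d a.
    by rewrite da in E2 cd; apply: (aux b a c); rewrite // 1?tpermC // eq_sym.
  have [db|db] := eqVneq d b.
    by rewrite db in E2 cd; apply: (aux a b c); rewrite // 1?tpermC // eq_sym.
  case/negP: t12; apply/eqP; apply: commute_braid braid.
  by rewrite E1 E2; apply/commgP/conjg_fixP; rewrite tpermJ !tpermD // eq_sym.
have [|x xP] := @perm_to_first n.+1 [:: i; j; k].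
  by rewrite /= !inE negb_or ij ik jk.
exists x; rewrite T1 T2 !tpermJ.
by have /= -> := xP 0%N isT; have /= -> := xP 1%N isT; have /= -> := xP 2 isT.
Qed.

Section ManyStrands.
Variables (m : nat) (G : groupType) (s v : nat -> G) (p : {multiplicative G -> 'S_m.+2}).
Hypothesis Gvb : virtual_braid s v p.
Hypothesis m2 : (2 <= m)%N.

Lemma v_decomposition (N : G -> Prop) : normal_pred N ->
  (forall i, (i <= m)%N -> exists2 w, vsub m v 0 w & N (s i * w)) ->
  forall g, exists2 w, vsub m v 0 w & N (g * w).
Proof.
move=> [[N1 NM NV] NJ] Ns; have [V1 VM VV] := vsub_subgroup m v 0.
apply: (vb_gen Gvb (A := fun g => exists2 w, vsub m v 0 w & N (g * w))) => [|//|i im].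
- split=> [|g h [w Hw Ng] [w' Hw' Nh]|g [w Hw Ng]].
  + by exists 1; rewrite ?mulg1.
  + exists (w' * w); first exact: VM.
    by have := NM _ _ Ng (NJ w^-1 _ Nh); rewrite invgK !mulgA mulgK.
  + exists w^-1; first exact: VV.
    by have := NJ w _ (NV _ Ng); rewrite invMg !mulgA mulgV mul1g.
- by exists (v i); [apply: vsub_v | rewrite (vb_v2 Gvb)].
Qed.

Section HomToGroup.
Variables (Q : groupType) (f : {multiplicative G -> Q}).

Lemma hom_kill_s : f (s 0) = 1 -> forall i, (i <= m)%N -> f (s i) = 1.
Proof.
move=> f0; elim=> // i IHi im; have := congr1 f (vb_vvs Gvb im).
rewrite !gmulfM IHi ?mulg1; last lia.
by move=> E; apply: (mulIg (f (v i) * f (v i.+1))); rewrite -E mul1g.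
Qed.

Lemma hom_kill_lam : f (lam s v) = 1 -> forall g, p g = 1 -> f g = 1.
Proof.
move=> fl; apply: (pure_ind Gvb (A := fun g => f g = 1)) => [|q /(lamp_witness Gvb) [w Hw wq]].
- split=> [|x y fx fy|x fx]; first exact: group_hom1.
    by rewrite gmulfM fx fy mulg1.
  by rewrite group_homV fx invg1.
- by rewrite -(lampE Gvb Hw wq) 2!gmulfM fl mulg1 group_homV mulgV.
Qed.

(** The equality spreads: [f (v i.+2)] commutes with [f (v i) = f (v i.+1)], and commuting braided
    elements coincide. The mixed relation then identifies all [f (s i)], and [s 0] commutes with
    [v 2]. *)
Lemma hom_abelian : f (v 0) = f (v 1%N) -> forall g h, commute (f g) (f h).
Proof.
move=> f01; set t := f (v 0) in f01; set b := f (s 0).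
have fv i : (i < m)%N -> f (v i) = t /\ f (v i.+1) = t.
  elim: i => [//|i IHi] im; have [fi fi1] := IHi ltac:(lia); split=> //.
  have c : commute (f (v i)) (f (v i.+2)).
    by rewrite /commute -!gmulfM (vb_vv Gvb) //; lia.
  have := congr1 f (vb_vvv Gvb im); rewrite !gmulfM fi1 => E.
  by apply/esym; apply: commute_braid E; rewrite -fi.
have {}fv i : (i <= m)%N -> f (v i) = t.
  by case: i => [//|i] im; case: (fv i im).
have tt : t * t = 1 by rewrite /t -gmulfM (vb_v2 Gvb) ?group_hom1.
have fs i : (i <= m)%N -> f (s i) = b.
  elim: i => [//|i IHi] im; have := congr1 f (vb_vvs Gvb im).
  by rewrite !gmulfM !fv ?IHi; try lia; rewrite mulgA tt mul1g mulg1.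
have tb : commute t b.
  have E : commute (s 0) (v 2) by apply: (vb_sv Gvb); lia.
  by rewrite -(fv 2 m2) /commute /b -!gmulfM E.
have com (x : Q) : commute t x -> commute b x -> forall g, commute (f g) x.
  move=> tx bx; apply: (vb_gen Gvb) => [|i im|i im]; rewrite ?fs ?fv //.
  split=> [|y z Hy Hz|y Hy]; rewrite ?group_hom1 ?gmulfM ?group_homV.
  - by rewrite /commute mul1g mulg1.
  - by apply/commute_sym/commuteM; apply/commute_sym.
  - by apply/commute_sym/commuteV/commute_sym.
move=> g h; apply: (com (f h)); apply/commute_sym; exact: (com _).
Qed.

Lemma hom_braid_v : f (v 0) * (f (v 1%N) * f (v 0)) = f (v 1%N) * (f (v 0) * f (v 1%N)).
Proof. by rewrite -!gmulfM (vb_vvv Gvb) //; lia. Qed.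

End HomToGroup.

Section AntiInvariant.
Variables (Q : groupType) (q : {multiplicative G -> Q}).
Let K (g : G) : Prop := q g = 1.

Lemma ker_subgroup : subgroup_pred K.
Proof.
split=> [|x y qx qy|x qx]; rewrite /K ?group_hom1 ?gmulfM ?group_homV ?qx ?qy ?mulg1 //.
exact: invg1.
Qed.

Lemma ker_conj_closed g x : K x -> K (g * x * g^-1).
Proof. by rewrite /K => qx; rewrite !gmulfM qx mulg1 group_homV mulgV. Qed.

Variable l : G -> int.
Hypothesis la : additive_on K l.
Variable u : G.
Hypotheses (Ku : K u) (lu : l u = 1%R).

(** The elements [y] and [t] differ by a member of [K], and conjugation by [K] does not change an
    additive functional. *)
Lemma anti_transfer t y : q y = q t -> (forall x, K x -> l (t * x * t^-1) = (- l x)%R) ->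
  forall x, K x -> l (y * x * y^-1) = (- l x)%R.
Proof.
move=> yt lt x Kx; pose k := y * t^-1.
have Kk : K k by rewrite /K /k gmulfM group_homV yt mulgV.
have -> : y * x * y^-1 = k * (t * x * t^-1) * k^-1.
  by rewrite /k invMg invgK !mulgA !mulgKV.
by rewrite (additive_onJ ker_subgroup la) ?lt //; exact: ker_conj_closed.
Qed.

Hypothesis lv : forall x, K x -> l (v 0 * x * (v 0)^-1) = (- l x)%R.

(* If [q \o alpha] kills every [s i], then [l \o alpha] takes one and the same value on
   all conjugates of all [s i], which anti-invariance forces to be zero. *)
Lemma s_not_killed (alpha beta : {multiplicative G -> G}) :
  cancel alpha beta -> cancel beta alpha -> q (alpha (s 0)) <> 1.
Proof.
move=> aK bK fs0; pose f : {multiplicative G -> Q} := q \o alpha.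
have fs i : (i <= m)%N -> f (s i) = 1 by move=> im; apply: (hom_kill_s (f := f) fs0).
pose F g := f g = 1; pose h g := l (alpha g).
have FG : subgroup_pred F by split=> [|x y fx fy|x fx];
  rewrite /F ?group_hom1 ?gmulfM ?group_homV ?fx ?fy ?mulg1 ?invg1.
have ha : additive_on F h by move=> x y fx fy; rewrite /h gmulfM la.
have FJ g x : F x -> F (g * x * g^-1).
  by rewrite /F => fx; rewrite !gmulfM fx mulg1 group_homV mulgV.
have [F1 FM FV] := FG.
pose L i w := h (w * s i * w^-1).
have Fs i w : (i <= m)%N -> F (w * s i * w^-1) by move=> im; apply/FJ/fs.
(* Under an additive functional the braid relation reads [2 L i + L i.+1 = L i + 2 L i.+1]. *)
have Lb i w : (i < m)%N -> L i.+1 w = L i w.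
  move=> im; have := congr1 (fun x => h (w * x * w^-1)) (vb_sss Gvb im).
  have split3 x y z : F x -> F y -> F z -> h (w * (x * (y * z)) * w^-1) =
      (h (w * x * w^-1)%g + (h (w * y * w^-1)%g + h (w * z * w^-1)%g))%R.
    move=> /(FJ w) Fx /(FJ w) Fy /(FJ w) Fz.
    have -> : w * (x * (y * z)) * w^-1 = w * x * w^-1 * (w * y * w^-1 * (w * z * w^-1)).
      by rewrite !mulgA !mulgKV.
    by rewrite (ha _ _ Fx (FM _ _ Fy Fz)) (ha _ _ Fy Fz).
  rewrite !split3; do ?[apply: fs; lia].
  by rewrite /L; move: (h _) (h _) => a b; lia.
have L1 w : L 1%N w = L 0 w by apply: Lb; lia.
have L2 w : L 2 w = L 0 w by rewrite Lb ?L1; lia.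
have Lcom i w x : commute x (s i) -> L i (w * x) = L i w.
  by move=> c; rewrite /L invMg !mulgA -(mulgA w x) c !mulgA mulgK.
pose A x := forall w, L 0 (w * x) = L 0 w.
have AG : subgroup_pred A.
  split=> [w|x y Ax Ay w|x Ax w]; first by rewrite mulg1.
    by rewrite mulgA Ay Ax.
  by have := Ax (w * x^-1); rewrite mulgKV => ->.
(* By [L2] the values may be computed with [s 2], which commutes with [v 0]. *)
have Av0 : A (v 0).
  move=> w; rewrite -!L2; apply: Lcom; apply: (vb_vs Gvb); lia.
have Av1 : A (v 1%N).
  move=> w; have e : L 0 (w * v 0 * (v 0 * v 1%N)) = L 0 (w * v 0).
    rewrite -[RHS]L1 /L !invMg; congr h.
    have := vb_vvs Gvb (ltac:(lia) : (0 < m)%N) => E.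
    have -> : s 1%N = v 0 * (v 1%N * s 0) * (v 0 * v 1%N)^-1 by rewrite E mulgK.
    by rewrite !invMg !mulgA.
  rewrite -[RHS]Av0 -e; congr (L 0 _).
  by rewrite -!mulgA (mulgA (v 0) (v 0)) (vb_v2 Gvb) ?mul1g.
have all x : A x.
  apply: (vb_gen Gvb AG) => [i im w|[//|[//|i]] im w].
    rewrite /L invMg; have -> : w * s i * s 0 * ((s i)^-1 * w^-1) =
      (w * s i * w^-1) * (w * s 0 * w^-1) * (w * s i * w^-1)^-1.
      by rewrite !invMg invgK !mulgA !mulgKV.
    by rewrite (additive_onJ FG ha) //; apply: Fs.
  by apply: Lcom; apply/commute_sym/(vb_sv Gvb); lia.
have Lc w : L 0 w = 0%R.
  have E : L 0 w = L 0 1 by rewrite -[RHS](all w) mul1g.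
  have E' : L 0 (beta (v 0)) = L 0 1 by rewrite -[RHS](all (beta (v 0))) mul1g.
  move: E'; rewrite {1}/L /h !gmulfM group_homV bK lv //.
  rewrite E /L mul1g invg1 mulg1 /h; move: (l _) => d; lia.
have Ls i w : (i <= m)%N -> L i w = 0%R.
  by elim: i => // i IHi im; rewrite Lb // IHi //; lia.
pose N k := F k /\ forall g, h (g * k * g^-1) = 0%R.
have NN : normal_pred N.
  split; first split=> [|x y [Fx hx] [Fy hy]|x [Fx hx]].
  - by split=> // g; rewrite mulg1 mulgV (additive_on1 FG ha).
  - split=> [|g]; first exact: FM.
    have -> : g * (x * y) * g^-1 = (g * x * g^-1) * (g * y * g^-1) by rewrite !mulgA mulgKV.
    by rewrite ha ?hx ?hy //; exact: FJ.
  - split=> [|g]; first exact: FV.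
    have -> : g * x^-1 * g^-1 = (g * x * g^-1)^-1 by rewrite !invMg invgK mulgA.
    by rewrite (additive_onV FG ha) ?hx //; exact: FJ.
  - move=> g x [Fx hx]; split=> [|e]; first exact: FJ.
    by have := hx (e * g); rewrite invMg !mulgA.
have Ns i : (i <= m)%N -> exists2 w, vsub m v 0 w & N (s i * w).
  move=> im; exists 1; first by case: (vsub_subgroup m v 0).
  by rewrite mulg1; split=> [|g]; [exact: fs | exact: Ls].
have Fu : F (beta u) by rewrite /F /f /= bK.
(* Up to [N], where [h] vanishes, [beta u] is a torsion element of [vsub 0], where [h] vanishes too;
   but [h (beta u) = l u = 1]. *)
have [w Hw [Fw hw]] := v_decomposition NN Ns (beta u).
have Fw' : F w by have := FM _ _ (FV _ Fu) Fw; rewrite mulgA mulVg mul1g.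
have [k wk] := vsub_torsion Gvb Hw.
have w0 := additive_on_torsion FG ha Fw' wk.
have := hw 1; rewrite mul1g invg1 mulg1 ha // w0 addr0 /h bK lu.
by [].
Qed.

End AntiInvariant.

End ManyStrands.

(** * Four strands *)

Definition sw (i x : nat) : nat := if x == i then i.+1 else if x == i.+1 then i else x.

Section PureFunctional.
Variables (m : nat) (G : groupType) (s v : nat -> G) (p : {multiplicative G -> 'S_m.+2}).
Hypothesis Gvb : virtual_braid s v p.
Variable l : G -> int.
Hypothesis la : additive_on (fun g => p g = 1) l.

Definition lamp_val (a b : nat) : int := l (lamp s v p (inord a, inord b)).

Lemma tperm_inord i a : (i <= m)%N -> (a <= m.+1)%N ->
  tperm (inord i) (inord i.+1) (inord a : 'I_m.+2) = inord (sw i a).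
Proof.
move=> im am; apply: val_inj; rewrite /= val_tperm_inord // !inordK //.
by rewrite /sw; case: eqP => [|_]; [lia | case: eqP; lia].
Qed.

Lemma lamp_val_v i a b : (i <= m)%N -> (a <= m.+1)%N -> (b <= m.+1)%N -> a != b ->
  l (v i * lamp s v p (inord a, inord b) * (v i)^-1) = lamp_val (sw i a) (sw i b).
Proof.
move=> im am bm ab; rewrite lampJ //=; [|by rewrite inord_eq|exact: vsub_v].
by rewrite (vb_pv Gvb) // tpermV /move_pair /= !tperm_inord.
Qed.

Lemma pure_functional0 : (forall a b, (a <= m.+1)%N -> (b <= m.+1)%N -> a != b ->
  lamp_val a b = 0%R) -> forall g, p g = 1 -> l g = 0%R.
Proof.
move=> l0 g pg; have KG := ker_subgroup p.
suff [] : p g = 1 /\ l g = 0%R by [].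
apply: (pure_ind Gvb (A := fun g => p g = 1 /\ l g = 0%R)) pg => [|[a b] ab].
- have [K1 KM KV] := KG; split=> [|x y [px lx] [py ly]|x [px lx]]; split.
  + exact: group_hom1.
  + exact: (additive_on1 KG la).
  + exact: KM.
  + by rewrite la // lx ly.
  + exact: KV.
  + by rewrite (additive_onV KG la) // lx.
- split; first exact: p_lamp.
  have := l0 a b (ltn_ord a) (ltn_ord b) ab; by rewrite /lamp_val !inord_val.
Qed.

End PureFunctional.

(* The three splittings of four points into two pairs, indexed by the partner of [0]. *)
Definition splitting (q : 'I_4 * 'I_4) : nat :=
  if (q.1 == 0 :> nat) || (q.2 == 0 :> nat) then (q.1 + q.2).-1 else 5 - (q.1 + q.2).

Definition ord4 (i : nat) : 'I_4 := inord i.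

Lemma splitting_lt q : q.1 != q.2 -> (splitting q < 3)%N.
Proof.
case: q => a b; rewrite /splitting -val_eqE /=; have := ltn_ord a; have := ltn_ord b.
by move: (a : nat) (b : nat) => [|[|[|[|x]]]] [|[|[|[|y]]]].
Qed.

Definition splitting_act (t : 'S_4) (a : 'I_3) : 'I_3 :=
  inord (splitting (t (ord4 0), t (ord4 a.+1))).

Lemma splitting_move (t : 'S_4) q : q.1 != q.2 ->
  splitting (move_pair t q) = splitting_act t (inord (splitting q)).
Proof.
have neq (i j : 'I_4) : i != j -> (t i != t j :> nat)%N.
  by move=> ij; rewrite val_eqE (inj_eq perm_inj).
have o (i j : nat) : (i < 4)%N -> (j < 4)%N -> i != j -> ord4 i != ord4 j.
  by move=> i4 j4; rewrite inord_eq.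
have := neq _ _ (o 0%N 1%N isT isT isT); have := neq _ _ (o 0%N 2 isT isT isT).
have := neq _ _ (o 0%N 3 isT isT isT); have := neq _ _ (o 1%N 2 isT isT isT).
have := neq _ _ (o 1%N 3 isT isT isT); have := neq _ _ (o 2 3 isT isT isT).
have := ltn_ord (t (ord4 0)); have := ltn_ord (t (ord4 1)).
have := ltn_ord (t (ord4 2)); have := ltn_ord (t (ord4 3)).
move=> B3 B2 B1 B0 N23 N13 N12 N03 N02 N01 q12.
have slt := splitting_lt q12.
rewrite /splitting_act inordK; last first.
  apply: splitting_lt => /=; rewrite (inj_eq perm_inj) inord_eq ?inordK //; lia.
rewrite inordK //.
case: q q12 slt => a b; rewrite -[a]inord_val -[b]inord_val -!/(ord4 _).
move: (ltn_ord a) (ltn_ord b); move: (a : nat) (b : nat) => {a b} x y.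
case: x => [|[|[|[|//]]]] _; case: y => [|[|[|[|//]]]] _ //=;
  rewrite ?inord_eq // /splitting /= !inordK //= => _ _;
  move: (t (ord4 0) : nat) (t (ord4 1) : nat) (t (ord4 2) : nat) (t (ord4 3) : nat)
    B0 B1 B2 B3 N01 N02 N03 N12 N13 N23 => x0 x1 x2 x3 *;
  repeat case: eqP => /=; lia.
Qed.

Lemma splitting_act1 : splitting_act 1 =1 id.
Proof.
move=> a; apply: val_inj; rewrite /splitting_act !perm1 /splitting /= !inordK //=;
  have := ltn_ord a; lia.
Qed.

Lemma splitting_actM t u a : splitting_act (t * u) a = splitting_act u (splitting_act t a).
Proof.
have n : ((ord4 0, ord4 a.+1) : 'I_4 * 'I_4).1 != (ord4 a.+1).
  by rewrite inord_eq //; have := ltn_ord a; lia.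
have := splitting_move u (q := (t (ord4 0), t (ord4 a.+1))).
rewrite /= (inj_eq perm_inj) n => /(_ isT) E.
apply: val_inj; transitivity (splitting (move_pair u (t (ord4 0), t (ord4 a.+1)))).
  rewrite /splitting_act /= !permM inordK //.
  by apply: splitting_lt; rewrite /= !(inj_eq perm_inj).
by rewrite E.
Qed.

Lemma splitting_act_inj t : injective (splitting_act t).
Proof.
apply: (can_inj (g := splitting_act t^-1)) => a.
by rewrite -splitting_actM mulgV splitting_act1.
Qed.

(** The surjection of [S_4] onto [S_3] behind the cubic resolvent; its kernel is the Klein
    four-group. *)
Definition resolvent (t : 'S_4) : 'S_3 := perm (@splitting_act_inj t).

Lemma resolventM : {morph resolvent : t u / t * u}.
Proof. by move=> t u; apply/permP => a; rewrite permM !permE splitting_actM. Qed.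

Lemma resolvent1 : resolvent 1 = 1.
Proof. by apply/permP => a; rewrite permE perm1 splitting_act1. Qed.

Lemma resolvent_surj (u : 'S_3) : exists t, resolvent t = u.
Proof.
exists (lift_perm ord0 ord0 u); apply/permP => a; rewrite permE /splitting_act.
have -> : ord4 0 = ord0 by apply: val_inj; rewrite /= inordK.
have -> : ord4 a.+1 = lift ord0 a by apply: val_inj; rewrite /= inordK //; have := ltn_ord a.
rewrite lift_perm_id lift_perm_lift; apply: val_inj.
by rewrite /splitting /= add0n inordK.
Qed.

HB.instance Definition _ := isUMagmaMorphism.Build 'S_4 'S_3 resolvent (conj resolvent1 resolventM).

Lemma three_points (i j : 'I_3) (x y : 'I_3) : i != j -> x != i -> x != j -> y != i -> y != j ->
  x = y.
Proof.
move=> ij xi xj yi yj; apply/eqP/negPn/negP => xy.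
have u : uniq [:: i; j; x; y] by rewrite /= !inE !negb_or ij !(eq_sym i) !(eq_sym j) xi xj yi yj xy.
by have := max_card (mem [:: i; j; x; y]); rewrite (card_uniqP u) card_ord.
Qed.

Lemma involution3 (t : 'S_3) : t != 1 -> t * t = 1 -> exists i j, i != j /\ t = tperm i j.
Proof.
move=> t1 tt; have tK x : t (t x) = x by rewrite -permM tt perm1.
have [i ti] : exists i, t i != i.
  apply/existsP; rewrite -negb_forall; apply: contra t1 => /forallP H.
  by apply/eqP/permP => x; rewrite perm1; apply/eqP.
exists i, (t i); split; first by rewrite eq_sym.
apply/permP => x; case: tpermP => [->//|->|/eqP xi /eqP xti]; first exact: tK.
have ii : i != t i by rewrite eq_sym.
apply: (three_points ii) => //; last by rewrite (inj_eq perm_inj).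
by apply: contra xti => /eqP <-; rewrite tK.
Qed.

Lemma commute_involution3 (t u : 'S_3) : t != 1 -> t * t = 1 -> commute u t -> u = 1 \/ u = t.
Proof.
move=> t1 tt ut; have [i [j [ij tE]]] := involution3 t1 tt.
rewrite tE in ut *; have ui := commute_tperm ij ut.
have uj : u j = j \/ u j = i by apply: commute_tperm; rewrite 1?eq_sym // tpermC.
have fixed x : x != i -> x != j -> u i = i \/ u i = j -> u j = j \/ u j = i -> u x = x.
  move=> xi xj Ui Uj; have ne a : x != a -> u x != u a by rewrite (inj_eq perm_inj).
  have U : u i != u j by rewrite (inj_eq perm_inj).
  apply: (three_points ij) => //; have := ne _ xi; have := ne _ xj;
    by case: Ui Uj U => -> [->|->]; rewrite ?eqxx.
have U : u i != u j by rewrite (inj_eq perm_inj).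
case: (ui) (uj) => [Ui|Ui] [Uj|Uj]; rewrite ?Ui ?Uj ?eqxx // in U.
- left; apply/permP => x; rewrite perm1.
  have [->//|xi] := eqVneq x i; have [->//|xj] := eqVneq x j; exact: fixed.
- right; apply/permP => x; case: tpermP => [->//|->//|/eqP xi /eqP xj]; exact: fixed.
Qed.

Section FourStrands.
Variables (G : groupType) (s v : nat -> G) (p : {multiplicative G -> 'S_4}).
Hypothesis Gvb : @virtual_braid 2 G s v p.

Definition res : {multiplicative G -> 'S_3} := resolvent \o p.

(** The indicator of the splitting [{0, 2}, {1, 3}] minus that of [{0, 3}, {1, 2}]: constant on
    orbits of the Klein four-group, and negated by [v 0], which exchanges the two splittings. *)
Definition kap4 (q : 'I_4 * 'I_4) : int :=
  match nat_of_ord q.1, nat_of_ord q.2 with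
  | 0%N, 2%N | 2%N, 0%N | 1%N, 3%N | 3%N, 1%N => 1%R
  | 0%N, 3%N | 3%N, 0%N | 1%N, 2%N | 2%N, 1%N => (-1)%R
  | _, _ => 0%R
  end.

Lemma kap4E q : q.1 != q.2 -> kap4 q = ((splitting q == 1%N)%:R - (splitting q == 2)%:R)%R.
Proof.
case: q => a b; rewrite /kap4 /splitting -val_eqE /=; have := ltn_ord a; have := ltn_ord b.
by move: (a : nat) (b : nat) => [|[|[|[|x]]]] [|[|[|[|y]]]].
Qed.

Lemma kap4_ker t q : resolvent t = 1 -> kap4 (move_pair t q) = kap4 q.
Proof.
move=> rt; have [q12|q12] := eqVneq q.1 q.2.
  have d (b : 'I_4) : kap4 (b, b) = 0%R by rewrite /kap4 /=; case: b => [[|[|[|[|b]]]]].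
  by case: q q12 => a b /= ->; rewrite /move_pair /= !d.
rewrite !kap4E //=; last by rewrite (inj_eq perm_inj).
have -> : splitting (move_pair t q) = splitting q.
  rewrite splitting_move //; have := congr1 (fun u : 'S_3 => u (inord (splitting q))) rt.
  by rewrite permE perm1 => ->; rewrite inordK // splitting_lt.
by [].
Qed.

Lemma kap4_v0 q : kap4 (move_pair (p (v 0)) q) = (- kap4 q)%R.
Proof.
case: q => a b; rewrite /kap4 /move_pair /= (vb_pv Gvb) // !val_tperm_inord //.
by move: (ltn_ord a) (ltn_ord b); move: (a : nat) (b : nat) => [|[|[|[|a']]]] [|[|[|[|b']]]].
Qed.

Let l4 := ell Gvb kap4.
Let K (g : G) : Prop := res g = 1.

Lemma l4_additive : additive_on K l4.
Proof.
move=> x y Kx _; rewrite /l4 ellM; congr (_ + _)%R; rewrite /ell; apply: eq_bigr => q _ /=.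
rewrite kap4_ker //; have := group_homV res x.
by rewrite Kx invg1 /res /= group_homV.
Qed.

Lemma l4_v0 x : K x -> l4 (v 0 * x * (v 0)^-1) = (- l4 x)%R.
Proof.
move=> Kx; rewrite /l4 ell_vJ; last exact: vsub_v.
rewrite /ell -sumrN; apply: eq_bigr => q _ /=.
by rewrite (p_v2 Gvb) // kap4_v0 mulNr.
Qed.

Let u4 := lamp s v p (inord 0, inord 2).

Lemma p_u4 : p u4 = 1.
Proof. by apply: (p_lamp Gvb); rewrite inord_eq. Qed.

Lemma K_u4 : K u4.
Proof. by rewrite /K /res /= p_u4 resolvent1. Qed.

Lemma l4_u4 : l4 u4 = 1%R.
Proof. by rewrite /l4 ell_lamp ?inord_eq // /kap4 /= !inordK. Qed.

Lemma res_v02 : res (v 0) = res (v 2).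
Proof.
rewrite /res /= !(vb_pv Gvb) //; apply/permP => a; rewrite !permE /splitting_act.
apply: val_inj; congr (val (inord _)); rewrite /splitting /= !val_tperm_inord // !inordK //.
  by case: a => [[|[|[|a]]]].
by have := ltn_ord a.
Qed.

Lemma res_v01 : res (v 0) != res (v 1%N).
Proof.
apply/negP => /eqP /(congr1 (fun t : 'S_3 => val (t ord0))).
rewrite /res /= !(vb_pv Gvb) // !permE /splitting_act /= !inordK ?splitting_lt //=;
  rewrite ?(inj_eq perm_inj) ?inord_eq //.
by rewrite /splitting /= !val_tperm_inord // !inordK.
Qed.

(** Since [res (v 0) = res (v 2)], [v 2] negates as well. A pair fixed by [v 0] or [v 2] then has
    value 0, and all remaining pairs are linked to [(0, 2)], where [d] vanishes by construction.
    This settles the kernel of [p], which contains a power of each element of [K]. *)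
Lemma l4_unique (l : G -> int) : additive_on K l ->
  (forall x, K x -> l (v 0 * x * (v 0)^-1) = (- l x)%R) ->
  forall x, K x -> l x = (l u4 * l4 x)%R.
Proof.
move=> la lv; pose d x : int := (l x - l u4 * l4 x)%R.
have KG := ker_subgroup res.
have pK x : p x = 1 -> K x by rewrite /K /res /= => ->; exact: resolvent1.
have da : additive_on K d.
  by move=> x y ex ey; rewrite /d la // l4_additive //;
    move: (l x) (l y) (l u4) (l4 x) (l4 y) => *; lia.
have da' : additive_on (fun g => p g = 1) d by move=> x y /pK Kx /pK Ky; exact: da.
have dv x : K x -> d (v 0 * x * (v 0)^-1) = (- d x)%R.
  by move=> ex; rewrite /d lv // l4_v0 //; move: (l x) (l u4) (l4 x) => *; lia.
have dv2 x : K x -> d (v 2 * x * (v 2)^-1) = (- d x)%R.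
  by apply: (anti_transfer (q := res) da (t := v 0)) => //; exact/esym/res_v02.
have Kl a b : (a <= 3)%N -> (b <= 3)%N -> a != b -> K (lamp s v p (inord a, inord b)).
  by move=> am bm ab; apply: pK; apply: (p_lamp Gvb); rewrite inord_eq.
have S0 a b : (a <= 3)%N -> (b <= 3)%N -> a != b ->
    lamp_val s v p d (sw 0 a) (sw 0 b) = (- lamp_val s v p d a b)%R.
  by move=> am bm ab; rewrite -(lamp_val_v Gvb) // dv //; exact: Kl.
have S2 a b : (a <= 3)%N -> (b <= 3)%N -> a != b ->
    lamp_val s v p d (sw 2 a) (sw 2 b) = (- lamp_val s v p d a b)%R.
  by move=> am bm ab; rewrite -(lamp_val_v Gvb) // dv2 //; exact: Kl.
have Z02 : lamp_val s v p d 0 2 = 0%R by rewrite /lamp_val /d -/u4 l4_u4 mulr1 subrr.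
have Z20 : lamp_val s v p d 2 0 = 0%R.
  (* The permutation of [w] is the double transposition [(0 2)(1 3)], so [w] lies in [K] and
     exchanges [(0, 2)] with [(2, 0)]. *)
  pose w := v 1%N * (v 0 * v 2) * v 1%N.
  have Kw : K w.
    have r11 : res (v 1%N) * res (v 1%N) = 1 by rewrite -gmulfM (vb_v2 Gvb) // group_hom1.
    have r00 : res (v 2) * res (v 2) = 1 by rewrite -gmulfM (vb_v2 Gvb) // group_hom1.
    by rewrite /K /w !gmulfM res_v02 r00 mulg1 r11.
  have Hw : vsub 2 v 0 w.
    by have [_ VM _] := vsub_subgroup 2 v 0; apply: (VM _ _ (VM _ _ _ (VM _ _ _ _)) _);
      apply: vsub_v.
  have := additive_onJ KG da Kw (Kl 0%N 2 isT isT isT).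
  rewrite lampJ ?inord_eq //; rewrite -/(lamp_val s v p d 0 2) Z02 => <-; congr (d (lamp _ _ _ _)).
  rewrite -group_homV /w !invMg !(v_inv Gvb) // !gmulfM !move_pairM !(vb_pv Gvb) //.
  by rewrite /move_pair /= !tperm_inord.
have d0 : forall g, p g = 1 -> d g = 0%R.
  apply: (pure_functional0 Gvb da') => a b am bm ab.
  have z x : (x = - x -> x = 0 :> int)%R by lia.
  have E01 : lamp_val s v p d 0 1 = 0%R by apply: z; exact: (S2 0%N 1%N).
  have E10 : lamp_val s v p d 1 0 = 0%R by apply: z; exact: (S2 1%N 0%N).
  have E23 : lamp_val s v p d 2 3 = 0%R by apply: z; exact: (S0 2 3).
  have E32 : lamp_val s v p d 3 2 = 0%R by apply: z; exact: (S0 3 2).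
  have E12 : lamp_val s v p d 1 2 = 0%R by have := S0 0%N 2 isT isT isT; rewrite Z02 oppr0.
  have E21 : lamp_val s v p d 2 1 = 0%R by have := S0 2 0%N isT isT isT; rewrite Z20 oppr0.
  have E03 : lamp_val s v p d 0 3 = 0%R by have := S2 0%N 2 isT isT isT; rewrite Z02 oppr0.
  have E30 : lamp_val s v p d 3 0 = 0%R by have := S2 2 0%N isT isT isT; rewrite Z20 oppr0.
  have E13 : lamp_val s v p d 1 3 = 0%R by have := S0 0%N 3 isT isT isT; rewrite E03 oppr0.
  have E31 : lamp_val s v p d 3 1 = 0%R by have := S0 3 0%N isT isT isT; rewrite E30 oppr0.
  by case: a am ab => [|[|[|[|a]]]] // _; case: b bm => [|[|[|[|b]]]].
move=> x Kx; suff : d x = 0%R by rewrite /d; move: (l x) (l u4 * l4 x)%R => *; lia.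
have : d (x ^+ #[p x]) = 0%R.
  apply: d0; rewrite -[RHS](expg_order (p x)).
  by elim: (#[p x]) => [|k IHk]; rewrite ?expg0 ?group_hom1 // !expgS gmulfM IHk.
rewrite (additive_onX KG da) // => /eqP; rewrite mulrn_eq0 => /orP [|/eqP //].
by rewrite eqn0Ngt order_gt0.
Qed.

Lemma reidemeister_four_strands (alpha : {multiplicative G -> G}) :
  bijective alpha -> reidemeister_number alpha = None.
Proof.
move=> /multiplicative_inverse [beta [aK bK]].
have m2 : (2 <= 2)%N by [].
pose f : {multiplicative G -> 'S_3} := res \o alpha.
have fv2 i : (i <= 2)%N -> f (v i) * f (v i) = 1.
  by move=> im; rewrite -gmulfM (vb_v2 Gvb) // group_hom1.
have rv2 i : (i <= 2)%N -> res (v i) * res (v i) = 1.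
  by move=> im; rewrite -gmulfM (vb_v2 Gvb) // group_hom1.
have f01 : f (v 0) != f (v 1%N).
  apply: contra res_v01 => /eqP E; apply/eqP.
  have com := hom_abelian Gvb m2 E (beta (v 0)) (beta (v 1%N)).
  rewrite /f /= !bK in com.
  exact: (commute_braid com (hom_braid_v Gvb m2 res)).
have nontriv (h : {multiplicative G -> 'S_3}) : h (v 0) != h (v 1%N) ->
    h (v 0) != 1 /\ h (v 1%N) != 1.
  have := hom_braid_v Gvb m2 h => + ne; move=> E; split; apply: contra ne => /eqP e.
    by apply/eqP; rewrite e; apply: (mulgI (h (v 1%N))); rewrite mulg1; move: E;
      rewrite e !mul1g mulg1.
  by apply/eqP; rewrite e; apply: (mulgI (h (v 0))); rewrite mulg1; move: E; rewrite e !mul1g mulg1.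
have [f0 f1] := nontriv f f01.
have f2 : f (v 2) != 1.
  have := congr1 f (vb_vvv Gvb (isT : (1 < 2)%N)); rewrite !gmulfM => E.
  apply: contra f1 => /eqP e; move: E; rewrite e !mul1g !mulg1 => E.
  by apply/eqP; apply: (mulgI (f (v 1%N))); rewrite E mulg1.
have f02 : f (v 2) = f (v 0).
  have c : commute (f (v 2)) (f (v 0)).
    by rewrite /commute -!gmulfM (vb_vv Gvb (i := 0) (j := 2)).
  by have [E|//] := commute_involution3 f0 (fv2 0%N isT) c; rewrite E eqxx in f2.
have fs0 : f (s 0) = f (v 0).
  have c : commute (f (s 0)) (f (v 0)).
    by rewrite -f02 /commute -!gmulfM (vb_sv Gvb (i := 0) (j := 2)).
  have [E|//] := commute_involution3 f0 (fv2 0%N isT) c.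
  by case: (s_not_killed Gvb m2 l4_additive K_u4 l4_u4 l4_v0 aK bK E).
have rs i : (i <= 2)%N -> res (s i) = res (v i).
  by move=> im; rewrite /res /= (vb_ps Gvb) // (vb_pv Gvb).
have conj_std (h : {multiplicative G -> 'S_3}) : h (v 0) != h (v 1%N) ->
    exists x, h (v 0) ^ x = tperm (inord 0) (inord 1) /\ h (v 1%N) ^ x = tperm (inord 1) (inord 2).
  move=> ne; have [h0 h1] := nontriv h ne.
  have hh i : (i <= 2)%N -> h (v i) * h (v i) = 1.
    by move=> im; rewrite -gmulfM (vb_v2 Gvb) // group_hom1.
  have [a [b [ab E0]]] := involution3 h0 (hh 0%N isT).
  have [c [d [cd E1]]] := involution3 h1 (hh 1%N isT).
  exact: (transposition_pair E0 E1 ne ab cd (hom_braid_v Gvb m2 h)).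
(* Both [f] and [res] are conjugate to the same standard pair of transpositions; [g0] lifts the
   conjugation between them, so that [alpha] followed by conjugation by [g0] preserves [res]. *)
have [x [X0 X1]] := conj_std f f01.
have [y [Y0 Y1]] := conj_std res res_v01.
have [t tE] := resolvent_surj (x * y^-1)^-1.
have [g0 _ pg0] := vsub_lift Gvb t.
have rg0 : res g0 = (x * y^-1)^-1 by rewrite /res /= pg0.
have cE (z : 'S_3) : res g0 * z * (res g0)^-1 = (z ^ x) ^ y^-1.
  by rewrite rg0 invgK -conjgM /conjg !mulgA.
have flam : f (lam s v) = 1 by rewrite /lam gmulfM fs0 fv2.
have fsv i : (i <= 2)%N -> f (s i) = f (v i).
  move=> im; apply: (mulIg (f (v i))); rewrite fv2 // -gmulfM (sv_lamp Gvb) //.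
  by apply: (hom_kill_lam Gvb flam); apply: (p_lamp Gvb); rewrite inord_eq; lia.
have qh g : res (g0 * alpha g * g0^-1) = res g.
  apply: (vb_gen Gvb (A := fun g => res (g0 * alpha g * g0^-1) = res g)) => [|i im|i im].
  - split=> [|a b Ea Eb|a Ea].
    + by rewrite !group_hom1 mulg1 mulgV group_hom1.
    + have -> : g0 * alpha (a * b) * g0^-1 = (g0 * alpha a * g0^-1) * (g0 * alpha b * g0^-1).
        by rewrite gmulfM !mulgA mulgKV.
      by rewrite gmulfM Ea Eb gmulfM.
    + have -> : g0 * alpha a^-1 * g0^-1 = (g0 * alpha a * g0^-1)^-1.
        by rewrite group_homV !invMg invgK mulgA.
      by rewrite group_homV Ea group_homV.
  - rewrite rs // !gmulfM -[res (alpha (s i))]/(f (s i)) fsv // group_homV cE.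
    case: i im => [|[|[|//]]] _.
    + by rewrite X0 -Y0 conjgK.
    + by rewrite X1 -Y1 conjgK.
    + by rewrite f02 X0 -Y0 conjgK res_v02.
  - rewrite !gmulfM -[res (alpha (v i))]/(f (v i)) group_homV cE.
    case: i im => [|[|[|//]]] _.
    + by rewrite X0 -Y0 conjgK.
    + by rewrite X1 -Y1 conjgK.
    + by rewrite f02 X0 -Y0 conjgK res_v02.
have qh' g : res (beta (g0^-1 * g * g0)) = res g.
  by rewrite -qh bK !mulgA mulgV mul1g mulgK.
have scal (h : G -> G) : (forall a b, h (a * b) = h a * h b) -> (forall g, res (h g) = res g) ->
    forall a, K a -> l4 (h a) = (l4 (h u4) * l4 a)%R.
  move=> hM rh; have h1 : h 1 = 1 by apply: (mulIg (h 1)); rewrite -hM !mul1g.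
  have hV a : h a^-1 = (h a)^-1 by apply: (mulIg (h a)); rewrite -hM !mulVg h1.
  apply: (l4_unique (l := fun a => l4 (h a))) => [a b Ka Kb|a Ka].
    by rewrite hM l4_additive // /K rh.
  rewrite !hM hV; apply: (anti_transfer (q := res) l4_additive (t := v 0)) => //.
    exact: l4_v0.
  by rewrite /K rh.
have KG := ker_subgroup res.
have Kf : finite_index K.
  exists 'S_3, (fun g => res g) => a b E; by rewrite /K gmulfM group_homV E mulgV.
apply: (reidemeister_signed (g := g0) (t := v 0) (u := u4) bK aK KG Kf l4_additive _
  (ker_conj_closed (q := res) (v 0)) l4_v0 (scal (fun a => g0 * alpha a * g0^-1) _ qh)
  (scal (fun a => beta (g0^-1 * a * g0)) _ qh') K_u4 l4_u4).
- by move=> a; rewrite /K qh.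
- by move=> a b; rewrite gmulfM !mulgA mulgKV.
- by move=> a b; rewrite -gmulfM !mulgA mulgK.
Qed.

End FourStrands.

(** * Five or more strands *)

Section FixedPairs.
Variables (n : nat).
Implicit Types t : 'S_n.

Definition fixed_points t : {set 'I_n} := [set a | t a == a].

(** The diagonal of the square of the fixed-point set accounts for the second summand. In this way a
    trace on ordered pairs reveals the number of fixed points. *)
Lemma card_fixed_pairs t :
  (#|[set q : 'I_n * 'I_n | (q.1 != q.2) && (move_pair t q == q)]| + #|fixed_points t|
   = #|fixed_points t| * #|fixed_points t|)%N.
Proof.
set A := fixed_points t; rewrite -cardsX -(cardsID [set q : 'I_n * 'I_n | q.1 == q.2]
  (finset.setX A A)).
rewrite addnC; congr (_ + _)%N.
  have -> : finset.setX A A :&: [set q : 'I_n * 'I_n | q.1 == q.2] = [set (a, a) | a in A].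
    apply/setP => -[a b]; rewrite !inE /=; apply/idP/imsetP => [|[c cA [-> ->]]].
      by move=> /andP [/andP [Aa _] /eqP <-]; exists a; rewrite // inE.
    by move: cA; rewrite inE => ->; rewrite eqxx.
  by rewrite card_imset // => a b [].
by congr #|pred_of_set _|; apply/setP => -[a b]; rewrite !inE.
Qed.

Lemma fixed_points_tperm (a b : 'I_n) : a != b -> (#|fixed_points (tperm a b)| + 2 = n)%N.
Proof.
move=> ab; have -> : fixed_points (tperm a b) = ~: [set a; b].
  apply/setP => c; rewrite !inE; case: tpermP => [->|->|/eqP ca /eqP cb].
  - by rewrite eqxx eq_sym (negPf ab).
  - by rewrite eqxx orbT (negPf ab).
  - by rewrite eqxx (negPf ca) (negPf cb).
by have := cardsC [set a; b]; rewrite cards2 ab card_ord addnC.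
Qed.

Lemma transposition_of_fixed t : (#|fixed_points t| + 2 = n)%N ->
  exists a b, a != b /\ t = tperm a b.
Proof.
move=> ft; have := cardsC (fixed_points t); rewrite card_ord => C.
have C2 : #|~: fixed_points t| = 2.
  by apply: (@addnI #|fixed_points t|); rewrite C ft.
have [a [b [ab E]]] := elimT (cards2P _) (introT eqP C2).
exists a, b; split=> //.
have moved c : (c \in ~: fixed_points t) = (t c != c) by rewrite !inE.
have ta : t a != a by rewrite -moved E !inE eqxx.
have tb : t b != b by rewrite -moved E !inE eqxx orbT.
have tta : t (t a) != t a by rewrite (inj_eq perm_inj).
have ttb : t (t b) != t b by rewrite (inj_eq perm_inj).
apply/permP => c; case: tpermP => [->|->|/eqP ca /eqP cb].
- by move: tta; rewrite -moved E !inE (negPf ta) => /eqP.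
- by move: ttb; rewrite -moved E !inE (negPf tb) orbF => /eqP.
- by apply/eqP/negPn; rewrite -moved E !inE (negPf ca) (negPf cb).
Qed.

End FixedPairs.

(* The alternating group is simple, so a nontrivial kernel would contain it. *)
Lemma perm_hom_inj (n : nat) (f : 'S_n.+2 -> 'S_n.+2) (x y : 'S_n.+2) : (4 < n.+2)%N ->
  {morph f : t u / t * u} -> odd_perm x = odd_perm y -> f x != f y -> injective f.
Proof.
move=> n5 fM xy fxy.
have f1 : f 1 = 1 by apply: (mulIg (f 1)); rewrite -fM !mul1g.
have fV t : f t^-1 = (f t)^-1 by apply: (mulIg (f t)); rewrite -fM !mulVg f1.
have gs : group_set [set t | f t == 1].
  apply/group_setP; split; first by rewrite inE f1.
  by move=> t u; rewrite !inE fM => /eqP -> /eqP ->; rewrite mulg1.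
pose N : {group 'S_n.+2} := Group gs.
have NJ t u : t \in N -> t ^ u \in N.
  by rewrite !inE /conjg !fM fV => /eqP ->; rewrite mul1g mulVg.
have normalNA : (N :&: 'Alt_('I_n.+2))%G <| 'Alt_('I_n.+2)%G.
  apply/andP; split; first exact: subsetIr.
  apply/fintype.subsetP => u uA; rewrite inE; apply/fintype.subsetP => _ /imsetP [t tN ->].
  move: tN; rewrite inE => /andP [tN tA]; rewrite inE NJ //=.
  by rewrite memJ_norm // (fintype.subsetP (normG _)).
have /simpleP [_ /(_ _ normalNA) []] : simple 'Alt_('I_n.+2) by apply: simple_Alt5;
  rewrite card_ord.
- move=> triv.
  (* Commutators are even, so a normal subgroup that meets the alternating group trivially is
     central. *)
  have cent t : t \in N -> forall u, commute t u.
    move=> tN u; have : [~ t, u] \in (N :&: 'Alt_('I_n.+2)).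
      rewrite inE; apply/andP; split; first by rewrite commgEl groupM ?groupV ?NJ.
      by rewrite Alt_even commgEl odd_permM odd_permV odd_permJ addbb.
    by rewrite triv inE => /commgP.
  have inN t : t \in N -> t = 1.
    move=> tN; apply/permP => a; rewrite perm1.
    have [b ba] : exists b, b != a.
      have [->|a0] := eqVneq a ord0; first by exists ord_max.
      by exists ord0; rewrite eq_sym.
    have [c [ca cb]] : exists c, c != a /\ c != b.
      have : (0 < #|~: [set a; b]|)%N.
        by have := cardsC [set a; b]; rewrite cards2 card_ord; case: (a == b) => /=; lia.
      by case/card_gt0P => c; rewrite !inE negb_or => /andP [ca cb]; exists c.
    have ab : a != b by rewrite eq_sym.
    have ac : a != c by rewrite eq_sym.
    have [//|tb] := commute_tperm ab (cent t tN (tperm a b)).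
    have [//|tc] := commute_tperm ac (cent t tN (tperm a c)).
    by rewrite -tb tc eqxx in cb.
  move=> t u ftu; apply: (mulIg u^-1); rewrite mulgV; apply: inN.
  by rewrite inE fM fV ftu mulgV.
- move=> full; have : x * y^-1 \in (N :&: 'Alt_('I_n.+2)).
    by rewrite full Alt_even odd_permM odd_permV xy addbb.
  rewrite inE inE fM fV => /andP [/eqP E _].
  by case/eqP: fxy; apply: (mulIg (f y)^-1); rewrite mulgV.
Qed.

Section FiveStrands.
Variables (m : nat) (G : groupType) (s v : nat -> G) (p : {multiplicative G -> 'S_m.+2}).
Hypothesis Gvb : virtual_braid s v p.
Hypothesis m3 : (3 <= m)%N.
Let K (g : G) : Prop := p g = 1.
Let l0 := ell Gvb (@kap m).
Let lm := lam s v.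

Lemma l0_pure : additive_on K l0.
Proof.
move=> x y Kx _; rewrite /l0 ellM; congr (_ + _)%R; rewrite /ell; apply: eq_bigr => q _ /=.
by rewrite Kx invg1 move_pair1.
Qed.

Lemma l0_pure_v i x : (i < 2)%N -> K x -> l0 (v i * x * (v i)^-1) = (- l0 x)%R.
Proof.
move=> i2 Kx; rewrite /l0 ell_vJ; last by apply: vsub_v; lia.
rewrite /ell -sumrN; apply: eq_bigr => q _ /=; rewrite (p_v2 Gvb); last lia.
by case: i i2 => [|[|//]] _; rewrite ?(kap_v0 Gvb) ?(kap_v1 Gvb) ?mulNr //; lia.
Qed.

Lemma l0_pure_lam : l0 lm = 1%R.
Proof. by rewrite /l0 ell_lam kap_base. Qed.

Lemma K_lam : K lm. Proof. exact: p_lam. Qed.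

(** A pair fixed by [v 0] or [v 1] has value 0 under [d], and for [a > 2] the pairs of [a] and 1 are
    moved by [v 0] to those of [a] and 0, which [v 1] fixes. The six pairs of the first three points
    are linked to [(0, 1)], where [d] vanishes by construction. *)
Lemma l0_pure_unique (l : G -> int) : additive_on K l ->
  (forall i x, (i < 2)%N -> K x -> l (v i * x * (v i)^-1) = (- l x)%R) ->
  forall x, K x -> l x = (l lm * l0 x)%R.
Proof.
move=> la lv; pose d x : int := (l x - l lm * l0 x)%R.
have da : additive_on K d.
  by move=> x y ex ey; rewrite /d la // l0_pure //; move: (l x) (l y) (l lm) (l0 x) (l0 y) => *;
    lia.
have dv i x : (i < 2)%N -> K x -> d (v i * x * (v i)^-1) = (- d x)%R.
  by move=> i2 ex; rewrite /d lv // l0_pure_v //; move: (l x) (l lm) (l0 x) => *; lia.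
pose P := lamp_val s v p d.
have S i a b : (i < 2)%N -> (a <= m.+1)%N -> (b <= m.+1)%N -> a != b -> P (sw i a) (sw i b) = (-
  P a b)%R.
  move=> i2 am bm ab; rewrite /P -(lamp_val_v Gvb) //; last lia.
  by rewrite dv //; apply: (p_lamp Gvb); rewrite inord_eq.
have Z01 : P 0%N 1%N = 0%R.
  by rewrite /P /lamp_val -(sv_lamp Gvb) // -/(lam s v) -/lm /d l0_pure_lam mulr1 subrr.
have Z10 : P 1%N 0%N = 0%R by have := S 0%N 0%N 1%N isT isT isT isT; rewrite Z01 oppr0.
have Z02 : P 0%N 2 = 0%R by have := S 1%N 0%N 1%N isT isT isT isT; rewrite Z01 oppr0.
have Z20 : P 2 0%N = 0%R by have := S 1%N 1%N 0%N isT isT isT isT; rewrite Z10 oppr0.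
have Z12 : P 1%N 2 = 0%R by have := S 0%N 0%N 2 isT isT ltac:(lia) isT; rewrite Z02 oppr0.
have Z21 : P 2 1%N = 0%R by have := S 0%N 2 0%N isT ltac:(lia) isT isT; rewrite Z20 oppr0.
have z (x : int) : (x = - x -> x = 0 :> int)%R by lia.
have far i a b : (i < 2)%N -> (a <= m.+1)%N -> (b <= m.+1)%N -> a != b -> sw i a = a -> sw i b =
  b ->
    P a b = 0%R.
  by move=> i2 am bm ab sa sb; apply: z; rewrite -(S i) // sa sb.
have Zfar a b : (a <= m.+1)%N -> (b <= m.+1)%N -> (2 < a)%N -> P a b = 0%R /\ P b a = 0%R \/ a = b.
  move=> am bm a3; have [ab|ab] := eqVneq a b; first by right.
  have ba : b != a by rewrite eq_sym.
  have sa i : (i < 2)%N -> sw i a = a by rewrite /sw; case: eqP => [|_]; [lia | case: eqP; lia].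
  left; case: b bm ab ba => [|[|b]] bm ab ba.
  - by split; apply: (far 1%N) => //; apply: sa.
  - have [E1 E2] : P a 0%N = 0%R /\ P 0%N a = 0%R.
      by split; apply: (far 1%N) => //; try exact: sa; lia.
    have := S 0%N a 0%N isT am isT ltac:(lia); have := S 0%N 0%N a isT isT am ltac:(lia).
    by rewrite sa // E1 E2 !oppr0.
  - by split; apply: (far 0%N) => //; apply: sa.
have d0 : forall g, p g = 1 -> d g = 0%R.
  apply: (pure_functional0 Gvb da) => a b am bm ab; rewrite -/(P a b).
  have [a3|a3] := ltnP 2 a; first by have [[]|E] := Zfar a b am bm a3 => //; rewrite E eqxx in ab.
  have [b3|b3] := ltnP 2 b; first by have [[]|E] := Zfar b a bm am b3 => //; rewrite E eqxx in ab.
  by case: a a3 ab {am} => [|[|[|a]]] // _; case: b b3 {bm} => [|[|[|b]]].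
by move=> x Kx; have := d0 x Kx; rewrite /d; move: (l x) (l lm * l0 x)%R => *; lia.
Qed.

(** The crossing counts are coordinates dual to the generators [lamp r], so [f] acts on them by the
    matrix of its values on these generators. *)
Lemma pure_cnt (f : {multiplicative G -> G}) : (forall g, K g -> K (f g)) ->
  forall g, K g -> forall q, cnt Gvb (f g) q =
    (\sum_(r | r.1 != r.2) cnt Gvb (f (lamp s v p r)) q * cnt Gvb g r)%R.
Proof.
move=> fK g Kg q; pose D r := cnt Gvb (f (lamp s v p r)) q.
pose E g : int := (cnt Gvb (f g) q - \sum_(r | r.1 != r.2) D r * cnt Gvb g r)%R.
have cntK x y r : K x -> cnt Gvb (x * y) r = (cnt Gvb x r + cnt Gvb y r)%R.
  by move=> Kx; rewrite cntM Kx move_pair1.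
have Ea : additive_on K E.
  move=> x y Kx Ky; rewrite /E gmulfM cntK; last exact: fK.
  under eq_bigr => r _ do rewrite cntK // mulrDr.
  by rewrite big_split /=; move: (\sum_(r | _) _)%R (\sum_(r | _) _)%R (cnt _ _ _) (cnt _ _ _) =>
    *; lia.
suff E0 : E g = 0%R by move: E0; rewrite /E => /eqP; rewrite subr_eq0 => /eqP.
apply: (pure_functional0 Gvb Ea) Kg => a b am bm ab.
have n : ((inord a, inord b) : 'I_m.+2 * 'I_m.+2).1 != (inord b : 'I_m.+2) by rewrite inord_eq.
rewrite /lamp_val /E (bigD1 (inord a, inord b)) //= cnt_lamp // eqxx mulr1 big1 ?addr0 ?subrr //.
by move=> r /andP [_ rn]; rewrite cnt_lamp // (negPf rn) mulr0.
Qed.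

Lemma reidemeister_five_strands (alpha : {multiplicative G -> G}) :
  bijective alpha -> reidemeister_number alpha = None.
Proof.
move=> /multiplicative_inverse [beta [aK bK]].
have m2 : (2 <= m)%N by lia.
pose f : {multiplicative G -> 'S_m.+2} := p \o alpha.
have KG := ker_subgroup p.
have p01 : p (v 0) != p (v 1%N).
  rewrite !(vb_pv Gvb) //; last lia.
  apply/negP => /eqP /(congr1 (fun t : 'S_m.+2 => val (t (inord 0)))).
  by rewrite /= !val_tperm_inord ?inordK //; lia.
have f01 : f (v 0) != f (v 1%N).
  apply: contra p01 => /eqP E; apply/eqP.
  have com := hom_abelian Gvb m2 E (beta (v 0)) (beta (v 1%N)).
  rewrite /f /= !bK in com.
  exact: (commute_braid com (hom_braid_v Gvb m2 p)).
(* The section of [p] with values in [vsub 0] is a homomorphism by [vsub_p_inj]; it turns the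
   restriction of [f] to [vsub 0] into an endomorphism [th] of the symmetric group. *)
have lift (t : 'S_m.+2) : exists w, vsub m v 0 w /\ p w = t.
  by have [w Hw pw] := vsub_lift Gvb t; exists w.
have [sec secP] := choice lift.
have [_ VM VV] := vsub_subgroup m v 0.
have secM t u : sec (t * u) = sec t * sec u.
  have [H1 E1] := secP t; have [H2 E2] := secP u; have [H3 E3] := secP (t * u).
  by apply: (vsub_p_inj Gvb) => //; [exact: VM | rewrite gmulfM E1 E2].
have sec_v w : vsub m v 0 w -> sec (p w) = w.
  by move=> Hw; have [H1 E1] := secP (p w); apply: (vsub_p_inj Gvb).
pose th t : 'S_m.+2 := f (sec t).
have thM : {morph th : t u / t * u} by move=> t u; rewrite /th secM gmulfM.
have th_v i : (i <= m)%N -> th (p (v i)) = f (v i).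
  by move=> im; rewrite /th sec_v //; apply: vsub_v.
have th_inj : injective th.
  apply: (perm_hom_inj (x := p (v 0)) (y := p (v 1%N)) _ thM) => //.
    by rewrite !(vb_pv Gvb) ?odd_tperm ?inord_eq //; lia.
  by rewrite !th_v //; lia.
(* The preimage [t0] of [f (s 0)] commutes with all transpositions of neighbours from the point 2
   on. As [3 <= m], at least two of these overlap, which forces [t0] to fix every point from 2
   on. *)
have fs0 : f (s 0) = f (v 0).
  have [t0 t0E] : exists t0, th t0 = f (s 0).
    have [g _ gK] := injF_bij th_inj; by exists (g (f (s 0))).
  have comm i : (2 <= i <= m)%N -> commute t0 (tperm (inord i) (inord i.+1)).
    move=> i2; apply: th_inj; rewrite !thM t0E -(vb_pv Gvb); last lia.
    rewrite th_v; last lia.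
    by rewrite -!gmulfM (vb_sv Gvb (i := 0) (j := i)) //; lia.
  have stab i : (2 <= i <= m)%N -> (t0 (inord i) = inord i \/ t0 (inord i) = inord i.+1) /\
      (t0 (inord i.+1) = inord i.+1 \/ t0 (inord i.+1) = inord i).
    move=> i2; have ne : (inord i : 'I_m.+2) != inord i.+1 by rewrite inord_eq; lia.
    split; first exact: commute_tperm ne (comm i i2).
    by apply: commute_tperm; [rewrite eq_sym | rewrite tpermC; exact: comm].
  have ine a b : (a <= m.+1)%N -> (b <= m.+1)%N -> a <> b -> (inord a : 'I_m.+2) <> inord b.
    by move=> am bm ab /eqP; rewrite inord_eq // => /eqP.
  have fix3 : t0 (inord 3) = inord 3.
    have [_ [//|A]] := stab 2 ltac:(lia); have [[//|B] _] := stab 3 ltac:(lia).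
    by move: A; rewrite B => /ine; case; lia.
  have fix2 : t0 (inord 2) = inord 2.
    have [[//|A] _] := stab 2 ltac:(lia).
    by move: A; rewrite -fix3 => /perm_inj /ine; case; lia.
  have fixi i : (2 <= i <= m.+1)%N -> t0 (inord i) = inord i.
    elim: i => [//|i IHi] i2; have [i1|i1] := eqVneq i 1%N; first by rewrite i1.
    have [_ [//|A]] := stab i ltac:(lia).
    by move: A; rewrite -(IHi ltac:(lia)) => /perm_inj /ine; case; lia.
  have fix_big (a : 'I_m.+2) : (1 < a)%N -> t0 a = a.
    by move=> a1; rewrite -[a]inord_val; apply: fixi; have := ltn_ord a; lia.
  have small (a : 'I_m.+2) : (a <= 1)%N -> (t0 a <= 1)%N.
    move=> a1; rewrite leqNgt; apply/negP => b1.
    by have := fix_big _ b1 => /perm_inj E; rewrite E in b1; lia.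
  have o0 : ((inord 0 : 'I_m.+2) <= 1)%N by rewrite inordK.
  have o1 : ((inord 1 : 'I_m.+2) <= 1)%N by rewrite inordK.
  have le1 (a : 'I_m.+2) : (a <= 1)%N -> a = inord 0 \/ a = inord 1.
    move=> a1; case E : (a : nat) a1 => [|[|//]] _; [left|right]; apply: val_inj;
      by rewrite /= inordK.
  have ne01 : t0 (inord 0) != t0 (inord 1) by rewrite (inj_eq perm_inj) inord_eq.
  have [T|T] : t0 = 1 \/ t0 = p (v 0).
    have [A|A] := le1 _ (small _ o0); have [B|B] := le1 _ (small _ o1);
      rewrite ?A ?B ?eqxx // in ne01.
    - left; apply/permP => a; rewrite perm1; have [a1|a1] := ltnP 1 a; first exact: fix_big.
      by have [->|->] := le1 _ a1.
    - right; rewrite (vb_pv Gvb) //; apply/permP => a; have [a1|a1] := ltnP 1 a.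
        rewrite fix_big // tpermD // -val_eqE /= inordK //; lia.
      by have [->|->] := le1 _ a1; rewrite ?tpermL ?tpermR.
  - have th1 : th 1 = 1 by apply: (mulIg (th 1)); rewrite -thM !mul1g.
    have E : p (alpha (s 0)) = 1 by rewrite -[LHS]/(f (s 0)) -t0E T th1.
    case: (s_not_killed Gvb m2 l0_pure K_lam l0_pure_lam _ aK bK E) => x.
    exact: (l0_pure_v (i := 0)).
  - by rewrite -t0E T th_v.
have flam : f lm = 1 by rewrite /lm /lam gmulfM fs0 -gmulfM (vb_v2 Gvb) // group_hom1.
have fth g : f g = th (p g).
  have [H1 E1] := secP (p g).
  have : f (g * (sec (p g))^-1) = 1.
    by apply: (hom_kill_lam Gvb flam); rewrite gmulfM group_homV E1 mulgV.
  by rewrite gmulfM group_homV => /(canRL (mulgK _)); rewrite invgK mul1g.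
have th1 : th 1 = 1 by apply: (mulIg (th 1)); rewrite -thM !mul1g.
have aKer g : K g <-> K (alpha g).
  rewrite /K -[p (alpha g)]/(f g) fth; split=> [->//|]; rewrite -[in X in X -> _]th1; exact: th_inj.
have bKer g : K g -> K (beta g) by move=> Kg; apply/aKer; rewrite bK.
have aKer' g : K g -> K (alpha g) by move/aKer.
(* The matrices of [alpha] and [beta] on crossing counts are inverse to each other and intertwine
   the permutation action on ordered pairs with its pullback along [th]; hence the traces agree. *)
pose T q r := cnt Gvb (alpha (lamp s v p r)) q.
pose T' q r := cnt Gvb (beta (lamp s v p r)) q.
have TT' q t : t.1 != t.2 -> (\sum_(r | r.1 != r.2) T q r * T' r t = (q == t)%:R)%R.
  by move=> t12; rewrite -(cnt_lamp Gvb) // -{1}(bK (lamp s v p t)) (pure_cnt aKer') //;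
    apply/bKer/(p_lamp Gvb).
have T'T q t : t.1 != t.2 -> (\sum_(r | r.1 != r.2) T' q r * T r t = (q == t)%:R)%R.
  by move=> t12; rewrite -(cnt_lamp Gvb) // -{1}(aK (lamp s v p t)) (pure_cnt bKer) //;
    apply/aKer'/(p_lamp Gvb).
have Teq t q r : r.1 != r.2 -> T q (move_pair t^-1 r) = T (move_pair (th t) q) r.
  move=> r12; have [H1 E1] := secP t.
  rewrite /T; have := lampJ Gvb r12 H1; rewrite E1 => <-.
  by rewrite !gmulfM group_homV cnt_J //; apply/aKer'/(p_lamp Gvb).
have trace t : (#|[set q : 'I_m.+2 * 'I_m.+2 | (q.1 != q.2) && (move_pair (th t) q == q)]| =
    #|[set q : 'I_m.+2 * 'I_m.+2 | (q.1 != q.2) && (move_pair t^-1 q == q)]|)%N.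
  have cardE (u : 'S_m.+2) : (#|[set q : 'I_m.+2 * 'I_m.+2 | (q.1 != q.2) && (move_pair u q ==
    q)]|%:R =
      \sum_(q | q.1 != q.2) (move_pair u q == q)%:R :> int)%R.
    rewrite -sum1dep_card natr_sum big_mkcondr /=; apply: eq_bigr => q _.
    by case: eqP.
  apply/eqP; rewrite -(eqr_nat int) !cardE; apply/eqP.
  transitivity (\sum_(q | q.1 != q.2) \sum_(r | r.1 != r.2) T (move_pair (th t) q) r * T' r q)%R.
    by apply: eq_bigr => q q12; rewrite TT'.
  rewrite exchange_big /=; apply: eq_bigr => r r12.
  transitivity (\sum_(q | q.1 != q.2) T' r q * T q (move_pair t^-1 r))%R.
    by apply: eq_bigr => q q12; rewrite mulrC Teq.
  by rewrite T'T ?(inj_eq perm_inj) // eq_sym.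
(* The number [k * (k - 1)] of fixed ordered pairs determines [k] here, since [k = m >= 3] for a
   transposition; so [th] preserves transpositions. *)
have transp i : (i <= m)%N -> exists a b, a != b /\ f (v i) = tperm a b.
  move=> im; apply: transposition_of_fixed; rewrite -th_v //.
  have := card_fixed_pairs (th (p (v i))); rewrite trace (p_v2 Gvb) //.
  have := card_fixed_pairs (p (v i)).
  have : (#|fixed_points (p (v i))| + 2 = m.+2)%N.
    by rewrite (vb_pv Gvb) // fixed_points_tperm // inord_eq; lia.
  move: #|fixed_points (p (v i))| #|fixed_points (th (p (v i)))| #|_| => x y z; nia.
have [a [b [ab E0]]] := transp 0%N isT.
have [c [d [cd E1]]] := transp 1%N ltac:(lia).
have [x [X0 X1]] : exists x, f (v 0) ^ x = p (v 0) /\ f (v 1%N) ^ x = p (v 1%N).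
  rewrite !(vb_pv Gvb) //; last lia.
  exact: (transposition_pair E0 E1 f01 ab cd (hom_braid_v Gvb m2 f)).
have [g0 _ pg0] := vsub_lift Gvb x^-1.
have Kh g : K g <-> K (g0 * alpha g * g0^-1).
  split=> [/aKer'|]; first exact: (ker_conj_closed (q := p)).
  move/(ker_conj_closed (q := p) g0^-1); rewrite invgK !mulgA mulVg mul1g mulgKV;
    exact: (proj2 (aKer g)).
have Kh' g : K g -> K (beta (g0^-1 * g * g0)).
  by move=> Kg; apply/Kh; rewrite bK !mulgA mulgV mul1g mulgK.
have hv i : (i < 2)%N -> p (g0 * alpha (v i) * g0^-1) = p (v i).
  move=> i2; rewrite !gmulfM group_homV pg0 invgK -[p (alpha (v i))]/(f (v i)) -mulgA -/(conjg _ _).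
  by case: i i2 => [|[|//]] _.
have hv' i : (i < 2)%N -> p (beta (g0^-1 * v i * g0)) = p (v i).
  move=> i2; set y := beta _.
  have Ey : g0 * alpha y * g0^-1 = v i by rewrite /y bK !mulgA mulgV mul1g mulgK.
  apply: (mulIg (p (v i))^-1); rewrite mulgV -group_homV -gmulfM; apply/Kh.
  rewrite /K; have -> : g0 * alpha (y * (v i)^-1) * g0^-1 = (g0 * alpha y * g0^-1) * (g0 * alpha
    (v i) * g0^-1)^-1.
    by rewrite gmulfM group_homV !invMg invgK !mulgA mulgKV.
  by rewrite gmulfM group_homV hv // Ey mulgV.
have scal (h : G -> G) : (forall a b, h (a * b) = h a * h b) -> (forall g, K g -> K (h g)) ->
    (forall i, (i < 2)%N -> p (h (v i)) = p (v i)) ->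
    forall a, K a -> l0 (h a) = (l0 (h lm) * l0 a)%R.
  move=> hM rh hpv; have h1 : h 1 = 1 by apply: (mulIg (h 1)); rewrite -hM !mul1g.
  have hV e : h e^-1 = (h e)^-1 by apply: (mulIg (h e)); rewrite -hM !mulVg h1.
  apply: (l0_pure_unique (l := fun a => l0 (h a))) => [e e' Ke Ke'|i e i2 Ke].
    by rewrite hM l0_pure //; exact: rh.
  rewrite !hM hV; apply: (anti_transfer (q := p) l0_pure (t := v i)); [exact: hpv | | exact: rh].
  by move=> y Ky; apply: l0_pure_v.
have Kf : finite_index K.
  exists 'S_m.+2, (fun g => p g) => e e' E; by rewrite /K gmulfM group_homV E mulgV.
apply: (reidemeister_signed (g := g0) (t := v 0) (u := lm) bK aK KG Kf l0_pure Kh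
  (ker_conj_closed (q := p) (v 0)) (fun y Ky => l0_pure_v (i := 0) isT Ky)
  (scal (fun a => g0 * alpha a * g0^-1) _ (fun g => proj1 (Kh g)) hv)
  (scal (fun a => beta (g0^-1 * a * g0)) _ Kh' hv') K_lam l0_pure_lam).
- by move=> e e'; rewrite gmulfM !mulgA mulgKV.
- by move=> e e'; rewrite -gmulfM !mulgA mulgK.
Qed.

End FiveStrands.

(** * The presented groups *)

Section WreathProduct.
Variables (n : nat) (H : groupType).
Notation pair := ('I_n * 'I_n)%type.

(** The wreath product over ordered pairs: a homomorphism into it lying over [p] is the same as a
    crossed homomorphism of the kind required by [vb_hom]. *)
Definition wreath : Type := ({ffun pair -> H} * 'S_n)%type.
HB.instance Definition _ := Choice.on wreath.

Definition wreath_mul (x y : wreath) : wreath :=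
  ([ffun q => x.1 q * y.1 (move_pair x.2 q)], x.2 * y.2).
Definition wreath_one : wreath := ([ffun=> 1], 1).
Definition wreath_inv (x : wreath) : wreath :=
  ([ffun q => (x.1 (move_pair x.2^-1 q))^-1], x.2^-1).

Lemma wreath_mulA : associative wreath_mul.
Proof.
move=> x y z; apply: injective_projections; last by rewrite /= mulgA.
by apply/ffunP => q; rewrite !ffunE /= ?ffunE move_pairM mulgA.
Qed.

Lemma wreath_mul1g : left_id wreath_one wreath_mul.
Proof.
move=> [x t]; apply: injective_projections; last by rewrite /= mul1g.
by apply/ffunP => q; rewrite !ffunE /= ?ffunE move_pair1 mul1g.
Qed.

Lemma wreath_mulg1 : right_id wreath_one wreath_mul.
Proof.
move=> [x t]; apply: injective_projections; last by rewrite /= mulg1.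
by apply/ffunP => q; rewrite !ffunE /= ?ffunE mulg1.
Qed.

Lemma wreath_mulVg : left_inverse wreath_one wreath_inv wreath_mul.
Proof.
move=> [x t]; apply: injective_projections; last by rewrite /= mulVg.
by apply/ffunP => q; rewrite !ffunE /= ?ffunE mulVg.
Qed.

Lemma wreath_mulgV : right_inverse wreath_one wreath_inv wreath_mul.
Proof.
move=> [x t]; apply: injective_projections; last by rewrite /= mulgV.
by apply/ffunP => q; rewrite !ffunE /= ?ffunE -move_pairM mulgV move_pair1 mulgV.
Qed.

HB.instance Definition _ := isGroup.Build wreath
  wreath_mulA wreath_mul1g wreath_mulg1 wreath_mulVg wreath_mulgV.

Lemma wreathM (x y : wreath) q : (x * y).1 q = x.1 q * y.1 (move_pair x.2 q).
Proof. by rewrite ffunE. Qed.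

Lemma wreath_eq (x y : wreath) : x.2 = y.2 -> (forall q, x.1 q = y.1 q) -> x = y.
Proof. by move=> xy2 xy1; apply: injective_projections => //; apply/ffunP. Qed.

End WreathProduct.

Lemma neqS (i : nat) : ((i == i.+1) = false) * ((i.+1 == i) = false) *
  ((i == i.+2) = false) * ((i.+2 == i) = false).
Proof. by do !split; lia. Qed.

(* [crossing i c d] is the contribution of [s i] to the ordered pair [(c, d)]. *)
Section Crossings.
Variables (H : groupType) (a b : H).

Definition crossing (i c d : nat) : H :=
  if (c == i) && (d == i.+1) then a else if (c == i.+1) && (d == i) then b else 1.

Ltac crossings := rewrite /crossing /sw /=;
  repeat (progress (rewrite ?eqSS ?eqxx ?neqS /=;
    repeat match goal with E : (_ == _) = false |- _ => rewrite !E /= end));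
  rewrite ?mulg1 ?mul1g //.

Lemma strand3 (i c : nat) : [\/ c = i, c = i.+1, c = i.+2 |
  [/\ (c == i) = false, (c == i.+1) = false & (c == i.+2) = false]].
Proof.
have [->|/negPf c0] := eqVneq c i; first by constructor 1.
have [->|/negPf c1] := eqVneq c i.+1; first by constructor 2.
by have [->|/negPf c2] := eqVneq c i.+2; [constructor 3|constructor 4].
Qed.

Ltac strands3 i c d :=
  case: (strand3 i c) => [->|->|->|[? ? ?]]; case: (strand3 i d) => [->|->|->|[? ? ?]];
  crossings.

Lemma crossing_sss i c d :
  crossing i c d * (crossing i.+1 (sw i c) (sw i d) *
    crossing i (sw i.+1 (sw i c)) (sw i.+1 (sw i d))) =
  crossing i.+1 c d * (crossing i (sw i.+1 c) (sw i.+1 d) *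
    crossing i.+1 (sw i (sw i.+1 c)) (sw i (sw i.+1 d))).
Proof. strands3 i c d. Qed.

Lemma crossing_vvs i c d : crossing i (sw i.+1 (sw i c)) (sw i.+1 (sw i d)) = crossing i.+1 c d.
Proof. strands3 i c d. Qed.

Lemma crossing_vss i c d :
  crossing i.+1 (sw i c) (sw i d) * crossing i (sw i.+1 (sw i c)) (sw i.+1 (sw i d)) =
  crossing i.+1 c d * crossing i (sw i.+1 c) (sw i.+1 d).
Proof. strands3 i c d. Qed.

Lemma crossing_vss' i c d :
  crossing i (sw i.+1 c) (sw i.+1 d) * crossing i.+1 (sw i (sw i.+1 c)) (sw i (sw i.+1 d)) =
  crossing i c d * crossing i.+1 (sw i c) (sw i d).
Proof. strands3 i c d. Qed.

Lemma crossing_far i j c d : (i + 2 <= j)%N || (j + 2 <= i)%N ->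
  crossing i c d * crossing j (sw i c) (sw i d) = crossing j c d * crossing i (sw j c) (sw j d).
Proof.
move=> ij.
have f1 : (i == j) = false by lia. have f2 : (j == i) = false by lia.
have f3 : (i.+1 == j) = false by lia. have f4 : (j == i.+1) = false by lia.
have f5 : (i == j.+1) = false by lia. have f6 : (j.+1 == i) = false by lia.
have st (x : nat) : [\/ x = i, x = i.+1, x = j | x = j.+1 \/
    [/\ (x == i) = false, (x == i.+1) = false, (x == j) = false & (x == j.+1) = false]].
  have [->|/negPf c0] := eqVneq x i; first by constructor 1.
  have [->|/negPf c1] := eqVneq x i.+1; first by constructor 2.
  have [->|/negPf c2] := eqVneq x j; first by constructor 3.
  by have [->|/negPf c3] := eqVneq x j.+1; constructor 4; [left|right].
by case: (st c) => [->|->|->|[->|[? ? ? ?]]]; case: (st d) => [->|->|->|[->|[? ? ? ?]]]; crossings.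
Qed.

Lemma crossing_far_v i j c d : (i + 2 <= j)%N || (j + 2 <= i)%N ->
  crossing i c d = crossing i (sw j c) (sw j d).
Proof.
move=> ij.
have f1 : (i == j) = false by lia. have f2 : (j == i) = false by lia.
have f3 : (i.+1 == j) = false by lia. have f4 : (j == i.+1) = false by lia.
have f5 : (i == j.+1) = false by lia. have f6 : (j.+1 == i) = false by lia.
have st (x : nat) : [\/ x = j, x = j.+1 | (x == j) = false /\ (x == j.+1) = false].
  have [->|/negPf c0] := eqVneq x j; first by constructor 1.
  by have [->|/negPf c1] := eqVneq x j.+1; [constructor 2|constructor 3].
by case: (st c) => [->|->|[? ?]]; case: (st d) => [->|->|[? ?]]; crossings; rewrite ?andbF.
Qed.

End Crossings.

Section PresentedGroups.
Variable m : nat.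
Notation idx := 'I_m.+1.
Notation vgen := (idx + idx)%type.
Variable rel : word vgen -> word vgen -> Prop.
Hypothesis VB_sub : forall u w, @VB_rel m.+2 u w -> rel u w.
Hypothesis UVB_sup : forall u w, rel u w -> @UVB_rel m.+2 u w.
Let G : groupType := presented rel.
Variable p : {multiplicative G -> 'S_m.+2}.
Hypothesis p_gen : forall x, p (pres_gen rel x) = @tau_gen m.+2 x.

Definition gen_s (i : nat) : G := pres_gen rel (inl (inord i : idx)).
Definition gen_v (i : nat) : G := pres_gen rel (inr (inord i : idx)).

Lemma tauE i : (i <= m)%N -> @tau m.+2 (inord i : idx) = tperm (inord i) (inord i.+1).
Proof.
by move=> im; rewrite /tau; congr tperm; apply: val_inj; rewrite /= !inordK //; lia.
Qed.

Section Cocycle.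
Variables (H : groupType) (a b : H).

Definition wreath_gen (x : vgen) : wreath m.+2 H :=
  match x with
  | inl i => ([ffun q => if q == (inord i, inord i.+1) then a
                         else if q == (inord i.+1, inord i) then b else 1], @tau m.+2 i)
  | inr i => ([ffun=> 1], @tau m.+2 i)
  end.

Lemma wreath_gen_s i q : (wreath_gen (inl i)).1 q = crossing a b i q.1 q.2.
Proof.
case: q => c d; rewrite ffunE /crossing !xpair_eqE -!val_eqE /= !inordK //.
  by have := ltn_ord i; lia.
by have := ltn_ord i; lia.
Qed.

Lemma val_tau (i : idx) c : @tau m.+2 i c = sw i c :> nat.
Proof.
have im := ltn_ord i.
have -> : i = inord i by rewrite inord_val.
by rewrite tauE // val_tperm_inord // !inordK.
Qed.

Lemma wreath_eval_snd w : (word_eval wreath_gen w).2 = word_eval (@tau_gen m.+2) w.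
Proof.
elim: w => [|[x e] w IHw]; first by rewrite /word_eval !big_nil.
rewrite /word_eval !big_cons /= -[\prod_(_ <- _) _]/(word_eval _ _) IHw.
by congr (_ * _); case: e; case: x.
Qed.

Lemma word_eval_cons (f : vgen -> wreath m.+2 H) x w :
  word_eval f ((x, false) :: w) = f x * word_eval f w.
Proof. by rewrite /word_eval big_cons. Qed.

Lemma word_eval_nil (f : vgen -> wreath m.+2 H) : word_eval f [::] = 1.
Proof. by rewrite /word_eval big_nil. Qed.

(** Since [rel] lies between the relations of [VB] and those of [UVB], checking the latter serves
    all three groups. Each side is read letter by letter while [sw] moves the pair along. *)
Lemma wreath_gen_respects : respects_rel rel wreath_gen.
Proof.
move=> l r /UVB_sup lr; apply: wreath_eq => [|q].
  by rewrite !wreath_eval_snd; apply: (tau_UVB lr).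
case: lr => {l r} [l r [{}l {}r [i j ij|i j ij|i j ij|i j ij|i|i j ij|i j ij]|i j ij]|i j ij];
  rewrite /sg /vg !word_eval_cons ?word_eval_nil ?mulg1.
- by rewrite !wreathM !wreath_gen_s /= !val_tau ij crossing_sss.
- by rewrite !wreathM !wreath_gen_s /= !val_tau crossing_far.
- by rewrite !wreathM !ffunE !mul1g.
- by rewrite !wreathM !ffunE !mul1g.
- by rewrite !wreathM !ffunE !mul1g.
- rewrite !wreathM !wreath_gen_s !ffunE /= !val_tau mulg1 mul1g.
  by apply: crossing_far_v.
- by rewrite !wreathM !wreath_gen_s !ffunE /= !val_tau !mul1g !mulg1 ij crossing_vvs.
- by rewrite !wreathM !wreath_gen_s !ffunE /= !val_tau !mul1g !mulg1 ij crossing_vss.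
- by rewrite !wreathM !wreath_gen_s !ffunE /= !val_tau !mul1g !mulg1 ij crossing_vss'.
Qed.

Lemma wreath_snd g : (pres_lift wreath_gen_respects g).2 = p g.
Proof.
rewrite -[g]class_of_wordK pres_lift_word wreath_eval_snd.
elim: (word_of_class g) => [|[x e] w IHw].
  by rewrite /word_eval big_nil -[class_of_word _ _]/(1 : G) group_hom1.
have -> : class_of_word rel ((x, e) :: w) =
    (class_of_word rel [:: (x, e)] : G) * class_of_word rel w.
  by rewrite [RHS]class_of_word_cat.
rewrite gmulfM -IHw /word_eval big_cons; congr (_ * _) => /=.
case: e; last by rewrite -p_gen.
by rewrite -p_gen -group_homV; congr (p _); rewrite [LHS]class_of_word_inv.
Qed.

End Cocycle.

Lemma class_of_word_cons x w :
  class_of_word rel ((x, false) :: w) = (pres_gen rel x : G) * class_of_word rel w.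
Proof. by rewrite [RHS]class_of_word_cat. Qed.

Lemma class_of_word_nil : class_of_word rel [::] = 1 :> G.
Proof. by []. Qed.

Definition class_simpl := (class_of_word_cons, class_of_word_nil, @mulg1).

Lemma rel_class l r : rel l r -> class_of_word rel l = class_of_word rel r.
Proof. by move=> lr; apply/class_of_wordP; have := pres_rel [::] [::] lr; rewrite !cats0. Qed.

Lemma presented_ind (A : G -> Prop) : subgroup_pred A ->
  (forall x, A (pres_gen rel x)) -> forall g, A g.
Proof.
move=> [A1 AM AV] Ax g; rewrite -[g]class_of_wordK.
elim: (word_of_class g) => [//|[x e] w IHw].
have -> : class_of_word rel ((x, e) :: w) =
    (class_of_word rel [:: (x, e)] : G) * class_of_word rel w.
  by rewrite [RHS]class_of_word_cat.
apply: AM IHw; case: e; last exact: Ax.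
by have := AV _ (Ax x); rewrite [_^-1]class_of_word_inv.
Qed.

Lemma presented_virtual_braid : virtual_braid gen_s gen_v p.
Proof.
have VB u w : @VB_rel m.+2 u w -> class_of_word rel u = class_of_word rel w.
  by move/VB_sub/rel_class.
have nxt i : (i < m)%N -> (inord i.+1 : idx) = (inord i : idx).+1 :> nat.
  by move=> im; rewrite !inordK //; lia.
have far i j : (i.+1 < j <= m)%N -> far (n := m.+2) (inord i : idx) (inord j : idx).
  by move=> ij; rewrite /far /= !inordK; lia.
have far' i j : (i.+1 < j <= m)%N -> Defs.far (n := m.+2) (inord j : idx) (inord i : idx).
  by move=> ij; rewrite /Defs.far /= !inordK; lia.
split=> [A AG As Av g|i im|i im|i im|i im|i j ij|i j ij|i j ij|i j ij|i im|i im|H a b].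
- apply: presented_ind => // -[i|i]; rewrite -[i]inord_val; [apply: As|apply: Av];
  exact: (ltn_ord i).
- by have := VB _ _ (VB_sss (n := m.+2) (nxt i im)); rewrite !class_simpl.
- by have := VB _ _ (VB_vvv (n := m.+2) (nxt i im)); rewrite !class_simpl.
- by have := VB _ _ (VB_vvs (n := m.+2) (nxt i im)); rewrite !class_simpl.
- by have := VB _ _ (VB_v2 (n := m.+2) (inord i : idx)); rewrite !class_simpl.
- by have := VB _ _ (VB_ss (n := m.+2) (far i j ij)); rewrite !class_simpl.
- by have := VB _ _ (VB_vv (n := m.+2) (far i j ij)); rewrite !class_simpl.
- by have := VB _ _ (VB_sv (n := m.+2) (far i j ij)); rewrite !class_simpl.
- by have := VB _ _ (VB_sv (n := m.+2) (far' i j ij)); rewrite !class_simpl => /esym.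
- by rewrite /gen_s p_gen /= tauE.
- by rewrite /gen_v p_gen /= tauE.
- exists (fun g q => (pres_lift (wreath_gen_respects a b) g).1 q); split=> [g h q|i q im|i q im].
  + by rewrite gmulfM wreathM wreath_snd.
  + by rewrite pres_lift_gen ffunE.
  + by rewrite pres_lift_gen ffunE inordK.
Qed.

End PresentedGroups.

Lemma VB_virtual_braid m : virtual_braid (gen_s (@VB_rel m.+2)) (gen_v (@VB_rel m.+2)) (piP_VB
  m.+2).
Proof.
apply: presented_virtual_braid => // [u w H|x]; first exact/UVB_WB/WB_VB.
exact: piP_VB_gen.
Qed.

Lemma WB_virtual_braid m : virtual_braid (gen_s (@WB_rel m.+2)) (gen_v (@WB_rel m.+2)) (piP_WB
  m.+2).
Proof.
apply: presented_virtual_braid => [u w|u w|x]; [exact: WB_VB|exact: UVB_WB|exact: piP_WB_gen].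
Qed.

Lemma UVB_virtual_braid m :
  virtual_braid (gen_s (@UVB_rel m.+2)) (gen_v (@UVB_rel m.+2)) (piP_UVB m.+2).
Proof.
apply: presented_virtual_braid => [u w H|//|x]; first exact/UVB_WB/WB_VB.
exact: piP_UVB_gen.
Qed.

Lemma UVP_R_infinity m : R_infinity (UVP m.+2).
Proof.
apply: (pure_R_infinity (UVB_virtual_braid m)).
have nxt : (0 < m)%N -> (inord 1 : 'I_m.+1) = (inord 0 : 'I_m.+1).+1 :> nat.
  by move=> m0; rewrite !inordK.
apply: (lamp_commute (UVB_virtual_braid m)) => m0.
- have /(rel_class (rel := @UVB_rel m.+2)) := UVB_WB (WB_vss (n := m.+2) (nxt m0)).
  by rewrite !class_simpl.
- have /(rel_class (rel := @UVB_rel m.+2)) := UVB_vss (n := m.+2) (nxt m0).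
  by rewrite !class_simpl.
Qed.

(** Two points give one ordered pair and its swap, hence a single factor and no two factors whose
    commutation must be checked. *)
Lemma pure2_R_infinity (G : groupType) (s v : nat -> G) (p : {multiplicative G -> 'S_2}) :
  @virtual_braid 0 G s v p -> R_infinity (kernel p).
Proof.
move=> Gvb; apply: (pure_R_infinity Gvb) => -[[[|[|//]] i] [[|[|//]] j]] [[[|[|//]] k] [[|[|//]]
  l]];
  by rewrite /swap_pair -!val_eqE /= ?xpair_eqE -?val_eqE.
Qed.

Lemma virtual_braid_R_infinity m (G : groupType) (s v : nat -> G)
    (p : {multiplicative G -> 'S_m.+2}) : virtual_braid s v p -> R_infinity G.
Proof.
move=> Gvb alpha ab; have [m1|m1] := leqP m 1; first exact: (reidemeister_few_strands Gvb m1 ab).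
have [m2|m2] := eqVneq m 2; last first.
  by apply: (reidemeister_five_strands Gvb _ ab); lia.
by subst m; apply: (reidemeister_four_strands Gvb ab).
Qed.

Theorem theorem3 (n : nat) (hn : (2 <= n)%N) :
  [/\ R_infinity (UVP n),
      R_infinity (UVB n) &
      R_infinity (VB n)] /\
  (n \in [:: 2; 3; 4] -> R_infinity (WB n)) /\
  (n = 2 -> [/\ R_infinity (VP n), R_infinity (WP n) & R_infinity (UVP n)]).
Proof.
case: n hn => [//|[//|m]] _; split; [split | split].
- exact: UVP_R_infinity.
- exact: (virtual_braid_R_infinity (UVB_virtual_braid m)).
- exact: (virtual_braid_R_infinity (VB_virtual_braid m)).
- by move=> _; exact: (virtual_braid_R_infinity (WB_virtual_braid m)).
- case=> ->; split.
  + exact: (pure2_R_infinity (VB_virtual_braid 0)).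
  + exact: (pure2_R_infinity (WB_virtual_braid 0)).
  + exact: UVP_R_infinity.
Qed.
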